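(* Let $n$ be a positive integer and let $1\leq q<\frac{n}{2}$. Set $q^\star=\frac{qn}{n-q}$. There exists a bounded domain $\Omega\subset\mathbb{R}^n$ which is a $(W^{1,p},W^{1,q})$-extension domain for every $p$ with $q^\star<p\leq\infty$, but which is not an $(L^{1,p},L^{1,q})$-extension domain for $1\leq q<p\leq n$ (that is, for any $p$ with $q<p\leq n$).
   Context: A domain is a nonempty connected open set. For a domain $\Omega\subset\mathbb{R}^n$ and $1\leq p\leq\infty$, the homogeneous Sobolev space $L^{1,p}(\Omega)$ consists of all $u\in L^1_{\rm loc}(\Omega)$ whose distributional gradient $\nabla u$ belongs to $L^p(\Omega;\mathbb{R}^n)$, with semi-norm $\|u\|_{L^{1,p}(\Omega)}=\|\nabla u\|_{L^p(\Omega)}$. The Sobolev space $W^{1,p}(\Omega)$ consists of all $u\in L^{1,p}(\Omega)$ that also belong to $L^p(\Omega)$, with norm $\|u\|_{W^{1,p}(\Omega)}=\left(\int_\Omega |u|^p+|\nabla u|^p\,dx\right)^{1/p}$ for $p<\infty$ and $\|u\|_{W^{1,\infty}(\Omega)}=\operatorname{ess\,sup}_\Omega(|u|+|\nabla u|)$. For (semi-)normed function spaces $\mathcal{X}(\Omega)$ on $\Omega$ and $\mathcal{Y}(\mathbb{R}^n)$ on $\mathbb{R}^n$, $\Omega$ is an $(\mathcal{X},\mathcal{Y})$-extension domain if there exists a bounded extension operator $E:\mathcal{X}(\Omega)\to\mathcal{Y}(\mathbb{R}^n)$, that is, there is a constant $C>0$ such that for every $u\in\mathcal{X}(\Omega)$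 one has $E(u)|_\Omega= u$ (almost everywhere) and $\|E(u)\|_{\mathcal{Y}(\mathbb{R}^n)}\leq C\|u\|_{\mathcal{X}(\Omega)}$. (Linearity of $E$ is not part of the definition.) *)

(* Defs.v *)
From HB Require Import structures.
From mathcomp Require Import all_boot all_order all_algebra.
From mathcomp Require Import all_classical all_reals all_analysis.

Set Implicit Arguments.
Unset Strict Implicit.
Unset Printing Implicit Defensive.

Import Order.TTheory GRing.Theory Num.Theory.
Import numFieldNormedType.Exports.

Local Open Scope classical_set_scope.
Local Open Scope ring_scope.

Definition measure_rV_display : measure_display -> measure_display.
Proof. exact. Qed.

(* The product (equivalently, Borel) sigma-algebra on R^n. *)
Section measurable_rV.
Context {R : realType} (n : nat).

Let coord (i : 'I_n) (v : 'rV[R]_n) : measurableTypeR R := v ord0 i.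

Let rV_set0 : g_sigma_preimage coord set0.
Proof. exact: sigma_algebra0. Qed.

Let rV_setC A : g_sigma_preimage coord A -> g_sigma_preimage coord (~` A).
Proof. exact: sigma_algebraC. Qed.

Let rV_bigcup (F : _^nat) : (forall i, g_sigma_preimage coord (F i)) ->
  g_sigma_preimage coord (\bigcup_i (F i)).
Proof. exact: sigma_algebra_bigcup. Qed.

HB.instance Definition _ :=
  @isMeasurable.Build (measure_rV_display default_measure_display)
  'rV[R]_n (g_sigma_preimage coord) rV_set0 rV_setC rV_bigcup.

End measurable_rV.

Section lebesgue_rV.
Variable R : realType.
Implicit Types n : nat.

Definition cons_rV n (xv : measurableTypeR R * 'rV[R]_n) : 'rV[R]_n.+1 :=
  row_mx (xv.1%:M : 'rV[R]_1) xv.2.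

Lemma cons_rV0 n xv : @cons_rV n xv ord0 ord0 = xv.1.
Proof.
rewrite /cons_rV (_ : @ord0 n = lshift n (@ord0 0)); last exact/val_inj.
transitivity ((xv.1%:M : 'rV[R]_1) ord0 ord0); first exact: row_mxEl.
by rewrite mxE mulr1n.
Qed.

Lemma cons_rVS n xv (i : 'I_n) : @cons_rV n xv ord0 (lift ord0 i) = xv.2 ord0 i.
Proof.
rewrite /cons_rV (_ : lift ord0 i = rshift 1%N i); last exact/val_inj.
exact: row_mxEr.
Qed.

Lemma measurable_coord_rV n (i : 'I_n) :
  measurable_fun setT (fun v : 'rV[R]_n => v ord0 i : measurableTypeR R).
Proof.
move=> _ Y mY; rewrite setTI; apply: sub_sigma_algebra => /=.
rewrite -bigcup_seq/=; exists i => /=; first by rewrite mem_index_enum.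
by exists Y => //; rewrite setTI.
Qed.

Lemma measurable_fun_rV d (T : measurableType d) n (f : T -> 'rV[R]_n) :
  (forall i, measurable_fun setT (fun t => f t ord0 i : measurableTypeR R)) ->
  measurable_fun setT f.
Proof.
move=> mf _ Y mY; rewrite setTI.
suff : @measurable _ 'rV[R]_n `<=` [set A | measurable (f @^-1` A)] by exact.
apply: smallest_sub => /=.
  split => /=.
  - by rewrite preimage_set0.
  - by move=> A mA; rewrite setTD preimage_setC; exact: measurableC.
  - by move=> F mF; rewrite preimage_bigcup; exact: bigcupT_measurable.
rewrite -bigcup_seq; apply: bigcup_sub => i _ A [B mB <-] /=.
rewrite setTI -[X in measurable X]setTI.
exact: (mf i measurableT B mB).
Qed.

Lemma measurable_cons_rV n : measurable_fun setT (@cons_rV n).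
Proof.
apply: measurable_fun_rV => i; case: (unliftP ord0 i) => [j ->|->].
- under eq_fun do rewrite cons_rVS.
  apply: (measurableT_comp (measurable_coord_rV j)).
  exact: measurable_snd.
- under eq_fun do rewrite cons_rV0.
  exact: measurable_fst.
Qed.

Fixpoint lebesgue_rV n : set 'rV[R]_n -> \bar R :=
  match n return set 'rV[R]_n -> \bar R with
  | 0 => \d_(0 : 'rV[R]_0)
  | m.+1 => pushforward (lebesgue_measure \x @lebesgue_rV m)%E (@cons_rV m)
  end.

End lebesgue_rV.
Arguments lebesgue_rV {R n}.

Section lebesgue_rV_measure.
Variable R : realType.
Local Open Scope ereal_scope.

Section cons_measure.
Variables (n : nat) (mu : {sigma_finite_measure set 'rV[R]_n -> \bar R}).

Let nu : set 'rV[R]_n.+1 -> \bar R :=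
  pushforward (lebesgue_measure \x mu) (@cons_rV R n).

Let mcons := @measurable_cons_rV R n.

Let nu0 : nu set0 = 0. Proof. exact: measure0. Qed.

Let nu_ge0 A : 0 <= nu A. Proof. exact: measure_ge0. Qed.

Let nu_sigma_additive : semi_sigma_additive nu.
Proof. exact: measure_semi_sigma_additive. Qed.

HB.instance Definition _ := isMeasure.Build _ _ _ nu
  nu0 nu_ge0 nu_sigma_additive.

Let uncons (v : 'rV[R]_n.+1) : measurableTypeR R * 'rV[R]_n :=
  (v ord0 ord0, \row_i v ord0 (lift ord0 i)).

Let uncons_consK : cancel (@cons_rV R n) uncons.
Proof.
move=> [x v]; rewrite /uncons cons_rV0; congr pair.
by apply/rowP => i; rewrite mxE cons_rVS.
Qed.

Let measurable_uncons : measurable_fun setT uncons.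
Proof.
apply/measurable_fun_pairP; split; first exact: measurable_coord_rV.
apply: measurable_fun_rV => i; under eq_fun do rewrite /= mxE.
exact: measurable_coord_rV.
Qed.

Let nu_sigma_finite : sigma_finite setT nu.
Proof.
have /sigma_finiteP[F [FT ndF Foo]] := sigma_finiteT (@lebesgue_measure R).
have /sigma_finiteP[G [GT ndG Goo]] := sigma_finiteT mu.
exists (fun k => uncons @^-1` (F k `*` G k)).
  rewrite -preimage_bigcup -[LHS](preimage_setT uncons); congr (_ @^-1` _).
  rewrite -setXTT FT GT; apply/seteqP; split => [[x v] /= [[j _ Fj] [k _ Gk]]|].
    exists (maxn j k) => //; split.
      by move: x Fj; exact/subsetPset/ndF/leq_maxl.
    by move: v Gk; exact/subsetPset/ndG/leq_maxr.
  by move=> [x v] [k _ []/= ? ?]; split; exists k.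
move=> k; have [? ?] := Foo k; have [? ?] := Goo k; split.
  rewrite -[X in measurable X]setTI; apply: measurable_uncons => //.
  exact: measurableX.
rewrite /nu /pushforward -comp_preimage (_ : uncons \o _ = id).
  by rewrite preimage_id product_measure1E// lte_mul_pinfty// ge0_fin_numE.
by apply/funext => xv /=; exact: uncons_consK.
Qed.

HB.instance Definition _ := Measure_isSigmaFinite.Build _ _ _ nu
  nu_sigma_finite.

Definition cons_measure : {sigma_finite_measure set 'rV[R]_n.+1 -> \bar R} :=
  nu.

End cons_measure.

Let lebesgue_rV_ex n :
  exists mu : {sigma_finite_measure set 'rV[R]_n -> \bar R},
    lebesgue_rV = mu :> (set _ -> _).
Proof.
elim: n => [|n [mu muE]].
  pose d0 : {finite_measure set 'rV[R]_0 -> \bar R} := \d_(0%R : 'rV[R]_0).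
  by exists d0.
by exists (cons_measure mu); rewrite /= muE.
Qed.

Variable n : nat.
Local Notation mu := (@lebesgue_rV R n).

Let mu0 : mu set0 = 0.
Proof. by have [nu ->] := lebesgue_rV_ex n; exact: measure0. Qed.

Let mu_ge0 A : 0 <= mu A.
Proof. by have [nu ->] := lebesgue_rV_ex n; exact: measure_ge0. Qed.

Let mu_sigma_additive : semi_sigma_additive mu.
Proof.
by have [nu ->] := lebesgue_rV_ex n; exact: measure_semi_sigma_additive.
Qed.

HB.instance Definition _ := isMeasure.Build _ _ _ mu
  mu0 mu_ge0 mu_sigma_additive.

Let mu_sigma_finite : sigma_finite setT mu.
Proof. by have [nu ->] := lebesgue_rV_ex n; exact: sigma_finiteT. Qed.

HB.instance Definition _ := Measure_isSigmaFinite.Build _ _ _ mu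
  mu_sigma_finite.

End lebesgue_rV_measure.

Lemma lebesgue_rV_box (R : realType) n (A : 'I_n -> set (measurableTypeR R)) :
  (forall i, measurable (A i)) ->
  lebesgue_rV [set v : 'rV[R]_n | forall i, A i (v ord0 i)] =
  (\prod_(i < n) lebesgue_measure (A i))%E.
Proof.
elim: n A => [|n IH] A mA.
  rewrite big_ord0 /= diracE mem_set//= => -[]//.
rewrite big_ord_recl /= -IH// /pushforward.
rewrite -product_measure1E//; last first.
  rewrite (_ : [set _ | _] = \bigcap_(i in [set: 'I_n])
      (fun v : 'rV[R]_n => v ord0 i : measurableTypeR R)
        @^-1` A (lift ord0 i)).
    apply: fin_bigcap_measurable => // i _; rewrite -[X in measurable X]setTI.
    exact: (measurable_coord_rV i measurableT).
  by apply/seteqP; split => v /= h i; [move=> _|]; exact: h.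
congr product_measure1; apply/seteqP; split => -[x v] /=.
  move=> h; split; first by have := h ord0; rewrite cons_rV0.
  by move=> i; have := h (lift ord0 i); rewrite cons_rVS.
move=> [h0 h] i; case: (unliftP ord0 i) => [j ->|->].
  by rewrite cons_rVS; exact: h.
by rewrite cons_rV0.
Qed.

Section sobolev.
Variables (R : realType) (n : nat).
Local Notation V := 'rV[R]_n.
Local Notation mu := (@lebesgue_rV R n).
Implicit Types (Omega : set V) (p : \bar R) (u : V -> R) (g : V -> V).

Definition is_domain Omega := [/\ Omega !=set0, open Omega & connected Omega].

Definition partial (i : 'I_n) (f : V -> R) : V -> R :=
  fun x => 'D_(delta_mx ord0 i) f x.

Definition smooth (f : V -> R) := forall s : seq 'I_n,
  continuous (foldr partial f s) /\
  forall i x, derivable (foldr partial f s) x (delta_mx ord0 i).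

Definition tsupport (f : V -> R) : set V := closure [set x | f x != 0].

Definition test_function Omega (phi : V -> R) :=
  [/\ smooth phi, compact (tsupport phi) & tsupport phi `<=` Omega].

Definition L1loc Omega u := measurable_fun Omega u /\
  forall K, compact K -> K `<=` Omega -> mu.-integrable K (EFin \o u).

Definition is_weak_gradient Omega u g := forall i : 'I_n,
  L1loc Omega (fun x => g x ord0 i) /\
  forall phi, test_function Omega phi ->
    \int[mu]_(x in Omega) (u x * partial i phi x) =
    - \int[mu]_(x in Omega) (g x ord0 i * phi x).

(* The weak gradient is unique up to a null set, so that the norms below do
   not depend on the choice made by xget. *)
Definition weak_gradient Omega u : V -> V :=
  xget (fun=> 0) [set g | is_weak_gradient Omega u g].

(* The norm of 'rV[R]_n in the library is the sup norm. *)
Definition euclidean_norm (v : V) : R := Num.sqrt (\sum_(i < n) v ord0 i ^+ 2).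

Definition grad_norm Omega u (x : V) : R :=
  euclidean_norm (weak_gradient Omega u x).

(* Extending by 0 outside of Omega does not change the L^p norm, including for
   p = +oo. *)
Definition Lp_norm Omega p u : \bar R := Lnorm mu p ((EFin \o u) \_ Omega).

(* Functions on Omega are represented by total functions whose values outside
   of Omega are irrelevant. *)
Record function_space := FunctionSpace {
  fs_mem : set (V -> R) ;
  fs_norm : (V -> R) -> \bar R }.

Definition L1p p Omega : function_space := {|
  fs_mem := [set u | [/\ L1loc Omega u,
    exists g, is_weak_gradient Omega u g &
    (Lp_norm Omega p (grad_norm Omega u) < +oo)%E]] ;
  fs_norm := fun u => Lp_norm Omega p (grad_norm Omega u) |}.

(* The value for p = -oo is irrelevant. *)
Definition W1p_norm p Omega u : \bar R :=
  match p with
  | r%:E => ((\int[mu]_(x in Omega)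
      (`|u x| `^ r + grad_norm Omega u x `^ r)%:E) `^ r^-1)%E
  | _ => Lp_norm Omega +oo (fun x => `|u x| + grad_norm Omega u x)
  end.

Definition W1p p Omega : function_space := {|
  fs_mem := [set u | fs_mem (L1p p Omega) u /\ (Lp_norm Omega p u < +oo)%E] ;
  fs_norm := W1p_norm p Omega |}.

(* The second clause says that E is well defined on classes of functions that
   are equal almost everywhere. *)
Definition extension_operator (X Y : set V -> function_space) Omega
    (E : (V -> R) -> (V -> R)) (C : R) :=
  [/\ forall u, fs_mem (X Omega) u -> fs_mem (Y setT) (E u),
      forall u v, fs_mem (X Omega) u -> fs_mem (X Omega) v ->
        ae_eq mu Omega u v -> ae_eq mu setT (E u) (E v),
      forall u, fs_mem (X Omega) u -> ae_eq mu Omega (E u) u &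
      forall u, fs_mem (X Omega) u ->
        (fs_norm (Y setT) (E u) <= C%:E * fs_norm (X Omega) u)%E].

Definition extension_domain (X Y : set V -> function_space) Omega :=
  exists E C, 0 < C /\ extension_operator X Y Omega E C.

End sobolev.

(* Main.v *)
(** The domain is a tube [|x_i| < h(x_0)] (i <> 0) around a bounded segment of
    the x_0-axis.  It is made of beads: the m-th one has length and width of
    the order of ell_m, and h is Lipschitz.  The choice
      ell_m = 2 ^ (- min_k (k + |m - sigma_k|))
    makes the sum of the ell_m ^ eps finite for every eps > 0, so that h^-s is
    integrable on the tube for every s < n, although the bead of index sigma_k
    has size at least 2 ^ -k and sigma_k may grow as fast as we like.

    Extension: reflect a function successively in the graphs x_i = h(x_0) and
    x_i = - h(x_0), i <> 0, and cut it off at a distance comparable to h from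
    the axis.  The reflections preserve the Lebesgue measure, and the gradient
    of the extension is controlled by |u| / h + |grad u| and its reflections.
    By Young's inequality, |u| / h is bounded in L^q by the norm of u in L^p
    and that of 1 / h in L^s, where 1 / q = 1 / p + 1 / s, and s < n if and
    only if p > q*.

    Non-extension: let u depend on x_0 only and increase by
    d_m = (m + 1) ^ (- 2 / 3) along the m-th bead.  The integral of |grad u|^n
    is comparable to the sum of the d_m ^ n, which is finite as
    n > 2 q >= 2, but u is so large on the bead of index sigma_k that it is
    not integrable, whereas extensions are locally integrable. *)
Require Import Defs.
From mathcomp Require Import all_boot all_order all_algebra.
From mathcomp Require Import all_classical all_reals all_analysis.
From mathcomp Require Import measurable_realfun ess_sup_inf.
From mathcomp Require Import zify ring lra.

Set Implicit Arguments.
Unset Strict Implicit.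
Unset Printing Implicit Defensive.

Import Order.TTheory GRing.Theory Num.Theory.
Import numFieldNormedType.Exports.

Local Open Scope classical_set_scope.
Local Open Scope ring_scope.

(** * Reflections preserve Lebesgue measure *)

(** Neither traces nor density of smooth functions are used: every weak derivative is checked
    directly against test functions. As a reflection preserves the measure, it can be moved from the
    function to the test function [phi], which leaves an integral over the unreflected side with
    [phi] combined with its reflection. Such a combination does not vanish on the reflecting graph,
    but it is a component of a vector field tangent to that graph, so a thin layer along the graph
    can be cut off at a bounded cost.

    The other obstacle is that [h] is smooth only away from the two ends of the tube. Compact sets
    avoid the ends, which suffices for the reflections. The ends themselves are removed at last by
    cut-offs in [x_0] of slope comparable to 1 / h: since [|v|] is at most [h] times an integrable
    function, the derivative of the cut-off times [v] stays dominated. The same balance between 1 /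
    h and [|v|] pays for the cut-offs across the axis. *)

Lemma lebesgue_measure_reflect (R : realType) (c : R)
    (A : set (measurableTypeR R)) : measurable A ->
  lebesgue_measure ((fun r => c - r) @^-1` A) = lebesgue_measure A.
Proof.
move=> mA.
have mf : measurable_fun setT
    (fun r : measurableTypeR R => c - r : measurableTypeR R).
  by apply: measurable_funB => //; exact: measurable_cst.
pose m := measure_function_pushforward__canonical__measure_function_Measure
  (@lebesgue_measure R) mf.
rewrite -[LHS]/(m A); apply/esym/lebesgue_measure_unique => //= _ [[a b]] _ <-.
rewrite /m /pushforward/= (_ : _ @^-1` _ = `[c - b, c - a[%classic); last first.
  by apply/seteqP; split => r /=; rewrite !in_itv/= => /andP[? ?];
    apply/andP; split; lra.
rewrite !lebesgue_measure_itv/= !lte_fin ltrD2l ltrN2; case: ifPn => // _.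
by rewrite -!EFinB; apply/eqP; rewrite eqe; apply/eqP; ring.
Qed.

Section coord_reflection.
Variable R : realType.

Definition coord_reflect n (i : 'I_n) (c : 'rV[R]_n -> R) (x : 'rV[R]_n) :
  'rV[R]_n := \row_k (if k == i then c x - x ord0 i else x ord0 k).

Lemma coord_reflectE n (i k : 'I_n) c (x : 'rV[R]_n) :
  coord_reflect i c x ord0 k = if k == i then c x - x ord0 i else x ord0 k.
Proof. by rewrite mxE. Qed.

Definition indep_coord n (i : 'I_n) (c : 'rV[R]_n -> R) :=
  forall x y : 'rV[R]_n, (forall k, k != i -> x ord0 k = y ord0 k) -> c x = c y.

Lemma coord_reflectK n (i : 'I_n) c : indep_coord i c ->
  involutive (coord_reflect i c).
Proof.
move=> ci x; apply/rowP => k; rewrite !mxE; case: eqP => [->|//].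
rewrite eqxx (ci _ x) ?subKr// => j ji.
by rewrite mxE (negbTE ji).
Qed.

Lemma measurable_coord_reflect n (i : 'I_n) c : measurable_fun setT c ->
  measurable_fun setT (coord_reflect i c : 'rV[R]_n -> 'rV[R]_n).
Proof.
move=> mc; apply: measurable_fun_rV => k.
under eq_fun do rewrite coord_reflectE.
case: eqP => _; last exact: measurable_coord_rV.
by apply: measurable_funB => //; exact: measurable_coord_rV.
Qed.

(** By Fubini on [cons_rV]. If [i] is not the first coordinate, fix the first one and use induction
    on the section. If it is, the sections must be taken along the first coordinate, hence the
    switch to the product measure in the other order. *)
Lemma lebesgue_rV_reflect n (i : 'I_n) c (A : set 'rV[R]_n) :
  measurable_fun setT c -> indep_coord i c -> measurable A ->
  lebesgue_rV (coord_reflect i c @^-1` A) = lebesgue_rV A.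
Proof.
elim: n i c A => [[]//|n IH] i c A mc ci mA.
have mconsA : measurable (@cons_rV R n @^-1` A).
  by rewrite -[X in measurable X]setTI; exact: measurable_cons_rV.
have mpA : measurable (coord_reflect i c @^-1` A).
  by rewrite -[X in measurable X]setTI; exact: measurable_coord_reflect.
have mconspA : measurable (@cons_rV R n @^-1` (coord_reflect i c @^-1` A)).
  by rewrite -[X in measurable X]setTI; exact: measurable_cons_rV.
rewrite /= /pushforward.
case: (unliftP ord0 i) => [j ij|i0].
- rewrite /product_measure1; apply: eq_integral => r _ /=.
  rewrite -[RHS](IH j (fun v => c (cons_rV (r, v))) (xsection _ _)).
  + congr lebesgue_rV; rewrite /xsection; apply/seteqP.
    suff e v : coord_reflect i c (cons_rV (r, v)) =
        cons_rV (r, coord_reflect j (fun v => c (cons_rV (r, v))) v).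
      by split => v /=; rewrite !inE/= -e.
    apply/rowP => k; rewrite coord_reflectE ij.
    case: (unliftP ord0 k) => [l ->|->].
      by rewrite (inj_eq lift_inj) !cons_rVS/= coord_reflectE.
    by rewrite -[ord0 == _]/false !cons_rV0.
  + apply: (measurableT_comp mc).
    apply: measurable_fun_rV => k; case: (unliftP ord0 k) => [l ->|->].
      by under eq_fun do rewrite cons_rVS; exact: measurable_coord_rV.
    by under eq_fun do rewrite cons_rV0; exact: measurable_cst.
  + move=> x y xy; apply: ci => k ki; case: (unliftP ord0 k) => [l kl|->].
      by rewrite kl !cons_rVS; apply: xy; move: ki; rewrite kl ij (inj_eq lift_inj).
    by rewrite !cons_rV0.
  + exact: measurable_xsection.
- have e X : measurable X -> (lebesgue_measure \x @lebesgue_rV R n)%E X =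
      (lebesgue_measure \x^ @lebesgue_rV R n)%E X.
    move=> mX; apply: product_measure_unique => // B C mB mC.
    exact: product_measure2E.
  rewrite !e// /product_measure2; apply: eq_integral => v _ /=.
  (* The value 0 of the first coordinate is arbitrary, as [c] does not depend on it. *)
  rewrite -[RHS](lebesgue_measure_reflect (c (cons_rV (0, v))))//; last first.
    exact: measurable_ysection.
  congr lebesgue_measure; rewrite /ysection.
  suff e' r : coord_reflect i c (cons_rV (r, v)) =
      cons_rV (c (cons_rV (0, v)) - r, v).
    by apply/seteqP; split => r /=; rewrite !inE/= -e'.
  apply/rowP => k; rewrite coord_reflectE i0.
  case: (unliftP ord0 k) => [l ->|->].
    by rewrite -[_ == _]/false !cons_rVS.
  rewrite eqxx !cons_rV0; congr (_ - _); apply: ci => k'; rewrite i0.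
  by case: (unliftP ord0 k') => [l -> _|->//]; rewrite !cons_rVS.
Qed.

Lemma ge0_integral_reflect n (i : 'I_n) c (f : 'rV[R]_n -> \bar R) :
  measurable_fun setT c -> indep_coord i c ->
  measurable_fun setT f -> (forall x, 0 <= f x)%E ->
  (\int[lebesgue_rV]_x f (coord_reflect i c x) = \int[lebesgue_rV]_x f x)%E.
Proof.
move=> mc ci mf f0.
have mr := measurable_coord_reflect i mc.
pose m := measure_function_pushforward__canonical__measure_function_Measure
  (@lebesgue_rV R n) mr.
transitivity (\int[m]_x f x)%E.
  by rewrite (ge0_integral_pushforward mr)// preimage_setT.
apply: (@eq_measure_integral _ _ _ _ lebesgue_rV m) => A mA _.
exact: lebesgue_rV_reflect.
Qed.

Lemma integrable_reflect n (i : 'I_n) c (f : 'rV[R]_n -> \bar R) :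
  measurable_fun setT c -> indep_coord i c ->
  lebesgue_rV.-integrable setT f ->
  lebesgue_rV.-integrable setT (f \o coord_reflect i c).
Proof.
move=> mc ci /integrableP[mf foo]; apply/integrableP; split.
  by apply: (measurableT_comp mf); exact: measurable_coord_reflect.
rewrite (ge0_integral_reflect (f := fun x => `|f x|)%E)//.
exact: measurableT_comp.
Qed.

Lemma integral_reflect n (i : 'I_n) c (f : 'rV[R]_n -> \bar R) :
  measurable_fun setT c -> indep_coord i c ->
  lebesgue_rV.-integrable setT f ->
  (\int[lebesgue_rV]_x f (coord_reflect i c x) = \int[lebesgue_rV]_x f x)%E.
Proof.
move=> mc ci intf.
have mr := measurable_coord_reflect i mc.
pose m := measure_function_pushforward__canonical__measure_function_Measure
  (@lebesgue_rV R n) mr.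
transitivity (\int[m]_x f x)%E.
  rewrite (integral_pushforward mr) ?preimage_setT//.
    exact: measurable_int intf.
  exact: integrable_reflect.
apply: (@eq_measure_integral _ _ _ _ lebesgue_rV m) => A mA _.
exact: lebesgue_rV_reflect.
Qed.

End coord_reflection.

(** * A toolkit for smooth functions *)

Lemma is_derive_cvgP (R : realType) (V : normedModType R) (f : V ->
  R) (x v : V) (d : R) :
  is_derive x v f d <->
  (h^-1 * (f (h *: v + x) - f x) @[h --> 0^'] --> d).
Proof.
split=> [[df <-]|fd]; first exact: df.
have df : derivable f x v by apply/cvg_ex; exists d.
by split => //; apply/cvg_lim.
Qed.

Lemma is_derive_lineP (R : realType) (V : normedModType R) (f : V ->
  R) (x v : V) (d : R) :
  is_derive x v f d <-> is_derive (0 : R) (1 : R) (fun s : R => f (s *: v + x)) d.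
Proof.
rewrite !is_derive_cvgP; set g1 := fun h : R => _; set g2 := fun h : R => _.
suff -> : g1 = g2 by [].
by apply/funext => h; rewrite /g1 /g2 addr0 scale0r add0r [h *: 1]mulr1.
Qed.

Lemma is_derive_line (R : realType) (V : normedModType R) (f : V ->
  R) (x v : V) (s d : R) :
  is_derive (s *: v + x) v f d -> is_derive s (1 : R) (fun s : R => f (s *: v + x)) d.
Proof.
rewrite !is_derive_cvgP; set g1 := fun h : R => _; set g2 := fun h : R => _.
suff -> : g1 = g2 by [].
by apply/funext => h; rewrite /g1 /g2 addrA -scalerDl [h *: 1]mulr1.
Qed.

Lemma is_derive_compR (R : realType) (V : normedModType R) (a : R -> R)
    (f : V -> R) (x v : V) (da df : R) :
  is_derive (f x) 1 a da -> is_derive x v f df ->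
  is_derive x v (a \o f) (da * df).
Proof.
move=> ha hf; apply/is_derive_lineP.
apply: (@is_derive1_comp _ a (fun s : R => f (s *: v + x))).
  by rewrite scale0r add0r.
exact: (is_derive_lineP f x v df).1.
Qed.

(** Stated with distances so that [a] and [b] come in any order; the bound on [c] makes it tend to
    [a] when [b] does. *)
Lemma MVT_dist (R : realType) (f df : R -> R) (a b : R) :
  (forall x : R, is_derive x 1 f (df x)) ->
  exists2 c, `|c - a| <= `|b - a| & f b - f a = df c * (b - a).
Proof.
move=> h.
have cf : continuous f.
  by move=> x; apply/differentiable_continuous/derivable1_diffP; have [] := h x.
have [ab|ba] := leP a b.
  have [|c] := @MVT_segment _ f df a b ab; first exact: continuous_subspaceT.
  rewrite in_itv/= => /andP[ac cb] e; exists c => //.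
  by rewrite !ger0_norm ?subr_ge0// lerD2r.
have [|c] := @MVT_segment _ f df b a (ltW ba); first exact: continuous_subspaceT.
rewrite in_itv/= => /andP[ac cb] e; exists c.
  by rewrite !ler0_norm ?subr_le0// ?(ltW ba)// lerN2 lerD2r.
by rewrite -opprB e -mulrN opprB.
Qed.

(* No Frechet differentiability is needed: the mean value theorem in the
   direction [u] and the continuity of [fu] at [y] are enough. *)
Lemma is_derive_curve (R : realType) (V : normedModType R) (f fu : V -> R)
    (y u v : V) (b : R -> R) (db dv : R) :
  (forall z, is_derive z u f (fu z)) -> {for y, continuous fu} ->
  is_derive y v f dv -> b 0 = 0 -> is_derive (0 : R) (1 : R) b db ->
  is_derive (0 : R) (1 : R) (fun s : R => f (s *: u + (b s *: v + y)))
    (fu y + dv * db).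
Proof.
move=> hu cu hv b0 hb.
have h2 : is_derive (0 : R) (1 : R) (fun s : R => f (b s *: v + y)) (dv * db).
  apply: (@is_derive1_comp _ (fun r : R => f (r *: v + y)) b) => //.
  by rewrite b0; exact: (is_derive_lineP f y v dv).1.
apply/is_derive_cvgP.
under eq_fun do rewrite addr0 [_ *: 1]mulr1.
rewrite scale0r add0r b0 scale0r add0r.
have -> : (fun h : R => h^-1 * (f (h *: u + (b h *: v + y)) - f y)) =
   (fun h => h^-1 * (f (h *: u + (b h *: v + y)) - f (b h *: v + y))) \+
   (fun h => h^-1 * (f (b h *: v + y) - f y)).
  by apply/funext => h /=; rewrite -mulrDr; congr (_ * _); ring.
apply: cvgD; last first.
  move/is_derive_cvgP : h2; under eq_fun do rewrite addr0 [_ *: 1]mulr1.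
  by rewrite b0 scale0r add0r.
have cb : b x @[x --> (0 : R)] --> (0 : R).
  rewrite -[X in _ --> X]b0.
  by apply: (@differentiable_continuous _ _ _ 0); apply/derivable1_diffP; case: hb.
have hm (h : R) : exists c : R, `|c| <= `|h| /\
   f (h *: u + (b h *: v + y)) - f (b h *: v + y) = fu (c *: u + (b h *: v + y)) * h.
  have [c] := @MVT_dist _ (fun s : R => f (s *: u + (b h *: v + y)))
    (fun s => fu (s *: u + (b h *: v + y))) 0 h (fun s => is_derive_line (hu _)).
  by rewrite !subr0 scale0r add0r => ? ?; exists c.
have /choice[c hc] := hm.
have cc : c x @[x --> (0 : R)] --> (0 : R).
  apply/cvgr0Pnorm_lt => e e0; apply/nbhs_ballP; exists e => //= h.
  by rewrite /ball/= sub0r normrN => he; have [hc1 _] := hc h; exact: le_lt_trans he.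
have cg : c h *: u + (b h *: v + y) @[h --> (0 : R)] --> y.
  rewrite -[X in _ --> X]add0r; apply: cvgD.
    by rewrite -[X in _ --> X](scale0r u); apply: cvgZr_tmp.
  rewrite -[X in _ --> X]add0r; apply: cvgD; last exact: cvg_cst.
  by rewrite -[X in _ --> X](scale0r v); apply: cvgZr_tmp.
have : fu (c h *: u + (b h *: v + y)) @[h --> (0 : R)] --> fu y.
  exact: (cvg_comp _ _ cg cu).
move=> H; have {}H : fu (c h *: u + (b h *: v + y)) @[h --> (0 : R)^'] --> fu y.
  exact: cvg_within_filter.
apply: cvg_trans H; apply: near_eq_cvg.
have : \forall h \near (0 : R)^', h != 0 by exact: nbhs_dnbhs_neq.
apply: filterS => h h0.
by have [_ ->] := hc h; rewrite mulrCA mulVf ?mulr1.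
Qed.

Lemma is_derive_affine (R : realType) (a b t : R) :
  is_derive t (1 : R) (fun s => a * s + b) a.
Proof.
have -> : (fun s => a * s + b) = (a \*: id) + cst b by [].
by apply: is_derive_eq; rewrite addr0 [_ *: _]mulr1.
Qed.

Section smooth.
Variables (R : realType) (n : nat).
Local Notation V := 'rV[R]_n.
Local Notation e i := (delta_mx ord0 i : V).
Implicit Types (f g : V -> R) (i j k : 'I_n).

(** A coinduction principle: a class closed under partial derivatives contains all the iterated
    ones, which are what [smooth] speaks of. *)
Lemma smooth_coind (P : (V -> R) -> Prop) :
  (forall f, P f -> continuous f /\
     forall i, exists2 g, P g & forall x, is_derive x (e i) f (g x)) ->
  forall f, P f -> smooth f.
Proof.
move=> h f Pf s.
have Ps : P (foldr (@partial R n) f s).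
  elim: s => //= i s /h[_ /(_ i)[g Pg gE]].
  suff -> : partial i (foldr (@partial R n) f s) = g by [].
  by apply/funext => x; rewrite /partial; have [] := gE x.
have [c d] := h _ Ps; split => // i x.
by have [g _ /(_ x)[]] := d i.
Qed.

Lemma smooth_continuous f : smooth f -> continuous f.
Proof. by move=> /(_ [::])[]. Qed.

Lemma smooth_is_derive f : smooth f ->
  forall i x, is_derive x (e i) f (partial i f x).
Proof. by move=> /(_ [::])[_ h] i x; exact: derivableP. Qed.

Lemma smooth_partial f i : smooth f -> smooth (partial i f).
Proof. by move=> sf s; have := sf (rcons s i); rewrite foldr_rcons. Qed.

Lemma partialE i f x d : is_derive x (e i) f d -> partial i f x = d.
Proof. by case. Qed.

(** The witness is the whole sequence of derivatives, so that passing to the derivative is a mere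
    shift of [s]. *)
Definition smooth1 (a : R -> R) := exists s : nat -> R -> R,
  s 0%N = a /\ forall (k : nat) x, is_derive x (1 : R) (s k) (s k.+1 x).

(* This class is closed under partial derivatives, so that [smooth_coind]
   applies to it. *)
Inductive smooth_closure : (V -> R) -> Prop :=
| sc_base f of smooth f : smooth_closure f
| sc_cst (c : R) : smooth_closure (fun=> c)
| sc_coord i : smooth_closure (fun x => x ord0 i)
| sc_add f g of smooth_closure f & smooth_closure g :
    smooth_closure (fun x => f x + g x)
| sc_mul f g of smooth_closure f & smooth_closure g :
    smooth_closure (fun x => f x * g x)
| sc_comp a f of smooth1 a & smooth_closure f : smooth_closure (fun x => a (f x))
| sc_reflect i c f of smooth_closure c & indep_coord i c & smooth f :
    smooth_closure (fun x => f (coord_reflect i c x)).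

Lemma smooth1_continuous a : smooth1 a -> continuous a.
Proof.
move=> [s [<- h]] x; apply: differentiable_continuous; apply/derivable1_diffP.
by case: (h O x).
Qed.

(** Along a coordinate line the reflected point moves at unit speed along [e k], if [k != i], and by
    a scalar function of [s] along [e i]: the kind of curve that [is_derive_curve] handles. *)
Lemma coord_reflect_curve i k c (x : V) (s : R) : indep_coord i c ->
  coord_reflect i c (s *: e k + x) =
  s *: (if k == i then 0 else e k) +
  ((c (s *: e k + x) - c x - (k == i)%:R * s) *: e i + coord_reflect i c x).
Proof.
move=> ci; apply/rowP => l; rewrite !mxE.
have [->|ki] := eqVneq k i.
  rewrite (ci _ x); last first.
    by move=> m mi; rewrite !mxE (negbTE mi) andbF mulr0 add0r.
  by rewrite !mxE; case: (l == i) => /=; ring.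
rewrite !mxE /=; case: (eqVneq l i) => [->|li].
  by rewrite [i == k]eq_sym (negbTE ki)/=; ring.
by rewrite mulr0 add0r.
Qed.

Lemma rV_continuous (T : topologicalType) (F : T -> V) :
  (forall i, continuous (fun t => F t ord0 i)) -> continuous F.
Proof.
move=> cF t; apply/cvg_ballP => r r0.
have : \forall s \near t, forall i, ball (F t ord0 i) r (F s ord0 i).
  by apply: filter_forall => i; have /cvg_ballP := cF i t; exact.
by apply: filterS => s hs; split => // i j; rewrite !ord1; exact: hs.
Qed.

Lemma continuous_coord_reflect i c : continuous c ->
  continuous (coord_reflect i c : V -> V).
Proof.
move=> cc; apply: rV_continuous => k y.
have [ki|ki] := eqVneq k i.
  have -> : (fun t : V => coord_reflect i c t ord0 k) = (fun t => c t - t ord0 i).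
    by apply/funext => t; rewrite coord_reflectE ki eqxx.
  exact: (cvgB (cc y) (@coord_continuous _ _ _ _ _ y)).
have -> : (fun t : V => coord_reflect i c t ord0 k) = (fun t => t ord0 k).
  by apply/funext => t; rewrite coord_reflectE (negbTE ki).
exact: coord_continuous.
Qed.

Lemma is_derive_coord i j (x : V) : is_derive x (e i) (fun x => x ord0 j) (i == j)%:R.
Proof.
apply/is_derive_lineP; rewrite /=.
have -> : (fun s : R => (s *: e i + x) ord0 j) = (fun s => (i == j)%:R * s + x ord0 j).
  by apply/funext => s; rewrite !mxE eqxx/= eq_sym mulrC.
exact: is_derive_affine.
Qed.

Lemma is_derive_reflect i k c f (x : V) (dc : R) : smooth f ->
  indep_coord i c -> is_derive x (e k) c dc ->
  is_derive x (e k) (fun x => f (coord_reflect i c x))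
    ((k != i)%:R * partial k f (coord_reflect i c x) +
     (dc - (k == i)%:R) * partial i f (coord_reflect i c x)).
Proof.
move=> sf ci hc; apply/is_derive_lineP.
under eq_fun do rewrite coord_reflect_curve//.
have hb : is_derive (0 : R) (1 : R)
    (fun s => c (s *: e k + x) - c x - (k == i)%:R * s) (dc - (k == i)%:R).
  have h1 := (is_derive_lineP _ _ _ _).1 hc.
  have h2 := is_deriveB h1 (is_derive_affine (k == i)%:R (c x) 0).
  have -> : (fun s => c (s *: e k + x) - c x - (k == i)%:R * s) =
    (fun s => c (s *: e k + x)) - (fun s => (k == i)%:R * s + c x).
    by apply/funext => s /=; rewrite !fctE; ring.
  exact: h2.
rewrite [X in is_derive _ _ _ (_ + X)]mulrC.
apply: (is_derive_curve (fu := fun y => (k != i)%:R * partial k f y)) => //.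
- move=> z; case: eqVneq => [_|_] /=.
    by rewrite mul0r; exact: is_derive0.
  by rewrite mul1r; exact: smooth_is_derive.
- have := smooth_continuous (smooth_partial k sf).
  by move=> /(_ (coord_reflect i c x)) cf; exact: (cvgM (cvg_cst _) cf).
- exact: smooth_is_derive.
- by rewrite scale0r add0r subrr sub0r mulr0 oppr0.
Qed.

Lemma smooth_closure_smooth f : smooth_closure f -> smooth f.
Proof.
apply: smooth_coind => {}f; elim=> {f}.
- move=> f sf; split; first exact: smooth_continuous.
  move=> i; exists (partial i f); first exact/sc_base/smooth_partial.
  by move=> x; exact: smooth_is_derive.
- move=> c; split; first exact: cst_continuous.
  by move=> i; exists (fun=> 0); [exact: sc_cst|move=> x; exact: is_derive_cst].
- move=> j; split; first exact: coord_continuous.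
  move=> i; exists (fun=> (i == j)%:R); first exact: sc_cst.
  by move=> x; exact: is_derive_coord.
- move=> f g scf [cf df] scg [cg dg]; split.
    by move=> x; exact: (cvgD (cf x) (cg x)).
  move=> i; have [df' sdf hf] := df i; have [dg' sdg hg] := dg i.
  exists (fun x => df' x + dg' x); first exact: sc_add.
  by move=> x; exact: is_deriveD.
- move=> f g scf [cf df] scg [cg dg]; split.
    by move=> x; exact: (cvgM (cf x) (cg x)).
  move=> i; have [df' sdf hf] := df i; have [dg' sdg hg] := dg i.
  exists (fun x => f x * dg' x + g x * df' x).
    by apply: sc_add; exact: sc_mul.
  by move=> x; exact: is_deriveM.
- move=> a f sa scf [cf df]; split.
    by move=> x; apply: (cvg_comp _ _ (cf x)); exact: smooth1_continuous.
  move=> i; have [df' sdf hf] := df i.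
  have [s [sE hs]] := sa.
  exists (fun x => s 1%N (f x) * df' x).
    apply: sc_mul => //; apply: sc_comp => //.
    by exists (fun k : nat => s k.+1).
  move=> x; apply: is_derive_compR => //.
  by rewrite -sE.
- move=> i c f scc [cc dc] ci sf; split.
    move=> x; have cr := continuous_coord_reflect (i := i) cc.
    apply: (@continuous_comp _ _ _ (coord_reflect i c) f x (cr x)).
    exact: smooth_continuous.
  move=> k; have [dc' sdc hc] := dc k.
  eexists; last by move=> x; exact: is_derive_reflect.
  apply: sc_add; apply: sc_mul.
  + exact: sc_cst.
  + by apply: sc_reflect => //; exact: smooth_partial.
  + by apply: sc_add => //; exact: sc_cst.
  + by apply: sc_reflect => //; exact: smooth_partial.
Qed.

End smooth.

(** * Smooth functions of one variable and a smooth step *)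

Section smooth1.
Variable R : realType.
Implicit Types (a b f g : R -> R) (x : R).

Lemma smooth1_coind (P : (R -> R) -> Prop) :
  (forall f, P f -> exists2 g, P g & forall x, is_derive x (1 : R) f (g x)) ->
  forall f, P f -> smooth1 f.
Proof.
move=> h f Pf; pose s k := iter k (fun f x => 'D_1 f x) f.
have Ps k : P (s k).
  elim: k => //= k /h[g Pg gE].
  suff -> : (fun x => 'D_1 (s k) x) = g by [].
  by apply/funext => x; have [] := gE x.
exists s; split => // k x; have [g Pg gE] := h _ (Ps k).
by apply: derivableP; have [] := gE x.
Qed.

(* The exponent [m] is there to have a family that is closed, up to linear
   combinations, under derivation. *)
Definition flat_exp m x := if 0 < x then x^-1 ^+ m * expR (- x^-1) else 0.

(** One term of the exponential series at 1 / x, of degree [m + 2], is enough. The square on the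
    right makes the difference quotient at 0 tend to 0. *)
Lemma flat_exp_bound m x : `|flat_exp m x| <= (m.+2)`!%:R * x ^+ 2.
Proof.
rewrite /flat_exp; case: ifPn => x0; last first.
  by rewrite normr0 mulr_ge0 ?sqr_ge0.
rewrite ger0_norm; last by rewrite mulr_ge0 ?expR_ge0// exprn_ge0// invr_ge0 ltW.
rewrite expRN ler_pdivrMr ?expR_gt0//.
have y0 : 0 <= x^-1 by rewrite invr_ge0 ltW.
have := expR_ge1Dxn m.+1 y0; move: (expR _) => E hE.
have {}hE : x^-1 ^+ m.+2 / (m.+2)`!%:R <= E by lra.
rewrite ler_pdivrMr ?ltr0n ?fact_gt0// in hE.
rewrite [X in _ <= X](_ : _ = x ^+ 2 * (E * (m.+2)`!%:R)); last by ring.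
rewrite (le_trans _ (ler_wpM2l (sqr_ge0 x) hE))// !exprS expr0 mulr1.
rewrite (_ : x * x * _ = (x / x) * (x / x) * x^-1 ^+ m); last by ring.
by rewrite divff ?gt_eqF// !mul1r.
Qed.

Lemma is_derive_flat_exp m x : is_derive x (1 : R) (flat_exp m)
  (- m%:R * flat_exp m.+1 x + flat_exp m.+2 x).
Proof.
have [x0|x0|->] := ltgtP x 0.
- rewrite /flat_exp ltNge (ltW x0)/= mulr0 addr0.
  apply: (@near_eq_is_derive _ _ _ (fun=> 0)) => //.
  near=> y; rewrite ltNge ltW//.
  by near: y; exact: lt_nbhsl.
- have h1 : is_derive x (1 : R) (fun x => x^-1) (- x ^- 2 *: 1).
    by apply: is_deriveV; rewrite // gt_eqF.
  have h2 := is_deriveX m h1.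
  have h3 : is_derive x (1 : R) (expR \o (fun x => - x^-1))
      (expR (- x^-1) * - (- x ^- 2 *: 1)).
    apply: is_derive1_comp; exact: is_deriveN.
  apply: (@near_eq_is_derive _ _ _
    ((fun x => x^-1) ^+ m * (expR \o (fun x => - x^-1)))).
    near=> y; rewrite /flat_exp ifT; first by rewrite /= !fctE.
    by near: y; exact: lt_nbhsr.
  apply: is_derive_eq; rewrite /flat_exp x0 !fctE/= /GRing.scale/=.
  rewrite !exprS; case: m {h2} => [|m] /=; first by field; rewrite gt_eqF.
  by rewrite !exprS; field; rewrite gt_eqF.
- have f0 k : flat_exp k 0 = 0 by rewrite /flat_exp ltxx.
  rewrite !f0 mulr0 addr0; apply/is_derive_cvgP; rewrite f0.
  apply/cvgr0Pnorm_lt => e e0; near=> h.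
  rewrite addr0 subr0 [_ *: _]mulr1 normrM normfV.
  have h0 : h != 0 by near: h; exact: nbhs_dnbhs_neq.
  rewrite ltr_pdivrMl ?normr_gt0//.
  apply: (le_lt_trans (flat_exp_bound _ _)).
  rewrite -(real_normK (num_real h)) expr2 mulrCA ltr_pM2l ?normr_gt0//.
  rewrite -ltr_pdivlMl ?ltr0n ?fact_gt0//.
  near: h; apply: dnbhs0_lt; rewrite mulr_gt0// invr_gt0 ltr0n fact_gt0//.
Unshelve. all: by end_near. Qed.

Inductive smooth1_closure : (R -> R) -> Prop :=
| s1_base f of smooth1 f : smooth1_closure f
| s1_cst (c : R) : smooth1_closure (fun=> c)
| s1_id : smooth1_closure id
| s1_flat m : smooth1_closure (flat_exp m)
| s1_add f g of smooth1_closure f & smooth1_closure g :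
    smooth1_closure (fun x => f x + g x)
| s1_mul f g of smooth1_closure f & smooth1_closure g :
    smooth1_closure (fun x => f x * g x)
| s1_inv f of smooth1_closure f & (forall x, f x != 0) :
    smooth1_closure (fun x => (f x)^-1)
| s1_comp f g of smooth1 f & smooth1_closure g :
    smooth1_closure (fun x => f (g x)).

Lemma smooth1_closure_smooth1 f : smooth1_closure f -> smooth1 f.
Proof.
apply: smooth1_coind => {}f; elim=> {f}.
- move=> f [s [<- sE]]; exists (s 1%N); last exact: sE.
  by apply: s1_base; exists (fun k : nat => s k.+1).
- by move=> c; exists (fun=> 0); [exact: s1_cst|move=> x; exact: is_derive_cst].
- by exists (fun=> 1); [exact: s1_cst|move=> x; exact: is_derive_id].
- move=> m; eexists; last by move=> x; exact: is_derive_flat_exp.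
  by apply: s1_add; [apply: s1_mul; [exact: s1_cst|]|]; exact: s1_flat.
- move=> f g _ [df sdf hf] _ [dg sdg hg].
  by exists (fun x => df x + dg x); [exact: s1_add|move=> x; exact: is_deriveD].
- move=> f g sf [df sdf hf] sg [dg sdg hg].
  exists (fun x => f x * dg x + g x * df x); last by move=> x; exact: is_deriveM.
  by apply: s1_add; exact: s1_mul.
- move=> f sf [df sdf hf] f0.
  exists (fun x => (- 1) * ((f x)^-1 * (f x)^-1) * df x).
    apply: s1_mul => //; apply: s1_mul; first exact: s1_cst.
    by apply: s1_mul; exact: s1_inv.
  move=> x; apply: is_derive_eq (is_deriveV (f0 x) (hf x)) _.
  have -> : - f x ^- 2 *: df x = - f x ^- 2 * df x by [].
  by rewrite -exprVn expr2; ring.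
- move=> f g [s [<- sE]] sg [dg sdg hg].
  exists (fun x => s 1%N (g x) * dg x).
    by apply: s1_mul => //; apply: s1_comp => //; exists (fun k : nat => s k.+1).
  by move=> x; exact: is_derive1_comp.
Qed.

Lemma smooth1_affine (a b : R) : smooth1 (fun x => a * x + b).
Proof.
apply: smooth1_closure_smooth1; apply: s1_add; last exact: s1_cst.
by apply: s1_mul; [exact: s1_cst|exact: s1_id].
Qed.

Lemma smooth1_derive f : smooth1 f ->
  smooth1 (derive1 f) /\ forall x, is_derive x (1 : R) f (derive1 f x).
Proof.
move=> [s [<- sE]]; have e : derive1 (s 0%N) = s 1%N.
  by apply/funext => x; rewrite derive1E; have [] := sE 0%N x.
by rewrite e; split; [exists (fun k : nat => s k.+1)|exact: sE].
Qed.

(** The transition happens between 1/4 and 3/4, strictly inside [0, 1], so that the function is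
    locally constant at 0, at 1 and beyond. *)
Definition smoothstep x := flat_exp 0 (x - 4^-1) /
  (flat_exp 0 (x - 4^-1) + flat_exp 0 (3 / 4 - x)).

Let flat_exp_ge0 x : 0 <= flat_exp 0 x.
Proof. by rewrite /flat_exp; case: ifPn => // _; rewrite mul1r expR_ge0. Qed.

Let flat_exp_gt0 x : 0 < x -> 0 < flat_exp 0 x.
Proof. by move=> x0; rewrite /flat_exp x0 mul1r expR_gt0. Qed.

Let flat_exp_eq0 x : x <= 0 -> flat_exp 0 x = 0.
Proof. by move=> x0; rewrite /flat_exp ltNge x0. Qed.

Let smoothstep_den x : 0 < flat_exp 0 (x - 4^-1) + flat_exp 0 (3 / 4 - x).
Proof.
have [xlt|xge] := ltP x (3 / 4).
  by rewrite ltr_wpDl// flat_exp_gt0// subr_gt0.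
rewrite ltr_wpDr// flat_exp_gt0//; lra.
Qed.

Lemma smoothstep_smooth : smooth1 smoothstep.
Proof.
have s0 : smooth1 (flat_exp 0) by apply: smooth1_closure_smooth1; exact: s1_flat.
have sa : smooth1_closure (fun x => flat_exp 0 (x - 4^-1)).
  by apply: s1_comp => //; apply: s1_add; [exact: s1_id|exact: s1_cst].
apply: smooth1_closure_smooth1; apply: s1_mul => //; apply: s1_inv.
  apply: s1_add => //; apply: s1_comp => //.
  apply: s1_add; first exact: s1_cst.
  have -> : -%R = (fun x : R => (- 1) * x) by apply/funext => x; rewrite mulN1r.
  by apply: s1_mul; [exact: s1_cst|exact: s1_id].
by move=> x; rewrite gt_eqF.
Qed.

Lemma smoothstep_ge0 x : 0 <= smoothstep x.
Proof. by rewrite divr_ge0// ltW. Qed.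

Lemma smoothstep_le1 x : smoothstep x <= 1.
Proof. by rewrite ler_pdivrMr// mul1r lerDl. Qed.

Lemma smoothstep_eq0 x : x <= 4^-1 -> smoothstep x = 0.
Proof. by move=> x4; rewrite /smoothstep flat_exp_eq0 ?mul0r// subr_le0. Qed.

Lemma smoothstep_eq1 x : 3 / 4 <= x -> smoothstep x = 1.
Proof.
move=> x4; have := smoothstep_den x.
rewrite /smoothstep [flat_exp 0 (_ - x)]flat_exp_eq0 ?subr_le0// addr0 => h.
by rewrite divff// gt_eqF.
Qed.

Lemma smoothstep_derive0 x : (x <= 0) || (1 <= x) -> derive1 smoothstep x = 0.
Proof.
rewrite derive1E => /orP[x0|x1].
  have : is_derive x (1 : R) smoothstep 0; last by case.
  apply: (@near_eq_is_derive _ _ _ (fun=> 0)) => //.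
  near=> y; rewrite smoothstep_eq0// ltW//.
  by near: y; apply: lt_nbhsl; lra.
have : is_derive x (1 : R) smoothstep 0; last by case.
apply: (@near_eq_is_derive _ _ _ (fun=> 1 : R)) => //.
near=> y; rewrite smoothstep_eq1// ltW//.
by near: y; apply: lt_nbhsr; lra.
Unshelve. all: by end_near. Qed.

Lemma smoothstep_derive_bounded :
  exists2 M : R, 0 < M & forall x, `|derive1 smoothstep x| <= M.
Proof.
have [/smooth1_continuous cd _] := smooth1_derive smoothstep_smooth.
have [|c _ hc] := @EVT_max R (fun x => `|derive1 smoothstep x|) 0 1 ler01.
  apply: continuous_subspaceT => x.
  by apply: cvg_norm; exact: cd.
exists (`|derive1 smoothstep c| + 1); first by rewrite ltr_wpDl.
move=> x; have [/smoothstep_derive0 ->|] := boolP ((x <= 0) || (1 <= x)).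
  by rewrite normr0 addr_ge0.
rewrite negb_or -!ltNge => /andP[x0 x1].
by rewrite (le_trans (hc _ _)) ?lerDl// in_itv/= !ltW.
Qed.

End smooth1.
#[global] Opaque smoothstep.

(** * Test functions *)

Section rV_topology.
Variables (R : realType) (n : nat).
Local Notation V := 'rV[R]_n.
Local Notation mu := (@lebesgue_rV R n).
Implicit Types (a b : 'I_n -> R) (A : set V).

Definition open_box a b : set V := [set x | forall i, a i < x ord0 i < b i].

Lemma measurable_coord_set (A : 'I_n -> set (measurableTypeR R)) :
  (forall i, measurable (A i)) ->
  measurable [set x : V | forall i, A i (x ord0 i)].
Proof.
move=> mA; rewrite (_ : [set _ | _] = \bigcap_(i in [set: 'I_n])
    (fun v : V => v ord0 i : measurableTypeR R) @^-1` A i).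
  apply: fin_bigcap_measurable => // i _; rewrite -[X in measurable X]setTI.
  exact: (measurable_coord_rV i measurableT).
by apply/seteqP; split => v /= h i; [move=> _|]; exact: h.
Qed.

Lemma measurable_open_box a b : measurable (open_box a b).
Proof.
have := @measurable_coord_set (fun i => `]a i, b i[%classic) (fun=> measurable_itv _).
congr measurable; apply/seteqP; split => x h i; have := h i; rewrite /= in_itv//.
Qed.

Lemma open_coord_lt i (c : R) : open [set x : V | x ord0 i < c].
Proof. by apply: open_comp (@open_lt _ c) => x _; exact: coord_continuous. Qed.

Lemma open_coord_gt i (c : R) : open [set x : V | c < x ord0 i].
Proof. by apply: open_comp (@open_gt _ c) => x _; exact: coord_continuous. Qed.

Lemma open_forall (T : topologicalType) (I : finType) (B : I -> set T) :
  (forall i, open (B i)) -> open [set x | forall i, B i x].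
Proof.
move=> oB; rewrite openE => x /= Bx; apply: filter_forall => i.
exact: open_nbhs_nbhs.
Qed.

(** Rational end points leave countably many boxes: this gives the measurability of open sets, and
    later lets null sets be gathered over all boxes. *)
Lemma open_nbhs_box A (x : V) : open A -> A x ->
  exists ab : {ffun 'I_n -> rat * rat},
    open_box (fun i => ratr (ab i).1) (fun i => ratr (ab i).2) x /\
    [set y : V | forall i, ratr (ab i).1 <= y ord0 i <= ratr (ab i).2] `<=` A.
Proof.
move=> oA Ax; have [r /= r0 rA] := (nbhs_ballP _ _).1 (open_nbhs_nbhs (conj oA Ax)).
have h i : exists pq : rat * rat, x ord0 i - r < ratr pq.1 < x ord0 i /\
    x ord0 i < ratr pq.2 < x ord0 i + r.
  have [p hp] := @rat_in_itvoo R (x ord0 i - r) (x ord0 i) ltac:(lra).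
  have [q hq] := @rat_in_itvoo R (x ord0 i) (x ord0 i + r) ltac:(lra).
  by exists (p, q); move: hp hq; rewrite !in_itv.
have /choice[ab hab] := h.
exists [ffun i => ab i]; split.
  by move=> i; rewrite ffunE; have [/andP[_ ->] /andP[-> _]] := hab i.
move=> y hy; apply: rA; split => // i0 i; rewrite !ord1.
have := hy i; rewrite ffunE; have [/andP[? _] /andP[_ ?]] := hab i.
by rewrite /ball/= => /andP[? ?]; rewrite ltr_norml; apply/andP; split; lra.
Qed.

Lemma open_measurable_rV A : open A -> measurable A.
Proof.
move=> oA.
pose B (ab : {ffun 'I_n -> rat * rat}) : set V :=
  if `[< open_box (fun i => ratr (ab i).1) (fun i => ratr (ab i).2) `<=` A >]
  then open_box (fun i => ratr (ab i).1) (fun i => ratr (ab i).2) else set0.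
have -> : A = \bigcup_ab B ab.
  apply/seteqP; split => [x Ax|x [ab _]]; last first.
    by rewrite /B; case: ifPn => // /asboolP h /h.
  have [ab [xb sb]] := open_nbhs_box oA Ax.
  exists ab => //; rewrite /B ifT//; apply/asboolP => y yb; apply: sb => i.
  by have /andP[/ltW -> /ltW ->] := yb i.
apply: countable_bigcupT_measurable => //.
by move=> ab; rewrite /B; case: ifPn => _; [exact: measurable_open_box|].
Qed.

Lemma closed_measurable_rV A : closed A -> measurable A.
Proof.
by rewrite -openC => /open_measurable_rV/measurableC; rewrite setCK.
Qed.

Lemma continuous_measurable_rV (f : V -> R) : continuous f -> measurable_fun setT f.
Proof.
move=> cf _; apply: (measurability _ (RGenOInfty.measurableE R)) => //.
move=> /= _ [_ [a ->] <-]; rewrite setTI; apply: open_measurable_rV.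
apply: open_comp; first by move=> x _; exact: cf.
exact: interval_open.
Qed.

Lemma compact_measurable_rV A : compact A -> measurable A.
Proof.
by move=> /(compact_closed (@norm_hausdorff _ _))/closed_measurable_rV.
Qed.

Lemma bounded_rV A : bounded_set A ->
  exists2 M : R, 0 < M & A `<=` [set x | forall i, `|x ord0 i| < M].
Proof.
move=> [M [Mr hM]]; exists (`|M| + 1); first by rewrite ltr_wpDl.
move=> x Ax i; apply: (@le_lt_trans _ _ (`|M| + 2^-1)); last by rewrite ltrD2l; lra.
apply: le_trans (hM (`|M| + 2^-1) _ _ Ax); last first.
  by rewrite (le_lt_trans (ler_norm _))// ltrDl; lra.
rewrite -[leRHS]/(mx_norm x) mx_normrE.
by apply: le_trans (le_bigmax _ _ (ord0, i)).
Qed.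

Lemma bounded_rV_sub A (M : R) :
  A `<=` [set x | forall i, `|x ord0 i| <= M] -> bounded_set A.
Proof.
move=> AM; exists `|M|; split; first exact: num_real.
move=> y My x Ax /=; have y0 : 0 <= y by rewrite ltW// (le_lt_trans _ My).
rewrite -[X in (X <= _)%R]/(mx_norm x) mx_normrE; apply/bigmax_leP; split => //.
move=> [j k] _ /=; rewrite ord1.
by rewrite (le_trans (AM _ Ax k))// (le_trans (ler_norm _))// ltW.
Qed.

Lemma bounded_measure_fin A : bounded_set A -> measurable A -> (mu A < +oo)%E.
Proof.
move=> /bounded_rV[M M0 AM] mA.
apply: (@le_lt_trans _ _ (mu [set x | forall i, `]-M, M[%classic (x ord0 i)])).
  apply: le_measure; rewrite ?inE//.
    exact: (@measurable_coord_set (fun=> `]-M, M[%classic)).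
  by move=> x /AM h i /=; rewrite in_itv/= -ltr_norml.
rewrite (@lebesgue_rV_box R n (fun=> `]-M, M[%classic))//.
pose I : set (measurableTypeR R) := `]-M, M[%classic.
suff [r ->] : exists r : R, (\prod_(i < n) lebesgue_measure I)%E = r%:E.
  exact: ltry.
apply: (@big_ind _ (fun x : \bar R => exists r : R, x = r%:E)).
- by exists 1.
- by move=> _ _ [r ->] [s ->]; exists (r * s).
- move=> i _; rewrite /I lebesgue_measure_itv/=.
  by case: ifPn => _; [exists (M - - M)|exists 0].
Qed.

End rV_topology.

Section test_functions.
Variables (R : realType) (n : nat).
Local Notation V := 'rV[R]_n.
Local Notation e i := (delta_mx ord0 i : V).
Local Notation mu := (@lebesgue_rV R n).
Implicit Types (f g v phi psi : V -> R) (D : set V).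

Lemma tsupport_eq0 f x : ~ tsupport f x -> f x = 0.
Proof. by move=> h; apply: contra_notP h => /eqP fx; exact: subset_closure. Qed.

Lemma tsupport_sub f D : closed D -> (forall x, ~ D x -> f x = 0) ->
  tsupport f `<=` D.
Proof.
move=> cD h; rewrite [X in _ `<=` X](closure_id D).1//; apply: closure_subset.
by move=> x /= /eqP fx; apply: contra_notP fx => /h.
Qed.

Lemma partial_tsupport i f x : ~ tsupport f x -> partial i f x = 0.
Proof.
move=> fx; apply: partialE; apply: (@near_eq_is_derive _ _ _ (fun=> 0)) => //.
have : nbhs x (~` tsupport f).
  by apply: open_nbhs_nbhs; split => //; apply: closed_openC; exact: closed_closure.
by apply: filterS => y yf; rewrite tsupport_eq0.
Qed.

Lemma tsupport_partial i f : tsupport (partial i f) `<=` tsupport f.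
Proof.
by apply: tsupport_sub; [exact: closed_closure|move=> x; exact: partial_tsupport].
Qed.

Lemma compact_support_bounded f : continuous f -> compact (tsupport f) ->
  exists2 C : R, 0 < C & forall x, `|f x| <= C.
Proof.
move=> cf kf.
have : compact (f @` tsupport f).
  by apply: continuous_compact => //; exact: continuous_subspaceT.
move=> /compact_bounded[M [_ hM]]; exists (`|M| + 1); first by rewrite ltr_wpDl.
move=> x; have [xf|xf] := pselect (tsupport f x); last first.
  by rewrite tsupport_eq0// normr0 addr_ge0.
by apply: hM; [rewrite (le_lt_trans (ler_norm _))// ltrDl|exists x].
Qed.

Lemma compact_rV D : compact D -> exists2 M : R, 0 < M &
  D `<=` [set x | forall i, `|x ord0 i| < M].
Proof. by move=> /compact_bounded/bounded_rV. Qed.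

Lemma integrable_measurable_fun v : mu.-integrable setT (EFin \o v) ->
  measurable_fun setT v.
Proof. by move=> iv; apply/measurable_EFinP; exact: measurable_int iv. Qed.

Lemma integrable_mul_bounded v f (C : R) : mu.-integrable setT (EFin \o v) ->
  measurable_fun setT f -> (forall x, v x != 0 -> `|f x| <= C) ->
  mu.-integrable setT (EFin \o (fun x => v x * f x)).
Proof.
move=> iv mf fC.
have mv := integrable_measurable_fun iv.
apply: (le_integrable _ _ _ (integrableZl _ (`|C|) iv)) => //.
  by apply/measurable_EFinP; exact: measurable_funM.
move=> x _; rewrite /= lee_fin !normrM normr_id mulrC.
have [->|vx] := eqVneq (v x) 0; first by rewrite normr0 !mulr0.
by rewrite ler_wpM2r// (le_trans (fC _ vx))// ler_norm.
Qed.

Lemma integrable_cst_indic D (C : R) : measurable D -> (mu D < +oo)%E ->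
  mu.-integrable setT (fun x => (C * \1_D x)%:E).
Proof.
move=> mD Doo; rewrite (_ : (fun x => _) = (EFin \o cst C) \_ D); last first.
  by apply/funext => x; rewrite patchE indicE; case: ifPn; rewrite ?mulr1 ?mulr0.
apply/(integrable_mkcond _ mD).1/measurable_bounded_integrable => //.
exists `|C|; split; first exact: num_real.
by move=> y Cy x _; exact: ltW.
Qed.

Lemma integrableDR f g : mu.-integrable setT (EFin \o f) ->
  mu.-integrable setT (EFin \o g) ->
  mu.-integrable setT (EFin \o (fun x => f x + g x)).
Proof. by move=> fi gi; exact: (integrableD measurableT fi gi). Qed.

Lemma integrableBR f g : mu.-integrable setT (EFin \o f) ->
  mu.-integrable setT (EFin \o g) ->
  mu.-integrable setT (EFin \o (fun x => f x - g x)).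
Proof. by move=> fi gi; exact: (integrableB measurableT fi gi). Qed.

Lemma integrable_compact_support f : continuous f -> compact (tsupport f) ->
  mu.-integrable setT (EFin \o f).
Proof.
move=> cf kf.
have [C C0 fC] := compact_support_bounded cf kf.
have mK := compact_measurable_rV kf.
have [M M0 KM] := compact_rV kf.
have Koo : (mu (tsupport f) < +oo)%E.
  by apply: bounded_measure_fin => //; exact: compact_bounded.
have mf := continuous_measurable_rV cf.
rewrite (_ : EFin \o f = (EFin \o f) \_ (tsupport f)); last first.
  apply/funext => x; rewrite /patch; case: ifPn => // /negP.
  by rewrite inE => /tsupport_eq0/= ->.
apply/(integrable_mkcond _ mK).1.
apply: measurable_bounded_integrable => //; first exact: measurable_funTS.
exists C; split; first exact: num_real.
by move=> y Cy x _; exact: le_trans (fC x) (ltW Cy).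
Qed.

Lemma test_function_partial D phi i : test_function D phi ->
  test_function D (partial i phi).
Proof.
move=> [sp kp pD]; split; first exact: smooth_partial.
  by apply: subclosed_compact kp (@tsupport_partial i phi); exact: closed_closure.
exact: subset_trans (@tsupport_partial i phi) pD.
Qed.

Lemma test_function_bounded D phi : test_function D phi ->
  exists2 C : R, 0 < C & forall x, `|phi x| <= C.
Proof. by case=> /smooth_continuous cp kp _; exact: compact_support_bounded. Qed.

Lemma test_function_mul D D' phi psi K : test_function D phi -> smooth psi ->
  compact K -> K `<=` D' -> (forall x, ~ K x -> psi x * phi x = 0) ->
  test_function D' (fun x => psi x * phi x).
Proof.
move=> [sp kp pD] spsi kK KD' hK.
have sK : tsupport (fun x => psi x * phi x) `<=` K.
  by apply: tsupport_sub => //; apply: compact_closed => //; exact: norm_hausdorff.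
split.
- by apply: smooth_closure_smooth; apply: sc_mul; exact: sc_base.
- by apply: subclosed_compact kK sK; exact: closed_closure.
- exact: subset_trans KD'.
Qed.

Lemma mean_value_partial f i x (r : R) : smooth f ->
  exists c : R, f (r *: e i + x) - f x = partial i f (c *: e i + x) * r.
Proof.
move=> sf; have [c _] := @MVT_dist R (fun s => f (s *: e i + x))
  (fun s => partial i f (s *: e i + x)) 0 r
  (fun s => is_derive_line (smooth_is_derive sf i _)).
by rewrite scale0r add0r subr0 => h; exists c.
Qed.

(** A translation is the composition of two reflections of the same coordinate, so its invariance
    properties follow from theirs. *)
Let translate i (r : R) (x : V) : V :=
  coord_reflect i (cst r) (coord_reflect i (cst 0) x).

Let translateE i r x : translate i r x = r *: e i + x.
Proof.
apply/rowP => k; rewrite /translate !coord_reflectE !mxE eqxx/= sub0r opprK.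
by case: eqP => [->|_]; rewrite ?mulr1 ?mulr0 ?add0r.
Qed.

Lemma integral_translate i (r : R) f : mu.-integrable setT (EFin \o f) ->
  mu.-integrable setT (EFin \o (fun x => f (r *: e i + x))) /\
  \int[mu]_x f (r *: e i + x) = \int[mu]_x f x.
Proof.
move=> fi; under eq_fun do rewrite -translateE.
have i1 := integrable_reflect (i := i) (c :=
  cst r) (measurable_cst _) (fun _ _ _ => erefl) fi.
have i2 := integrable_reflect (i := i) (c :=
  cst 0) (measurable_cst _) (fun _ _ _ => erefl) i1.
split => //.
rewrite /Rintegral; congr fine.
rewrite -(integral_reflect (i := i) (c :=
  cst r) (measurable_cst _) (fun _ _ _ => erefl) fi).
by rewrite -(integral_reflect (i := i) (c :=
  cst 0) (measurable_cst _) (fun _ _ _ => erefl) i1).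
Qed.

Lemma cvg_harmonic_dnbhs : (@harmonic R) @ \oo --> (0 : R)^'.
Proof.
move=> A A0; have H := @cvg_harmonic R _ A0.
move: H; apply: (@filterS nat \oo _ [set k | harmonic k != 0 -> A (harmonic k)]
  [set k | A (harmonic k)]).
by move=> k; apply; rewrite gt_eqF// /harmonic/= invr_gt0.
Qed.

(** The difference quotients have integral 0 by translation invariance. They converge to the partial
    derivative, and the mean value theorem bounds them by its maximum on a fixed box. *)
Lemma integral_partial0 i f : smooth f -> compact (tsupport f) ->
  \int[mu]_x partial i f x = 0.
Proof.
move=> sf kf; pose F k (x : V) := (harmonic k)^-1 * (f (harmonic k *: e i + x) - f x).
have cf := smooth_continuous sf.
have cpf := smooth_continuous (smooth_partial i sf).
have fi := integrable_compact_support cf kf.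
have [C C0 pC] := compact_support_bounded cpf
  (subclosed_compact (@closed_closure _ _) kf (@tsupport_partial i f)).
have [M M0 KM] := compact_rV kf.
have Fi k : mu.-integrable setT (EFin \o (fun x => f (harmonic k *: e i + x) - f x)).
  have [i1 _] := integral_translate i (harmonic k) fi.
  exact: integrableBR.
have F0 k : \int[mu]_x F k x = 0.
  have [i1 e1] := integral_translate i (harmonic k) fi.
  by rewrite RintegralZl// RintegralB// e1 subrr mulr0.
(* The margin 1 is the largest step of the sequence [harmonic]. *)
pose B : set V := [set x | forall j, `[- (M + 1), M + 1]%classic (x ord0 j)].
have mB : measurable B by exact: (@measurable_coord_set _ _ (fun=> `[- (M + 1), M +
  1]%classic)).
have Boo : (mu B < +oo)%E.
  apply: bounded_measure_fin => //; apply: (@bounded_rV_sub _ _ _ (M + 1)).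
  by move=> x Bx k; have := Bx k; rewrite /= in_itv/= -ler_norml.
have FB k x : ~ B x -> F k x = 0.
  move=> nB; rewrite /F !tsupport_eq0 ?subrr ?mulr0//; apply: contra_not nB => /KM h j;
    have := h j; rewrite /= in_itv/= -ler_norml.
    by move/ltW => /le_trans; apply; rewrite lerDl.
  rewrite !mxE eqxx/=; set t := (_ * _) => hj.
  have ht : `|t| <= 1.
    rewrite /t normrM mulr_ile1//.
      by rewrite ger0_norm// invf_le1// ler1n.
    by case: (j == i); rewrite ?normr1 ?normr0.
  rewrite (_ : x ord0 j = (t + x ord0 j) - t); last by ring.
  by rewrite (le_trans (ler_normB _ _))// lerD// ltW.
have FC k x : `|F k x| <= C.
  have [c hc] := mean_value_partial i x (harmonic k) sf.
  rewrite /F hc mulrC mulfK//; rewrite /harmonic invr_neq0//.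
have [] := @dominated_convergence _ _ _ mu setT measurableT (fun k => EFin \o F k)
  (EFin \o partial i f) (fun x => (C * \1_B x)%:E).
- move=> k; apply/measurable_EFinP; apply: measurable_funM => //.
  by have /measurable_int/measurable_EFinP := Fi k.
- by apply/measurable_EFinP; exact: continuous_measurable_rV.
- apply: aeW => x _; apply: cvg_EFin; first by near=> k.
  have /is_derive_cvgP h := smooth_is_derive sf i x.
  exact: (cvg_comp _ _ cvg_harmonic_dnbhs h).
- exact: integrable_cst_indic.
- apply: aeW => x k _; rewrite /= lee_fin.
  have [xB|/FB ->] := pselect (B x); last by rewrite normr0 mulr_ge0// ltW.
  by rewrite indicE mem_set// mulr1.
move=> ip _ cv; rewrite /Rintegral (_ : (\int[mu]_x _)%E = 0%E)//.
have cv0 : (\int[mu]_x (EFin \o F k) x)%E @[k --> \oo] --> 0%E.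
  rewrite (_ : (fun k => _) = (fun=> 0%E)); first exact: cvg_cst.
  apply/funext => k; rewrite -[LHS]fineK; first by congr EFin; exact: F0.
  apply: integrable_fin_num => //.
  exact: (integrableZl measurableT (harmonic k)^-1 (Fi k)).
exact: (cvg_unique _ cv cv0).
Unshelve. all: by end_near. Qed.

End test_functions.

(** * Uniqueness of weak gradients *)

Section real_integrals.
Variables (R : realType) (d : measure_display) (T : measurableType d).
Variable mu : {measure set T -> \bar R}.
Implicit Types (f G : T -> R).

Lemma EFin_Rintegral f : mu.-integrable setT (EFin \o f) ->
  (\int[mu]_x (f x)%:E)%E = (\int[mu]_x f x)%:E.
Proof. by move=> fi; rewrite /Rintegral fineK//; exact: integrable_fin_num. Qed.

Lemma Rintegral_dominated (F : nat -> T -> R) f G :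
  (forall k, measurable_fun setT (F k)) ->
  (forall x, F k x @[k --> \oo] --> f x) ->
  mu.-integrable setT (EFin \o G) -> (forall k x, `|F k x| <= G x) ->
  mu.-integrable setT (EFin \o f) /\
  \int[mu]_x F k x @[k --> \oo] --> \int[mu]_x f x.
Proof.
move=> mF Ff Gi FG.
have mf : measurable_fun setT f.
  by apply: (@measurable_fun_cvg _ _ _ _ F) => // x _; exact: Ff.
have [] := @dominated_convergence _ _ _ mu setT measurableT
  (fun k => EFin \o F k) (EFin \o f) (EFin \o G).
- by move=> k; exact/measurable_EFinP.
- exact/measurable_EFinP.
- by apply: aeW => x _; apply: cvg_EFin; [exact: nearW|exact: Ff].
- exact: Gi.
- by apply: aeW => x k _; rewrite /= lee_fin.
move=> fi _ cv; split => //.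
by rewrite [X in _ --> X]EFin_Rintegral// in cv; exact: fine_cvg cv.
Qed.

End real_integrals.

Section vanishing.
Variables (R : realType) (n : nat).
Local Notation V := 'rV[R]_n.
Local Notation mu := (@lebesgue_rV R n).
Implicit Types (a b c d : 'I_n -> R) (f : V -> R) (D : set V).

Let boxes : set (set V) := [set A | exists a b, A = open_box a b].

(** Open boxes are stable under intersection, so that Dynkin's induction applies to this family of
    generators. *)
Lemma measurable_rV_boxes : @measurable _ V = <<s boxes >>.
Proof.
apply/seteqP; split; last first.
  apply: smallest_sub; first exact: sigma_algebra_measurable.
  by move=> _ [a [b ->]]; exact: measurable_open_box.
move=> A mA.
suff : measurable_fun [set: g_sigma_algebraType boxes]
    (id : g_sigma_algebraType boxes -> V).
  by move=> /(_ measurableT A mA); rewrite setTI.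
apply: measurable_fun_rV => i _.
apply: (measurability _ (RGenOInfty.measurableE R)) => //.
move=> /= _ [_ [r ->] <-]; rewrite setTI.
rewrite (_ : _ @^-1` _ = \bigcup_(k : nat) open_box
    (fun j => if j == i then r else - k%:R) (fun=> k%:R)).
  apply: bigcupT_measurable => k; apply: sub_sigma_algebra.
  by do 2 eexists.
apply/seteqP; split => [x /=|x [k _ /(_ i)] /=]; rewrite in_itv/= ?andbT.
  move=> rx; pose k := Num.Def.archi_bound `|x|.
  exists k => // j.
  have : `|x ord0 j| < k%:R.
    rewrite (le_lt_trans _ (archi_boundP _))//.
    rewrite -[leRHS]/(mx_norm x) mx_normrE.
    exact: (le_bigmax _ (fun ij => `|x ij.1 ij.2|) (ord0, j)).
  by rewrite ltr_norml => /andP[xk ->]; case: eqP => [->|_]; rewrite ?rx ?xk.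
by rewrite eqxx => /andP[].
Qed.

Let setI_boxes : setI_closed boxes.
Proof.
move=> _ _ [a [b ->]] [c [d ->]].
exists (fun i => Num.max (a i) (c i)), (fun i => Num.min (b i) (d i)).
apply/seteqP; split => x /=.
  by move=> [h1 h2] i; rewrite gt_max lt_min; have /andP[-> ->] := h1 i;
    have /andP[-> ->] := h2 i.
move=> h; split => i; have := h i; rewrite gt_max lt_min;
  by move=> /andP[/andP[? ?] /andP[? ?]]; apply/andP.
Qed.

Lemma integral_boxes_eq0 f : mu.-integrable setT (EFin \o f) ->
  (\int[mu]_x (f x)%:E = 0)%E ->
  (forall a b, \int[mu]_(x in open_box a b) (f x)%:E = 0)%E ->
  {ae mu, forall x, f x = 0}.
Proof.
move=> fi f0 fb.
have h A : measurable A -> (\int[mu]_(x in A) (f x)%:E = 0)%E.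
  rewrite measurable_rV_boxes => mA; move: A mA.
  apply: (dynkin_induction measurable_rV_boxes) => //.
  - by move=> _ [a [b ->]]; exact: fb.
  - move=> S mS S0; move: f0; rewrite -(setUv S) integral_setU_EFin//.
    + by rewrite S0 add0e.
    + exact: measurableC.
    + by rewrite setUv; apply/measurable_EFinP; exact: measurable_int fi.
    + exact/disj_set2P/setICr.
  - move=> F mF tF F0; rewrite integral_bigcup//.
      by rewrite eseries0.
    by apply: integrableS fi => //; exact: bigcupT_measurable.
have : ae_eq mu setT (EFin \o f) (cst 0%E).
  apply: integral_ae_eq => // E _ mE.
  by rewrite h// integral_cst// mul0e.
by apply: filterS => x /(_ I) /= [].
Qed.

Lemma smooth_prod (I : Type) (s : seq I) (F : I -> V -> R) :
  (forall i, smooth (F i)) -> smooth (fun x => \prod_(i <- s) F i x).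
Proof.
move=> sF; apply: smooth_closure_smooth; elim: s => [|i s IH].
  rewrite (_ : (fun _ => _) = fun=> 1); first exact: sc_cst.
  by apply/funext => x; rewrite big_nil.
rewrite (_ : (fun _ => _) = fun x => F i x * \prod_(j <- s) F j x).
  by apply: sc_mul => //; exact: sc_base.
by apply/funext => x; rewrite big_cons.
Qed.

(** Steep smooth steps that vanish outside of the open box and converge pointwise to its indicator:
    they turn integrals against test functions into integrals over boxes. *)
Definition box_bump c d (k : nat) : V -> R := fun x => \prod_(i < n)
  (smoothstep (k.+1%:R * x ord0 i + - (k.+1%:R * c i)) *
   smoothstep (- k.+1%:R * x ord0 i + k.+1%:R * d i)).

Lemma box_bump_smooth c d k : smooth (box_bump c d k).
Proof.
apply: smooth_prod => i; apply: smooth_closure_smooth; apply: sc_mul;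
  (apply: sc_comp; first exact: smoothstep_smooth);
  by apply: sc_add; [apply: sc_mul; [exact: sc_cst|exact: sc_coord]|exact: sc_cst].
Qed.

Lemma box_bump_ge0 c d k x : 0 <= box_bump c d k x.
Proof. by apply: prodr_ge0 => i _; rewrite mulr_ge0// smoothstep_ge0. Qed.

Lemma box_bump_le1 c d k x : box_bump c d k x <= 1.
Proof.
by apply: prodr_ile1 => i; rewrite mulr_ge0 ?smoothstep_ge0//=
  mulr_ile1 ?smoothstep_ge0 ?smoothstep_le1.
Qed.

Lemma box_bump_eq0 c d k x : ~ open_box c d x -> box_bump c d k x = 0.
Proof.
move=> nx; have [i] : exists i, ~~ (c i < x ord0 i < d i).
  apply/not_existsP => h; apply: nx => i; apply/negPn/negP.
  exact: h.
rewrite negb_and -!leNgt => xi; rewrite /box_bump (bigD1 i)//=.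
have [xc|xd] := orP xi.
  by rewrite smoothstep_eq0 ?mul0r// (@le_trans _ _ 0)// -mulrBr
    mulr_ge0_le0// subr_le0.
by rewrite [X in _ * X * _]smoothstep_eq0 ?mulr0 ?mul0r// (@le_trans _ _ 0)//
  mulNr addrC -mulrBr mulr_ge0_le0// subr_le0.
Qed.

Lemma box_bump_cvg c d x :
  box_bump c d k x @[k --> \oo] --> (\1_(open_box c d) x : R).
Proof.
have [xb|xb] := pselect (open_box c d x); last first.
  rewrite indicE memNset//; under eq_cvg do rewrite box_bump_eq0//.
  exact: cvg_cst.
rewrite indicE mem_set//=; apply: cvg_near_cst.
have : \forall k \near \oo, forall i : 'I_n,
    3 / 4 <= k%:R * (x ord0 i - c i) /\ 3 / 4 <= k%:R * (d i - x ord0 i).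
  apply: filter_forall => i; have /andP[xi1 xi2] := xb i.
  near=> k; split.
    rewrite -ler_pdivrMr ?subr_gt0//.
    by near: k; exact: nbhs_infty_ger.
  rewrite -ler_pdivrMr ?subr_gt0//.
  by near: k; exact: nbhs_infty_ger.
apply: filterS => k hk; apply: big1 => i _; have [h1 h2] := hk i.
rewrite !smoothstep_eq1 ?mulr1//.
  rewrite mulNr addrC -mulrBr (le_trans h2)// ler_wpM2r ?ler_nat//.
  by have /andP[_ ?] := xb i; rewrite subr_ge0 ltW.
rewrite -mulrBr (le_trans h1)// ler_wpM2r ?ler_nat//.
by have /andP[? _] := xb i; rewrite subr_ge0 ltW.
Unshelve. all: by end_near. Qed.

Lemma compact_closed_box a b :
  compact [set y : V | forall i, a i <= y ord0 i <= b i].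
Proof.
have := @rV_compact R n (fun i => `[a i, b i]%classic) (fun=> @segment_compact _ _ _).
congr compact; apply/seteqP; split => x h i; have := h i; rewrite /= in_itv//.
Qed.

Lemma box_bump_test c d k D :
  [set y : V | forall i, c i <= y ord0 i <= d i] `<=` D ->
  test_function D (box_bump c d k).
Proof.
move=> cdD; have kc := @compact_closed_box c d.
have sc : tsupport (box_bump c d k) `<=` [set y : V | forall i, c i <= y ord0 i <= d i].
  apply: tsupport_sub; first exact: (compact_closed (@norm_hausdorff _ _) kc).
  move=> x nx; apply: box_bump_eq0; apply: contra_not nx => h i.
  by have /andP[/ltW -> /ltW ->] := h i.
split; first exact: box_bump_smooth.
  by apply: subclosed_compact kc sc; exact: closed_closure.
exact: subset_trans cdD.
Qed.

Lemma L1loc_test_integrable D f phi : open D -> L1loc D f -> test_function D phi ->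
  mu.-integrable setT (EFin \o (fun x => (f \_ D) x * phi x)) /\
  \int[mu]_(x in D) (f x * phi x) = \int[mu]_x ((f \_ D) x * phi x).
Proof.
move=> oD [mf lf] tphi; have [sp kp pD] := tphi.
have mK := compact_measurable_rV kp.
have fi := (integrable_mkcond _ mK).1 (lf _ kp pD).
have [C C0 pC] := test_function_bounded tphi.
have mp := continuous_measurable_rV (smooth_continuous sp).
have e x : (f \_ D) x * phi x = (f \_ (tsupport phi)) x * phi x.
  rewrite !patchE; have [xp|xp] := pselect (tsupport phi x).
    by rewrite !mem_set//; exact: pD.
  by rewrite (tsupport_eq0 xp) !mulr0.
split.
  under [X in EFin \o X]eq_fun do rewrite e.
  apply: (@integrable_mul_bounded _ _ _ _ C) => //.
  by rewrite (_ : EFin \o _ = (EFin \o f) \_ (tsupport phi))// restrict_EFin.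
rewrite Rintegral_mkcond; apply: eq_Rintegral => x _; rewrite !patchE.
by case: ifPn => // _; rewrite mul0r.
Qed.

(** The fundamental lemma of the calculus of variations. Testing against [box_bump] shows that the
    integral of [f] vanishes on all small boxes, hence [f] vanishes almost everywhere on each box
    whose closure lies in [D]. *)
Lemma L1loc_vanishing D f : open D -> L1loc D f ->
  (forall phi, test_function D phi -> \int[mu]_(x in D) (f x * phi x) = 0) ->
  {ae mu, forall x, D x -> f x = 0}.
Proof.
move=> oD lf f0.
have key a b : [set y : V | forall i, a i <= y ord0 i <= b i] `<=` D ->
    {ae mu, forall x, open_box a b x -> f x = 0}.
  move=> abD; pose F := f \_ (open_box a b).
  have kK := @compact_closed_box a b.
  have mB := @measurable_open_box _ _ a b.
  have Fi : mu.-integrable setT (EFin \o F).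
    rewrite /F -restrict_EFin; apply/(integrable_mkcond _ mB).1.
    apply: integrableS (lf.2 _ kK abD) => //; first exact: compact_measurable_rV.
    by move=> x h i; have /andP[/ltW -> /ltW ->] := h i.
  have bs c d : (forall i, a i <= c i) -> (forall i, d i <= b i) ->
      (\int[mu]_x (F x * \1_(open_box c d) x)%:E = 0)%E.
    move=> ac db.
    have mcd := @measurable_open_box _ _ c d.
    have cdD : [set y : V | forall i, c i <= y ord0 i <= d i] `<=` D.
      apply: subset_trans abD => x h i; have /andP[h1 h2] := h i.
      by rewrite (le_trans (ac i) h1) (le_trans h2 (db i)).
    have e k x : (f \_ D) x * box_bump c d k x = F x * box_bump c d k x.
      have [xb|/(box_bump_eq0 k) ->] := pselect (open_box c d x);
        last by rewrite !mulr0.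
      rewrite /F !patchE !mem_set//.
        move=> i; have /andP[h1 h2] := xb i.
        by rewrite (le_lt_trans (ac i) h1) (lt_le_trans h2 (db i)).
      by apply: cdD => i; have /andP[/ltW -> /ltW ->] := xb i.
    have mF := integrable_measurable_fun Fi.
    have [] := @Rintegral_dominated _ _ _ mu (fun k x => F x * box_bump c d k x)
      (fun x => F x * \1_(open_box c d) x) (fun x => `|F x|).
    - move=> k; apply: measurable_funM => //.
      by apply: continuous_measurable_rV;
        exact: smooth_continuous (box_bump_smooth _ _ _).
    - by move=> x; apply: cvgM; [exact: cvg_cst|exact: box_bump_cvg].
    - exact: integrable_norm Fi.
    - by move=> k x; rewrite normrM ler_piMr// ger0_norm ?box_bump_ge0 ?box_bump_le1.
    move=> Fci cv; rewrite EFin_Rintegral//; congr EFin; apply: (cvg_unique _ cv) => //.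
    rewrite (_ : (fun k => _) = fun=> 0); first exact: cvg_cst.
    apply/funext => k.
    have tk := box_bump_test k cdD.
    have [i1 i2] := L1loc_test_integrable oD lf tk.
    by rewrite -[RHS](f0 _ tk) i2; apply: eq_Rintegral => x _; rewrite /= e.
  have Fcd E : measurable E -> (\int[mu]_(x in E) (F x)%:E = \int[mu]_x (F x * \1_E
    x)%:E)%E.
    move=> mE; rewrite integral_mkcond; apply: eq_integral => x _.
    by rewrite patchE indicE; case: ifPn; rewrite ?mulr1 ?mulr0.
  have : {ae mu, forall x, F x = 0}.
    apply: integral_boxes_eq0 => //.
      rewrite -(bs a b)//; apply: eq_integral => x _; congr EFin.
      rewrite indicE /F patchE.
      by case: ifPn => _; rewrite ?mulr1 ?mulr0.
    move=> c d; rewrite Fcd//; last exact: measurable_open_box.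
    (* An arbitrary box may be replaced by its intersection with [open_box a b], outside of which
       [F] is 0. *)
    rewrite -(bs (fun i => Num.max (a i) (c i)) (fun i => Num.min (b i) (d i)))//;
      last 2 first.
    - by move=> i; rewrite le_max lexx.
    - by move=> i; rewrite ge_min lexx.
    apply: eq_integral => x _; congr EFin.
    have [xb|xb] := pselect (open_box a b x);
      last by rewrite /F patchE memNset// !mul0r.
    congr (_ * _); rewrite !indicE; congr (_%:R); congr (nat_of_bool _).
    apply/idP/idP; rewrite !inE => h i; have /andP[h1 h2] := xb i; have := h i;
      rewrite gt_max lt_min.
      by move=> /andP[-> ->]; rewrite h1 h2.
    by move=> /andP[/andP[_ ->] /andP[_ ->]].
  apply: filterS => x Fx xb; move: Fx; rewrite /F patchE mem_set//.
(* The rational boxes are enumerated by their codes, as [ae_foralln] gathers null sets indexed by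
   natural numbers. *)
pose P (k : nat) (x : V) :=
  if unpickle k is Some ab then let ab : {ffun 'I_n -> rat * rat} := ab in
  [set y : V | forall i, ratr (ab i).1 <= y ord0 i <= ratr (ab i).2] `<=` D ->
  open_box (fun i => ratr (ab i).1) (fun i => ratr (ab i).2) x -> f x = 0
  else True.
have : {ae mu, forall x, forall k, P k x}.
  apply/ae_foralln => k; rewrite /P; case: unpickle => [ab|]; last exact: aeW.
  have [abD|abD] := pselect
    ([set y : V | forall i, ratr (ab i).1 <= y ord0 i <= ratr (ab i).2] `<=` D).
    by have := key _ _ abD; apply: filterS => x + _; exact.
  exact: aeW.
apply: filterS => x hP Dx; have [ab [xab abD]] := open_nbhs_box oD Dx.
by have := hP (pickle ab); rewrite /P pickleK; exact.
Qed.

Lemma weak_gradient_unique D (u : V -> R) (g g' : V -> V) : open D ->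
  is_weak_gradient D u g -> is_weak_gradient D u g' ->
  {ae mu, forall x, D x -> g x = g' x}.
Proof.
move=> oD hg hg'.
have h i : {ae mu, forall x, D x -> g x ord0 i - g' x ord0 i = 0}.
  have [lg tg] := hg i; have [lg' tg'] := hg' i.
  apply: (L1loc_vanishing oD).
    split; first exact: measurable_funB lg.1 lg'.1.
    move=> K cK KD; apply: (integrableB (compact_measurable_rV cK) (lg.2 K cK KD)
      (lg'.2 K cK KD)).
  move=> phi tphi.
  have [i1 e1] := L1loc_test_integrable oD lg tphi.
  have [i2 e2] := L1loc_test_integrable oD lg' tphi.
  transitivity (\int[mu]_x (((fun x => g x ord0 i) \_ D) x * phi x -
      ((fun x => g' x ord0 i) \_ D) x * phi x)).
    rewrite Rintegral_mkcond; apply: eq_Rintegral => x _; rewrite !patchE.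
    by case: ifPn => _; rewrite ?mulrBl// !mul0r subrr.
  rewrite RintegralB// -e1 -e2; apply/eqP; rewrite subr_eq0 -eqr_opp.
  by rewrite -tg// -tg'.
have : {ae mu, forall x i, D x -> g x ord0 i - g' x ord0 i = 0}.
  pose P (k : nat) (x : V) :=
    if insub k is Some i then D x -> g x ord0 i - g' x ord0 i = 0 else True.
  have : {ae mu, forall x k, P k x}.
    apply/ae_foralln => k; rewrite /P; case: insubP => [i _ _|_]; first exact: h.
    exact: aeW.
  by apply: filterS => x hP i; have := hP i; rewrite /P valK.
apply: filterS => x hx Dx; apply/rowP => i; apply/eqP; rewrite -subr_eq0.
by apply/eqP; exact: hx.
Qed.

Lemma weak_gradientP D (u : V -> R) (g : V -> V) : is_weak_gradient D u g ->
  is_weak_gradient D u (weak_gradient D u).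
Proof.
move=> wg.
exact: (@xgetPex _ (fun=> 0) [set g | is_weak_gradient D u g] (ex_intro _ g wg)).
Qed.

End vanishing.

(** * Extension by reflection *)

Section reflection.
Variables (R : realType) (N : nat).
Local Notation n := N.+1.
Local Notation V := 'rV[R]_n.
Local Notation e i := (delta_mx ord0 i : V).
Local Notation mu := (@lebesgue_rV R n).
Implicit Types (D : set V) (v a b phi psi : V -> R) (G : 'I_n -> V -> R).

Lemma smoothD a b : smooth a -> smooth b -> smooth (fun x => a x + b x).
Proof. by move=> sa sb; apply: smooth_closure_smooth; apply: sc_add;
  exact: sc_base. Qed.

Lemma smoothM a b : smooth a -> smooth b -> smooth (fun x => a x * b x).
Proof. by move=> sa sb; apply: smooth_closure_smooth; apply: sc_mul;
  exact: sc_base. Qed.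

Opaque partial.

Lemma smooth_cst (c : R) : smooth (fun _ : V => c).
Proof. by apply: smooth_closure_smooth; exact: sc_cst. Qed.

Lemma smooth_measurable a : smooth a -> measurable_fun setT a.
Proof. by move=> /smooth_continuous; exact: continuous_measurable_rV. Qed.

(* The functions vanish outside of [D], so that all integrals are over the
   whole space. *)
Definition weakly_differentiable D v G :=
  [/\ forall x, ~ D x -> v x = 0 /\ forall j, G j x = 0,
      mu.-integrable setT (EFin \o v),
      forall j, mu.-integrable setT (EFin \o G j) &
      forall j phi, test_function D phi ->
        \int[mu]_x (v x * partial j phi x) = - \int[mu]_x (G j x * phi x)].

(* The test field [a e_k + b e_i] is not supported in [D], but its normal
   component vanishes on the part [H(x_0) = sg x_i] of the boundary.  Hence
   the term in which the cut-off function [eta] is derived stays bounded. *)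
Lemma cutoff_divergence D v G (i k : 'I_n) (H : R ->
  R) (sg : R) (K : set V) a b (C : R) :
  weakly_differentiable D v G -> smooth1 H -> k != i -> ord0 != i ->
  compact K -> smooth a -> smooth b ->
  (forall x : V, ~ K x -> a x = 0) -> (forall x : V, ~ K x -> b x = 0) ->
  (forall x : V, K x -> 0 < H (x ord0 ord0) - sg * x ord0 i -> D x) ->
  (forall x : V, K x -> D x -> 0 < H (x ord0 ord0) - sg * x ord0 i) ->
  (forall x : V, `|(k == ord0)%:R * derive1 H (x ord0 ord0) * a x - sg * b x| <=
     C * `|H (x ord0 ord0) - sg * x ord0 i|) ->
  \int[mu]_x (v x * (partial k a x + partial i b x)) =
  - \int[mu]_x (G k x * a x + G i x * b x).
Proof.
move=> [v0 vi Gi vG] sH ki i0 cK sa sb aK bK KD DK abC.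
pose s (x : V) := H (x ord0 ord0) - sg * x ord0 i.
have [sdH dH] := smooth1_derive sH.
(* [eta m] vanishes near the graph [s = 0] and tends to 1 where [s > 0], that is, in the part of [D]
   that meets [K]. *)
pose eta (m : nat) (x : V) := smoothstep (m.+1%:R * s x).
have ss : smooth s.
  rewrite (_ : s = fun x => H (x ord0 ord0) + (- sg) * x ord0 i); last first.
    by apply/funext => x; rewrite /s mulNr.
  apply: smooth_closure_smooth; apply: sc_add.
    by apply: sc_comp => //; exact: sc_coord.
  by apply: sc_mul; [exact: sc_cst|exact: sc_coord].
have seta m : smooth (eta m).
  apply: smooth_closure_smooth; apply: sc_comp; first exact: smoothstep_smooth.
  by apply: sc_mul; [exact: sc_cst|exact: sc_base].
have ds j (x : V) : is_derive x (e j) s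
    ((j == ord0)%:R * derive1 H (x ord0 ord0) - sg * (j == i)%:R).
  apply: is_deriveB.
    rewrite mulrC; apply: (is_derive_compR (dH _)).
    exact: is_derive_coord.
  apply: is_derive_eq (is_deriveZ sg (is_derive_coord j i x)) _.
  by [].
have [sdst dst] := smooth1_derive (@smoothstep_smooth R).
have deta m j (x : V) : is_derive x (e j) (eta m)
    (derive1 (@smoothstep R) (m.+1%:R * s x) * (m.+1%:R *
     ((j == ord0)%:R * derive1 H (x ord0 ord0) - sg * (j == i)%:R))).
  exact: (is_derive_compR (dst _)).
have cK' := compact_closed (@norm_hausdorff _ _) cK.
have tst m f : smooth f -> (forall x, ~ K x -> f x = 0) ->
    test_function D (fun x => f x * eta m x).
  move=> sf fK.
  (* [smoothstep] vanishes up to 1/4, so [eta m] is 0 where [(m + 1) s] is less than 1/4. *)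
  pose K' := K `&` [set x | (4 * m.+1%:R)^-1 <= s x].
  have cl : closed K'.
    apply: closedI => //.
    apply: (@closed_comp _ _ s [set y : R | (4 * m.+1%:R)^-1 <= y]).
      by move=> x _; exact: smooth_continuous.
    exact: closed_ge.
  have sK' : tsupport (fun x => f x * eta m x) `<=` K'.
    apply: tsupport_sub => // x nx.
    have [Kx|Kx] := pselect (K x); last by rewrite fK// mul0r.
    rewrite /eta smoothstep_eq0 ?mulr0//.
    have : ~~ ((4 * m.+1%:R)^-1 <= s x) by apply/negP => h; apply: nx; split.
    rewrite -ltNge invfM => /ltW h.
    by rewrite -ler_pdivlMl// mulrC.
  split.
  - exact: (smoothM sf (seta m)).
  - apply: subclosed_compact (subset_trans sK' _); [exact: closed_closure|exact: cK|].
    by move=> x [].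
  - apply: subset_trans sK' _ => x [Kx /= sx]; apply: KD => //.
    by rewrite (lt_le_trans _ sx)// invr_gt0 mulr_gt0.
have [Mt Mt0 hMt] := @smoothstep_derive_bounded R.
have tsK f : (forall x, ~ K x -> f x = 0) -> tsupport f `<=` K.
  by move=> fK; apply: tsupport_sub.
have bK' f : smooth f -> (forall x, ~ K x -> f x = 0) ->
    exists2 c : R, 0 < c & forall x, `|f x| <= c.
  move=> sf fK; apply: compact_support_bounded; first exact: smooth_continuous.
  by apply: subclosed_compact (tsK _ fK) => //; exact: closed_closure.
have pK j f : (forall x, ~ K x -> f x = 0) -> forall x, ~ K x -> partial j f x = 0.
  by move=> fK x Kx; apply: partial_tsupport => /(tsK _ fK).
have itm u f : mu.-integrable setT (EFin \o u) -> smooth f ->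
    (forall x, ~ K x -> f x = 0) -> mu.-integrable setT (EFin \o (fun x => u x * f x)).
  move=> ui sf fK; have [c _ fc] := bK' _ sf fK.
  apply: (@integrable_mul_bounded _ _ _ _ c) => //.
  exact: smooth_measurable.
have se m f : smooth f -> smooth (fun x => f x * eta m x).
  by move=> sf; exact: (smoothM sf (seta m)).
have eK m f : (forall x, ~ K x -> f x = 0) -> forall x, ~ K x -> f x * eta m x = 0.
  by move=> fK x Kx; rewrite fK// mul0r.
have pe m j f x : smooth f -> partial j (fun x => f x * eta m x) x =
    f x * (derive1 (@smoothstep R) (m.+1%:R * s x) * (m.+1%:R *
     ((j == ord0)%:R * derive1 H (x ord0 ord0) - sg * (j == i)%:R))) +
    eta m x * partial j f x.
  by move=> sf; apply: partialE; apply: is_deriveM => //; exact: smooth_is_derive.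
pose F m x := v x * (partial k (fun x => a x * eta m x) x +
                     partial i (fun x => b x * eta m x) x).
pose Gm m x := G k x * (a x * eta m x) + G i x * (b x * eta m x).
have FG m : \int[mu]_x F m x = - \int[mu]_x Gm m x.
  rewrite /F; under eq_Rintegral do rewrite mulrDr.
  rewrite RintegralD//; last 2 first.
  - exact: (itm _ _ vi (smooth_partial k (se m _ sa)) (pK k _ (eK m _ aK))).
  - exact: (itm _ _ vi (smooth_partial i (se m _ sb)) (pK i _ (eK m _ bK))).
  rewrite (vG _ _ (tst m _ sa aK)) (vG _ _ (tst m _ sb bK)).
  rewrite /Gm RintegralD//; last 2 first.
  - exact: (itm _ _ (Gi k) (se m _ sa) (eK m _ aK)).
  - exact: (itm _ _ (Gi i) (se m _ sb) (eK m _ bK)).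
  by rewrite opprD.
have Fx m x : F m x = v x * (eta m x * (partial k a x + partial i b x) +
    m.+1%:R * derive1 (@smoothstep R) (m.+1%:R * s x) *
    ((k == ord0)%:R * derive1 H (x ord0 ord0) * a x - sg * b x)).
  rewrite /F !pe// eqxx (negbTE ki) [i == ord0]eq_sym (negbTE i0)/=; ring.
have eta_cvg x : 0 < s x -> \forall m \near \oo, 1 <= m.+1%:R * s x.
  move=> sx; near=> m; rewrite -ler_pdivrMr// (@le_trans _ _ m%:R)//; last first.
    by rewrite ler_nat.
  by near: m; exact: nbhs_infty_ger.
have [ca ca0 hca] := bK' _ (smooth_partial k sa) (pK k _ aK).
have [cb cb0 hcb] := bK' _ (smooth_partial i sb) (pK i _ bK).
have eta1 m x : `|eta m x| <= 1.
  by rewrite ger0_norm ?smoothstep_ge0 ?smoothstep_le1.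
have c0 : 0 <= ca + cb + `|C| * Mt.
  exact: addr_ge0 (addr_ge0 (ltW ca0) (ltW cb0)) (mulr_ge0 (normr_ge0 _) (ltW Mt0)).
have mv := integrable_measurable_fun vi.
have mG j := integrable_measurable_fun (Gi j).
have [] := @Rintegral_dominated _ _ _ mu F
  (fun x => v x * (partial k a x + partial i b x))
  (fun x => `|v x| * (ca + cb + `|C| * Mt)).
- move=> m; apply: measurable_funM => //; apply: measurable_funD;
    apply: smooth_measurable.
    exact: smooth_partial (se m _ sa).
  exact: smooth_partial (se m _ sb).
- move=> x; have [Kx|Kx] := pselect (K x); last first.
    under eq_cvg do rewrite Fx aK// bK// !mulr0 subrr mulr0 addr0 !pK// addr0 mulr0.
    by rewrite !pK// addr0; exact: cvg_cst.
  have [Dx|/v0[vx _]] := pselect (D x); last first.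
    by under eq_cvg do rewrite Fx vx mul0r; rewrite vx mul0r; exact: cvg_cst.
  apply: cvg_near_cst; apply: filterS (eta_cvg _ (DK _ Kx Dx)) => m hm.
  rewrite Fx /eta smoothstep_eq1; last by rewrite (le_trans _ hm)//; lra.
  by rewrite smoothstep_derive0 ?hm ?orbT// mulr0 mul0r addr0 mul1r.
- apply: (@integrable_mul_bounded _ _ _ _ (ca + cb + `|C| * Mt)) => //.
    exact: integrable_norm vi.
  by move=> x _; rewrite ger0_norm.
- move=> m x; rewrite Fx normrM ler_wpM2l// (le_trans (ler_normD _ _))// lerD//.
    rewrite normrM (le_trans (ler_pM _ _ (eta1 _ _) (ler_normD _ _)))// mul1r.
    by rewrite lerD.
  rewrite 2!normrM.
  (* Deriving [eta m] produces a factor [m + 1]. Where that derivative is nonzero, [(m + 1) s] lies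
     between 0 and 1, and the field contributes at most [C |s|], so the product stays bounded. *)
  have [h0|h0] := eqVneq (derive1 (@smoothstep R) (m.+1%:R * s x)) 0.
    by rewrite h0 normr0 mulr0 mul0r mulr_ge0// ltW.
  have : ~~ ((m.+1%:R * s x <= 0) || (1 <= m.+1%:R * s x)).
    by apply: contra h0 => /smoothstep_derive0 ->.
  rewrite negb_or -!ltNge => /andP[h1 h2].
  have h3 : `|m.+1%:R : R| * `|s x| <= 1 by rewrite -normrM ger0_norm ltW.
  apply: (@le_trans _ _ (`|m.+1%:R| * Mt * (`|C| * `|s x|))).
    rewrite ler_pM ?mulr_ge0// ?ler_wpM2l//.
    by rewrite (le_trans (abC x))// ler_wpM2r// ler_norm.
  rewrite (_ : _ * _ * _ = (`|m.+1%:R| * `|s x|) * (`|C| * Mt)); last by ring.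
  by rewrite ler_piMl// mulr_ge0// ltW.
move=> _ cvF.
have [] := @Rintegral_dominated _ _ _ mu Gm
  (fun x => G k x * a x + G i x * b x)
  (fun x => `|G k x * a x| + `|G i x * b x|).
- move=> m; apply: measurable_funD; apply: measurable_funM => //;
    apply: smooth_measurable.
    exact: se.
  exact: se.
- move=> x; have [Kx|Kx] := pselect (K x); last first.
    rewrite aK// bK// !mulr0; under eq_cvg do rewrite /Gm aK// bK// !mul0r !mulr0 addr0.
    by rewrite addr0; exact: cvg_cst.
  have [Dx|/v0[_ gx]] := pselect (D x); last first.
    by under eq_cvg do rewrite /Gm !gx !mul0r; rewrite !gx !mul0r; exact: cvg_cst.
  apply: cvg_near_cst; apply: filterS (eta_cvg _ (DK _ Kx Dx)) => m hm.
  by rewrite /Gm /eta smoothstep_eq1 ?mulr1// (le_trans _ hm)//; lra.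
- apply: integrableDR; apply: integrable_norm; exact: itm.
- move=> m x; rewrite /Gm (le_trans (ler_normD _ _))//.
  rewrite [G k x * (a x * _)]mulrA [G i x * (b x * _)]mulrA lerD//.
    by rewrite normrM ler_piMr.
  by rewrite normrM ler_piMr.
move=> _ cvG.
have e : (fun m => \int[mu]_x F m x) = \- (fun m => \int[mu]_x Gm m x).
  by apply/funext => m; exact: FG.
by rewrite e in cvF; exact: (cvg_unique _ cvF (cvgN cvG)).
Unshelve. all: by end_near. Qed.

Definition axis_reflect (h : R -> R) (i : 'I_n) (sg : R) : V -> V :=
  coord_reflect i (fun x => 2 * sg * h (x ord0 ord0)).

Lemma measurable_axis_shift (h : R -> R) (sg : R) : measurable_fun setT h ->
  measurable_fun setT (fun x : V => 2 * sg * h (x ord0 ord0)).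
Proof.
move=> mh; apply: measurable_funM => //; apply: (measurableT_comp mh).
exact: measurable_coord_rV.
Qed.

Lemma axis_reflect_indep h (i : 'I_n) sg : i != ord0 ->
  indep_coord i (fun x : V => 2 * sg * h (x ord0 ord0)).
Proof. by move=> i0 x y xy; rewrite xy// eq_sym. Qed.

Lemma axis_reflectK h (i : 'I_n) sg : i != ord0 -> involutive (axis_reflect h i sg).
Proof. by move=> i0; apply: coord_reflectK; exact: axis_reflect_indep. Qed.

Lemma axis_reflect0 h (i : 'I_n) sg (x : V) : i != ord0 ->
  axis_reflect h i sg x ord0 ord0 = x ord0 ord0.
Proof. by move=> i0; rewrite coord_reflectE eq_sym (negbTE i0). Qed.

Lemma axis_reflect_i h (i : 'I_n) sg (x : V) :
  axis_reflect h i sg x ord0 i = 2 * sg * h (x ord0 ord0) - x ord0 i.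
Proof. by rewrite coord_reflectE eqxx. Qed.

Lemma axis_reflect_eq h H (i : 'I_n) sg (x : V) : h (x ord0 ord0) = H (x ord0 ord0) ->
  axis_reflect h i sg x = axis_reflect H i sg x.
Proof. by move=> hH; apply/rowP => k; rewrite !coord_reflectE hH. Qed.

Lemma axis_reflect_shift h (i : 'I_n) sg (x : V) :
  axis_reflect h i sg x = (2 * (sg * h (x ord0 ord0) - x ord0 i)) *: e i + x.
Proof.
apply/rowP => k; rewrite coord_reflectE !mxE eqxx/=.
by case: eqP => [->|_] /=; rewrite ?mulr1 ?mulr0 ?add0r//; ring.
Qed.

Definition reflect_fun h (i : 'I_n) sg v : V -> R :=
  fun x => v x + v (axis_reflect h i sg x).

(* The chain rule for the composition of [v], of gradient [G], with the
   reflection [x_i |-> 2 sg h(x_0) - x_i]. *)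
Definition reflect_grad h (dh : R -> R) (i : 'I_n) sg G (j : 'I_n) : V -> R :=
  fun x => if j == i then G i x - G i (axis_reflect h i sg x)
  else G j x + G j (axis_reflect h i sg x) +
    (j == ord0)%:R * (2 * sg * dh (x ord0 ord0) * G i (axis_reflect h i sg x)).

(** After the change of variables [phi] is replaced by its sum or difference with its reflection
    [phir], and [cutoff_divergence] applies to a field that depends on whether [j] is [i], [ord0] or
    another index. The smooth [H] stands for [h] on the support of [phi]. *)
Lemma reflect_weakly_differentiable (T M : R) (h dh : R -> R) (i : 'I_n) (sg : R)
    D D' v G :
  i != ord0 -> sg * sg = 1 ->
  measurable_fun setT h -> measurable_fun setT dh -> (forall t, `|dh t| <= M) ->
  (forall K : set V, compact K -> K `<=` [set x | `|x ord0 ord0| < T] ->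
     exists (H : R -> R) (T' : R), [/\ smooth1 H, K `<=` [set x | `|x ord0 ord0| < T'] &
       forall t, `|t| < T' -> h t = H t /\ dh t = derive1 H t]) ->
  D' `<=` [set x | `|x ord0 ord0| < T] ->
  (forall x : V, D x -> sg * x ord0 i < h (x ord0 ord0)) ->
  (forall x : V, D' x -> sg * x ord0 i < h (x ord0 ord0) -> D x) ->
  (forall x : V, D' x -> h (x ord0 ord0) < sg * x ord0 i ->
    D (axis_reflect h i sg x)) ->
  D `<=` D' -> (forall x, D (axis_reflect h i sg x) -> D' x) ->
  weakly_differentiable D v G ->
  weakly_differentiable D' (reflect_fun h i sg v) (reflect_grad h dh i sg G).
Proof.
move=> i0 sg1 mh mdh dhM hloc D'T DL D'L D'U DD' rDD' wv.
have [v0 vi Gi vG] := wv.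
have mc := measurable_axis_shift sg mh.
have ci := axis_reflect_indep h sg i0.
have iR f : mu.-integrable setT (EFin \o f) ->
    mu.-integrable setT (EFin \o (fun x => f (axis_reflect h i sg x))).
  by move=> fi; exact: (integrable_reflect mc ci fi).
have eR f : mu.-integrable setT (EFin \o f) ->
    \int[mu]_x f (axis_reflect h i sg x) = \int[mu]_x f x.
  by move=> fi; rewrite /Rintegral (integral_reflect mc ci fi).
have mdhx := measurable_axis_shift sg mdh.
have M0 : 0 <= M by apply: le_trans (dhM 0).
have idh f : mu.-integrable setT (EFin \o f) ->
    mu.-integrable setT (EFin \o (fun x => f x * (2 * sg * dh (x ord0 ord0)))).
  move=> fi; apply: (@integrable_mul_bounded _ _ _ _ (`|2 * sg| * M)) => //.
  by move=> x _; rewrite normrM ler_wpM2l.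
split.
- move=> x nD'; have nD : ~ D x by move=> /DD'.
  have nR : ~ D (axis_reflect h i sg x) by move=> /rDD'.
  have [v1 g1] := v0 _ nD; have [v2 g2] := v0 _ nR.
  rewrite /reflect_fun v1 v2 addr0; split => // j.
  by rewrite /reflect_grad !g1 !g2 !mulr0 subrr !addr0; case: eqP.
- by apply: integrableDR => //; exact: iR.
- move=> j; rewrite /reflect_grad; case: eqP => _.
    by apply: integrableBR => //; exact: iR.
  apply: integrableDR; first by apply: integrableDR => //; exact: iR.
  case: eqP => _; last first.
    rewrite (_ : _ \o _ = cst 0%E); first exact: integrable0.
    by apply/funext => x; rewrite /= mul0r.
  rewrite (_ : _ \o _ = EFin \o (fun x => G i (axis_reflect h i sg x) * (2 * sg * dh (x
    ord0 ord0)))).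
    exact/idh/iR.
  by apply/funext => x; rewrite /= mul1r mulrC.
move=> j phi tphi; have [sphi kphi phiD'] := tphi.
pose K := tsupport phi.
have [H [T' [sH KT' hH]]] := hloc K kphi (subset_trans phiD' D'T).
have [sdH dH] := smooth1_derive sH.
pose phir x := phi (axis_reflect H i sg x).
have sc : smooth_closure (fun x : V => 2 * sg * H (x ord0 ord0)).
  by apply: sc_mul; [exact: sc_cst|apply: sc_comp => //; exact: sc_coord].
have ciH := axis_reflect_indep H sg i0.
have sphir : smooth phir by apply: smooth_closure_smooth; exact: sc_reflect.
(* A compact set that carries both [phi] and [phir]. *)
pose K2 := K `|` axis_reflect H i sg @` K.
have crH : continuous (axis_reflect H i sg).
  exact: continuous_coord_reflect (smooth_continuous (smooth_closure_smooth sc)).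
have cK2 : compact K2.
  apply: compactU => //; apply: continuous_compact => //.
  exact: continuous_subspaceT.
have phiK2 x : ~ K2 x -> phi x = 0.
  by move=> nx; apply: tsupport_eq0 => Kx; apply: nx; left.
have phirK2 x : ~ K2 x -> phir x = 0.
  move=> nx; apply: (@tsupport_eq0 _ _ phi (axis_reflect H i sg x)) => Kx.
  by apply: nx; right; exists (axis_reflect H i sg x) => //; exact: axis_reflectK.
have K2T' x : K2 x -> `|x ord0 ord0| < T'.
  by move=> [/KT'//|[y /KT'/= yT' <-]]; rewrite axis_reflect0.
have K2D x : K2 x -> 0 < H (x ord0 ord0) - sg * x ord0 i -> D x.
  rewrite subr_gt0; move=> [Kx|[y Ky <-]].
    rewrite -(hH _ _).1; last exact: KT'.
    by apply: D'L; exact: phiD'.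
  rewrite axis_reflect0// axis_reflect_i -(hH _ _).1; last exact: KT'.
  rewrite mulrBr !mulrA [sg * 2]mulrC -[2 * sg * sg]mulrA sg1 mulr1 => hy.
  rewrite -(axis_reflect_eq _ _ (hH _ (KT' _ Ky)).1); apply: D'U; first exact: phiD'.
  lra.
have DK2 x : K2 x -> D x -> 0 < H (x ord0 ord0) - sg * x ord0 i.
  by move=> Kx /DL; rewrite subr_gt0 (hH _ (K2T' _ Kx)).1.
have tphii := test_function_partial i tphi.
have [C C0 hC] := test_function_bounded tphii.
have i0' : ord0 != i by rewrite eq_sym.
have sgn : `|sg| = 1 by apply/eqP; rewrite -sqrp_eq1// -normrX expr2 sg1 normr1.
(* A point and its reflection coincide on the graph and are at distance [2 |H - sg x_i|] elsewhere,
   hence the factor 2. *)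
have phiC x : `|phi x - phir x| <= 2 * C * `|H (x ord0 ord0) - sg * x ord0 i|.
  rewrite /phir axis_reflect_shift distrC.
  have [c ->] := mean_value_partial i x (2 * (sg * H (x ord0 ord0) - x ord0 i)) sphi.
  have -> : sg * H (x ord0 ord0) - x ord0 i = sg * (H (x ord0 ord0) - sg * x ord0 i).
    by rewrite mulrBr mulrA sg1 mul1r.
  rewrite !normrM sgn mul1r normr_nat [2 * C]mulrC -mulrA.
  by apply: ler_wpM2r; [rewrite mulr_ge0|exact: hC].
have itm u f : mu.-integrable setT (EFin \o u) -> smooth f ->
    (forall x, ~ K2 x -> f x = 0) -> mu.-integrable setT (EFin \o (fun x => u x * f x)).
  move=> ui sf fK.
  have kf : compact (tsupport f).
    apply: (subclosed_compact _ cK2); first exact: closed_closure.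
    by apply: tsupport_sub => //; exact: compact_closed (@norm_hausdorff _ _) cK2.
  have [c _ fc] := compact_support_bounded (smooth_continuous sf) kf.
  by apply: (@integrable_mul_bounded _ _ _ _ c) => //; exact: smooth_measurable.
have refl_test psi x : (forall y, ~ K y -> psi y = 0) ->
    psi (axis_reflect h i sg x) = psi (axis_reflect H i sg x).
  move=> psiK; have [xT|xT] := ltP `|x ord0 ord0| T'.
    by rewrite (axis_reflect_eq _ _ (hH _ xT).1).
  by rewrite !psiK// => /KT' /=; rewrite axis_reflect0// ltNge xT.
have sreflH psi : smooth psi -> smooth (fun x => psi (axis_reflect H i sg x)).
  by move=> spsi; apply: smooth_closure_smooth; exact: sc_reflect.
have reflK2 psi : (forall y, ~ K y -> psi y = 0) ->
    forall x, ~ K2 x -> psi (axis_reflect H i sg x) = 0.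
  move=> psiK x nx; apply: psiK => Kx; apply: nx; right.
  by exists (axis_reflect H i sg x) => //; exact: axis_reflectK.
have KK2 psi : (forall y, ~ K y -> psi y = 0) -> forall x, ~ K2 x -> psi x = 0.
  by move=> psiK x nx; apply: psiK => Kx; apply: nx; left.
have move_refl u psi : mu.-integrable setT (EFin \o u) -> smooth psi ->
    (forall y, ~ K y -> psi y = 0) ->
    mu.-integrable setT (EFin \o (fun x => u (axis_reflect h i sg x) * psi x)) /\
    \int[mu]_x (u (axis_reflect h i sg x) * psi x) =
    \int[mu]_x (u x * psi (axis_reflect H i sg x)).
  move=> ui spsi psiK; split; first exact: itm (iR _ ui) spsi (KK2 _ psiK).
  rewrite -(eR (fun x => u x * psi (axis_reflect H i sg x))); last first.
    exact: (itm _ _ ui (sreflH _ spsi) (reflK2 _ psiK)).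
  apply: eq_Rintegral => x _ /=; congr (_ * _).
  by rewrite -refl_test// axis_reflectK.
have phiK x : ~ K x -> phi x = 0 by exact: tsupport_eq0.
have pphiK k x : ~ K x -> partial k phi x = 0 by exact: partial_tsupport.
have spphi k : smooth (partial k phi) by exact: smooth_partial.
have lhs : \int[mu]_x (reflect_fun h i sg v x * partial j phi x) =
    \int[mu]_x (v x * (partial j phi x + partial j phi (axis_reflect H i sg x))).
  have [iv ev] := move_refl _ _ vi (spphi j) (pphiK j).
  rewrite /reflect_fun; under eq_Rintegral do rewrite mulrDl.
  have i1 := itm _ _ vi (spphi j) (KK2 _ (pphiK j)).
  have i2 := itm _ _ vi (sreflH _ (spphi j)) (reflK2 _ (pphiK j)).
  rewrite (RintegralD measurableT i1 iv) ev -(RintegralD measurableT i1 i2).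
  by apply: eq_Rintegral => x _; rewrite mulrDr.
have pphir k x : partial k phir x =
    (k != i)%:R * partial k phi (axis_reflect H i sg x) +
    ((k == ord0)%:R * (2 * sg * derive1 H (x ord0 ord0)) - (k == i)%:R) *
    partial i phi (axis_reflect H i sg x).
  apply: partialE; apply: is_derive_reflect => //.
  have dz := is_deriveZ (2 * sg) (is_derive_compR (dH (x ord0 ord0)) (is_derive_coord k
    ord0 x)).
  apply: is_derive_eq dz _.
  by rewrite -[LHS]/(2 * sg * (derive1 H (x ord0 ord0) * (k == ord0)%:R)); ring.
rewrite {}lhs.
(* For [j = i] the field is [(phi - phir) e_i], which vanishes on the graph. The second direction
   that [cutoff_divergence] asks for is [ord0], with coefficient 0. *)
have [ji|ji] := eqVneq j i.
  have [iG eG] := move_refl _ _ (Gi i) sphi phiK.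
  pose b x := phi x - phir x.
  have sb : smooth b.
    rewrite (_ : b = fun x => phi x + (fun=> -1) x * phir x); last first.
      by apply/funext => x; rewrite mulN1r.
    exact: (smoothD sphi (smoothM (smooth_cst _) sphir)).
  have pb x : partial i b x = partial i phi x + partial i phi (axis_reflect H i sg x).
    have -> : partial i b x = partial i phi x - partial i phir x.
      by apply: partialE; apply: is_deriveB; exact: smooth_is_derive.
    by rewrite pphir eqxx (negbTE i0)/=; ring.
  have p0 (k : 'I_n) (x : V) : partial k (fun=> 0 : R) x = 0.
    by apply: partialE; exact: is_derive_cst.
  transitivity (\int[mu]_x (v x * (partial ord0 (fun=> 0) x + partial i b x))).
    by apply: eq_Rintegral => x _; rewrite p0 add0r pb ji.
  have i1 := itm _ _ (Gi i) sphi phiK2.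
  have i2 := itm _ _ (Gi i) sphir phirK2.
  have bC (x : V) : `|(ord0 == ord0 :> 'I_n)%:R * derive1 H (x ord0 ord0) * (fun=> 0) x
    - sg * b x| <=
      2 * C * `|H (x ord0 ord0) - sg * x ord0 i|.
    by rewrite mulr0 sub0r normrN normrM sgn mul1r; exact: phiC.
  have bK2 x : ~ K2 x -> b x = 0 by move=> nx; rewrite /b phiK2// phirK2// subrr.
  rewrite (cutoff_divergence wv sH i0' i0' cK2 (smooth_cst 0) sb (fun _ _ => erefl) bK2
    K2D DK2 bC).
  rewrite ji; congr (- _); under eq_Rintegral do rewrite mulr0 add0r mulrBr.
  rewrite (RintegralB measurableT i1 i2).
  rewrite -eG /reflect_grad eqxx; under [RHS]eq_Rintegral do rewrite mulrBl.
  by rewrite (RintegralB measurableT i1 iG).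
pose a x := phi x + phir x.
have sa : smooth a by exact: smoothD.
have aK2 x : ~ K2 x -> a x = 0 by move=> nx; rewrite /a phiK2// phirK2// addr0.
have pa k x : partial k a x = partial k phi x + partial k phir x.
  by apply: partialE; apply: is_deriveD; exact: smooth_is_derive.
have [iG eG] := move_refl _ _ (Gi j) sphi phiK.
have ia := itm _ _ (Gi j) sphi phiK2.
have ja := itm _ _ (Gi j) sphir phirK2.
have eGa : \int[mu]_x (G j x * a x) = \int[mu]_x (G j x * phi x) +
    \int[mu]_x (G j (axis_reflect h i sg x) * phi x).
  rewrite eG -(RintegralD measurableT ia ja).
  by apply: eq_Rintegral => x _; rewrite mulrDr.
(* For [j] other than [i] and [ord0] the graph does not depend on [x_j], so [(phi + phir) e_j] is
   tangent to it and the constant is 0. *)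
have [j0|j0] := eqVneq j ord0; last first.
  have p0 (k : 'I_n) (x : V) : partial k (fun=> 0 : R) x = 0.
    by apply: partialE; exact: is_derive_cst.
  transitivity (\int[mu]_x (v x * (partial j a x + partial i (fun=> 0) x))).
    apply: eq_Rintegral => x _; congr (_ * _).
    by rewrite p0 addr0 pa pphir (negbTE ji) (negbTE j0)/= mul0r subrr mul0r mul1r
      addr0.
  have aC (x : V) : `|(j == ord0)%:R * derive1 H (x ord0 ord0) * a x - sg * (fun=> 0)
    x| <=
      0 * `|H (x ord0 ord0) - sg * x ord0 i|.
    by rewrite (negbTE j0) !mul0r mulr0 subrr normr0.
  rewrite (cutoff_divergence wv sH ji i0' cK2 sa (smooth_cst 0) aK2 (fun _ _ => erefl)
    K2D DK2 aC).
  congr (- _); under eq_Rintegral do rewrite mulr0 addr0.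
  rewrite eGa /reflect_grad (negbTE ji) (negbTE j0).
  under [RHS]eq_Rintegral do rewrite mul0r addr0 mulrDl.
  by rewrite (RintegralD measurableT ia iG).
(* For [j = ord0], this component along [e_i] makes [(phi + phir) e_0] tangent to the graph: the
   normal component becomes [H' (phi - phir)]. Its divergence also produces the extra term of the
   chain rule. *)
pose b (x : V) := 2 * sg * (derive1 H (x ord0 ord0) * phir x).
have sdH0 : smooth (fun x : V => derive1 H (x ord0 ord0)).
  by apply: smooth_closure_smooth; apply: sc_comp => //; exact: sc_coord.
have sb : smooth b by exact: (smoothM (smooth_cst _) (smoothM sdH0 sphir)).
have pb x : partial i b x = 2 * sg * (derive1 H (x ord0 ord0) * partial i phir x).
  apply: partialE; apply: is_deriveZ.
  have [s1 /(_ (x ord0 ord0)) d1] := smooth1_derive sdH.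
  have d2 := is_derive_compR d1 (is_derive_coord i ord0 x).
  apply: is_derive_eq (is_deriveM d2 (smooth_is_derive sphir i x)) _.
  by rewrite (negbTE i0) mulr0 scaler0 addr0.
have bK2 x : ~ K2 x -> b x = 0 by move=> nx; rewrite /b phirK2// !mulr0.
transitivity (\int[mu]_x (v x * (partial j a x + partial i b x))).
  apply: eq_Rintegral => x _; congr (_ * _).
  rewrite pa pb !pphir j0 !eqxx [ord0 == i]eq_sym (negbTE i0)/=; ring.
have abC (x : V) : `|(j == ord0)%:R * derive1 H (x ord0 ord0) * a x - sg * b x| <=
    M * (2 * C) * `|H (x ord0 ord0) - sg * x ord0 i|.
  rewrite j0 eqxx/= mul1r.
  rewrite (_ : _ - _ = derive1 H (x ord0 ord0) * (a x - 2 * (sg * sg) * phir x));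
    last first.
    by rewrite /b; ring.
  rewrite sg1 (_ : a x - _ = phi x - phir x); last by rewrite /a; ring.
  have [Kx|nKx] := pselect (K2 x); last first.
    by rewrite phiK2// phirK2// subrr mulr0 normr0 mulr_ge0// mulr_ge0// mulr_ge0// ltW.
  by rewrite normrM -mulrA ler_pM// -(hH _ (K2T' _ Kx)).2.
rewrite (cutoff_divergence wv sH ji i0' cK2 sa sb aK2 bK2 K2D DK2 abC).
congr (- _).
have ib := itm _ _ (Gi i) sb bK2.
have iaj : mu.-integrable setT (EFin \o (fun x => G j x * a x)).
  exact: itm (Gi j) sa aK2.
rewrite (RintegralD measurableT iaj ib) eGa.
have [iG' eG'] := move_refl _ _ (Gi i) sphi phiK.
have idb : mu.-integrable setT (EFin \o (fun x : V => 1 * (2 * sg * dh (x ord0 ord0) *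
    G i (axis_reflect h i sg x)) * phi x)).
  rewrite (_ : _ \o _ = EFin \o (fun x => (G i (axis_reflect h i sg x) * phi x) *
    (2 * sg * dh (x ord0 ord0)))); first exact: idh.
  by apply/funext => x /=; congr EFin; ring.
rewrite [RHS](_ : _ = \int[mu]_x ((G j x * phi x + G j (axis_reflect h i sg x) * phi x)
  +
    1 * (2 * sg * dh (x ord0 ord0) * G i (axis_reflect h i sg x)) * phi x)); last first.
  by apply: eq_Rintegral => x _; rewrite /reflect_grad (negbTE ji) j0 eqxx/=; ring.
rewrite (RintegralD measurableT (integrableDR ia iG) idb).
rewrite (RintegralD measurableT ia iG); congr (_ + _).
rewrite -(eR (fun x => G i x * b x))//.
apply: eq_Rintegral => x _; rewrite /b axis_reflect0// /phir -refl_test//.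
rewrite axis_reflectK//.
have [Kx|/phiK ->] := pselect (K x); last by rewrite !mulr0.
by rewrite (hH _ (KT' _ Kx)).2; ring.
Qed.

End reflection.

(** * The tube *)

Section truncated_limit.
Variables (R : realType) (tau : nat -> R) (T : R).
Hypothesis tau_lt : forall m, tau m < T.
Hypothesis tau_nd : forall m k, (m <= k)%N -> tau m <= tau k.
Hypothesis tau_T : forall t, t < T -> exists m, t < tau m.

Definition stable (X : Type) (r : X -> R) (F : nat -> X -> R) :=
  forall k m x, (k <= m)%N -> `|r x| < tau k -> F m x = F k x.

(* The indicator makes the limit equal to 0, instead of an unspecified value,
   outside of the union of the sets [|r| < tau m]. *)
Definition truncated_limit (X : Type) (r : X -> R) (F : nat -> X -> R) (x : X) : R :=
  limn (fun m => F m x * (`|r x| < tau m)%R%:R).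

Lemma truncated_limit_cvg (X : Type) (r : X -> R) F : stable r F -> forall x,
  F m x * (`|r x| < tau m)%R%:R @[m --> \oo] --> truncated_limit r F x.
Proof.
move=> sF x; suff [l hl] : exists l : R, F m x * (`|r x| < tau m)%R%:R @[m --> \oo] -->
  l.
  by rewrite /truncated_limit; apply/cvg_ex; exists l.
have [xT|Tx] := ltP `|r x| T.
  have [k xk] := tau_T xT; exists (F k x); apply: cvg_near_cst.
  exists k => // m /= km; rewrite (sF _ _ _ km xk) (lt_le_trans xk) ?mulr1//.
  exact: tau_nd.
exists 0; apply: cvg_near_cst; apply: nearW => m.
by rewrite ltNge (le_trans (ltW (tau_lt m)) Tx) mulr0.
Qed.

Lemma truncated_limitE (X : Type) (r : X -> R) F : stable r F -> forall k x,
  `|r x| < tau k -> truncated_limit r F x = F k x.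
Proof.
move=> sF k x xk; apply/cvg_lim => //; apply: cvg_near_cst.
exists k => // m /= km; rewrite (sF _ _ _ km xk) (lt_le_trans xk) ?mulr1//.
exact: tau_nd.
Qed.

Lemma truncated_limit0 (X : Type) (r : X -> R) F x : T <= `|r x| ->
  truncated_limit r F x = 0.
Proof.
move=> Tx; apply/cvg_lim => //; apply: cvg_near_cst; apply: nearW => m.
by rewrite ltNge (le_trans (ltW (tau_lt m)) Tx) mulr0.
Qed.

Lemma measurable_truncated_limit d (X : measurableType d) (r : X -> R) F :
  stable r F -> measurable_fun setT r -> (forall m, measurable_fun setT (F m)) ->
  measurable_fun setT (truncated_limit r F).
Proof.
move=> sF mr mF.
apply: (@measurable_fun_cvg _ _ _ _ (fun m x => F m x * (`|r x| < tau m)%R%:R)).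
  move=> m; apply: measurable_funM => //.
  rewrite (_ : (fun x => _) = \1_[set x | `|r x| < tau m]).
    apply: measurable_indic; rewrite -[X in measurable X]setTI.
    apply: measurable_fun_ltr => //; exact: measurableT_comp.
  apply/funext => x; rewrite indicE; have [xm|xm] := boolP (`|r x| < tau m).
    by rewrite mem_set.
  by rewrite memNset//=; exact/negP.
by move=> x _; exact: truncated_limit_cvg.
Qed.

End truncated_limit.

(** * Smooth interpolation of the bead sizes *)

Section knots.
Variables (R : realType) (ell : nat -> R).
Hypothesis ell_gt0 : forall m, 0 < ell m.
Hypothesis ell_le1 : forall m, ell m <= 1.
Hypothesis ell_leS : forall m, ell m <= 2 * ell m.+1.
Hypothesis ell_geS : forall m, ell m.+1 <= 2 * ell m.
Hypothesis ell_sum : exists B, forall m, \sum_(j < m) ell j <= B.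

Definition knot m := \sum_(j < m) ell j.
Definition knot_sup := sup (range knot).

Lemma knotS m : knot m.+1 = knot m + ell m.
Proof. by rewrite /knot big_ord_recr. Qed.

Lemma knot_ltS m : knot m < knot m.+1.
Proof. by rewrite knotS ltrDl. Qed.

Lemma knot_nd m k : (m <= k)%N -> knot m <= knot k.
Proof.
move=> /subnK <-; elim: (k - m)%N => // j IH.
by rewrite addSn (le_trans IH)// ltW// knot_ltS.
Qed.

Lemma knot_ge0 m : 0 <= knot m.
Proof. by apply: sumr_ge0 => i _; exact: ltW. Qed.

Let has_sup_knot : has_sup (range knot).
Proof.
split; first by exists (knot 0); exists 0%N.
by have [B hB] := ell_sum; exists B => _ [m _ <-]; exact: hB.
Qed.

Lemma knot_lt m : knot m < knot_sup.
Proof.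
by apply: (lt_le_trans (knot_ltS m)); apply: sup_upper_bound => //; exists m.+1.
Qed.

Lemma knot_cvg t : t < knot_sup -> exists m, t < knot m.
Proof.
by move=> /(sup_gt (has_sup_knot.1))[_ [m _ <-] tm]; exists m.
Qed.

Lemma knot_sup_gt0 : 0 < knot_sup.
Proof. by rewrite (le_lt_trans (knot_ge0 0))// knot_lt. Qed.

Lemma knot_index t : 0 <= t -> t < knot_sup -> exists m, knot m <= t < knot m.+1.
Proof.
move=> t0 /knot_cvg[m]; elim: m => [|m IH] tm.
  by move: tm; rewrite /knot big_ord0 ltNge t0.
by have [/IH//|mt] := ltP t (knot m); exists m; rewrite mt.
Qed.

(* A smooth even function that increases from 0 to 1 as the absolute value of
   the argument goes from [knot j] to [knot j.+1]. *)
Definition knot_step j (t : R) :=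
  smoothstep ((ell j)^-1 * t + - ((ell j)^-1 * knot j)) +
  smoothstep (- (ell j)^-1 * t + - ((ell j)^-1 * knot j)).

Lemma smooth_knot_step j : smooth1 (knot_step j).
Proof.
apply: smooth1_closure_smooth1; apply: s1_add;
  (apply: s1_comp; first exact: smoothstep_smooth);
  exact/s1_base/smooth1_affine.
Qed.

Let arg_le0 j (t : R) : t <= knot j -> (ell j)^-1 * t + - ((ell j)^-1 * knot j) <= 0.
Proof. by move=> h; rewrite -mulrBr mulr_ge0_le0 ?invr_ge0 ?(ltW (ell_gt0 _))//
  subr_le0. Qed.

Let arg_ge1 j (t : R) : knot j.+1 <= t -> 1 <= (ell j)^-1 * t + - ((ell j)^-1 * knot j).
Proof.
move=> h; rewrite -mulrBr ler_pdivlMl// mulr1.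
by rewrite knotS in h; lra.
Qed.

Lemma knot_stepN j (t : R) : knot_step j (- t) = knot_step j t.
Proof. by rewrite /knot_step mulrNN mulrN -mulNr addrC. Qed.

Lemma knot_step_abs j (t : R) : knot_step j `|t| = knot_step j t.
Proof. by have [_|_] := ger0P t; rewrite ?knot_stepN. Qed.

Lemma knot_step_pos j (t : R) : 0 <= t ->
  knot_step j t = smoothstep ((ell j)^-1 * t + - ((ell j)^-1 * knot j)).
Proof.
move=> t0; rewrite /knot_step [X in _ + X]smoothstep_eq0 ?addr0//.
rewrite (@le_trans _ _ 0)// mulNr -mulrN; apply: arg_le0.
by rewrite (le_trans _ (knot_ge0 _))// oppr_le0.
Qed.

Lemma knot_step_eq0 j (t : R) : `|t| <= knot j -> knot_step j t = 0.
Proof.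
move=> h; rewrite -knot_step_abs knot_step_pos// smoothstep_eq0//.
by rewrite (@le_trans _ _ 0)//; exact: arg_le0.
Qed.

Lemma knot_step_eq1 j (t : R) : knot j.+1 <= `|t| -> knot_step j t = 1.
Proof.
move=> h; rewrite -knot_step_abs knot_step_pos// smoothstep_eq1//.
by rewrite (@le_trans _ _ 1)//; [lra|exact: arg_ge1].
Qed.

Lemma knot_step_ge0 j (t : R) : 0 <= knot_step j t.
Proof. by rewrite addr_ge0// smoothstep_ge0. Qed.

Lemma knot_step_le1 j (t : R) : knot_step j t <= 1.
Proof. by rewrite -knot_step_abs knot_step_pos// smoothstep_le1. Qed.

Variable M : R.
Hypothesis M_ge : forall x : R, `|derive1 (@smoothstep R) x| <= M.

Let M_ge0 : 0 <= M. Proof. exact: le_trans (M_ge 0). Qed.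

Lemma derive1_knot_step j (t : R) : derive1 (knot_step j) t =
  (ell j)^-1 * (derive1 (@smoothstep R) ((ell j)^-1 * t + - ((ell j)^-1 * knot j)) -
   derive1 (@smoothstep R) (- (ell j)^-1 * t + - ((ell j)^-1 * knot j))).
Proof.
have [_ ds] := smooth1_derive (@smoothstep_smooth R).
have h (a b : R) : is_derive t (1 : R) (fun t => smoothstep (a * t + b))
    (derive1 (@smoothstep R) (a * t + b) * a).
  exact: (is_derive1_comp (ds _) (is_derive_affine a b t)).
rewrite derive1E.
have := is_deriveD (h (ell j)^-1 (- ((ell j)^-1 * knot j)))
   (h (- (ell j)^-1) (- ((ell j)^-1 * knot j))).
by case=> _ ->; rewrite mulrN -mulrBl mulrC.
Qed.

Lemma derive1_knot_step_eq0 j (t : R) : (`|t| <= knot j) || (knot j.+1 <= `|t|) ->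
  derive1 (knot_step j) t = 0.
Proof.
move=> h; have k0 := knot_ge0 j.
have e1 : ((ell j)^-1 * t - (ell j)^-1 * knot j <= 0) ||
    (1 <= (ell j)^-1 * t - (ell j)^-1 * knot j).
  have [t0|t0] := leP t 0.
    by rewrite (@arg_le0 j t)// (le_trans t0).
  have := h; rewrite gtr0_norm// => /orP[h1|h1]; first by rewrite arg_le0.
  by rewrite arg_ge1 ?orbT.
have e2 : (- (ell j)^-1 * t - (ell j)^-1 * knot j <= 0) ||
    (1 <= - (ell j)^-1 * t - (ell j)^-1 * knot j).
  rewrite mulNr -mulrN; have [t0|t0] := leP 0 t.
    by rewrite (@arg_le0 j (- t))// (le_trans _ k0)// oppr_le0.
  have := h; rewrite ltr0_norm// => /orP[h1|h1]; first by rewrite arg_le0.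
  by rewrite arg_ge1 ?orbT.
by rewrite derive1_knot_step (smoothstep_derive0 e1) (smoothstep_derive0 e2) subrr
  mulr0.
Qed.

(** For each sign of [t] one of the two terms of the derivative vanishes, hence [M] and not twice
    [M]. *)
Lemma derive1_knot_step_bound j (t : R) :
  `|derive1 (knot_step j) t| <= M / ell j.
Proof.
rewrite derive1_knot_step normrM mulrC [`|(ell j)^-1|]gtr0_norm ?invr_gt0//.
rewrite ler_wpM2r ?invr_ge0 ?(ltW (ell_gt0 _))//.
have k0 := knot_ge0 j; have [t0|t0] := leP 0 t.
  rewrite [X in _ - X]smoothstep_derive0 ?subr0//.
  by rewrite mulNr -mulrN (@arg_le0 j (- t))// (le_trans _ k0)// oppr_le0.
rewrite [X in X - _]smoothstep_derive0 ?sub0r ?normrN//.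
by rewrite (@arg_le0 j t)// (le_trans (ltW t0)).
Qed.

(** Used twice: with the increments [ell j.+1 - ell j] for the width of the tube, and later with the
    increments [d j] for the function that has no extension. *)
Definition step_fun (a : nat -> R) m (t : R) := \sum_(j < m) a j * knot_step j t.

Lemma smooth_step_fun a m : smooth1 (step_fun a m).
Proof.
apply: smooth1_closure_smooth1; rewrite /step_fun; elim: m => [|m IH].
  by under eq_fun do rewrite big_ord0; exact: s1_cst.
under eq_fun do rewrite big_ord_recr.
apply: s1_add => //; apply: s1_mul; first exact: s1_cst.
exact/s1_base/smooth_knot_step.
Qed.

Lemma stable_step_fun a : stable knot id (step_fun a).
Proof.
move=> k m t /subnK <- tk; elim: (m - k)%N => // j IH.
rewrite addSn -IH /step_fun big_ord_recr/= knot_step_eq0 ?mulr0 ?addr0//.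
by rewrite (le_trans (ltW tk))// knot_nd// leq_addl.
Qed.

Lemma step_funE a k t : knot k <= `|t| ->
  step_fun a k.+1 t = \sum_(j < k) a j + a k * knot_step k t.
Proof.
move=> kt; rewrite /step_fun big_ord_recr/=; congr (_ + _).
apply: eq_bigr => j _; rewrite knot_step_eq1 ?mulr1//.
by rewrite (le_trans _ kt)// knot_nd.
Qed.

Lemma step_fun_end a m t : knot m <= `|t| -> step_fun a m t = \sum_(j < m) a j.
Proof.
move=> mt; apply: eq_bigr => j _; rewrite knot_step_eq1 ?mulr1//.
by rewrite (le_trans _ mt)// knot_nd.
Qed.

Lemma derive1_step_fun a m t :
  derive1 (step_fun a m) t = \sum_(j < m) a j * derive1 (knot_step j) t.
Proof.
rewrite derive1E; suff [] : is_derive t (1 : R) (step_fun a m)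
  (\sum_(j < m) a j * derive1 (knot_step j) t) by [].
rewrite /step_fun; elim: m => [|m IH].
  by under eq_fun do rewrite big_ord0; rewrite big_ord0; exact: is_derive_cst.
under eq_fun do rewrite big_ord_recr/=; rewrite big_ord_recr/=.
apply: is_deriveD; apply: is_deriveZ.
by have [_] := smooth1_derive (smooth_knot_step m); exact.
Qed.

Lemma derive1_step_fun_eq a k m t : (k < m)%N -> knot k <= `|t| < knot k.+1 ->
  derive1 (step_fun a m) t = a k * derive1 (knot_step k) t.
Proof.
move=> km /andP[kt tk]; rewrite derive1_step_fun (bigD1 (Ordinal km))//=.
rewrite big1 ?addr0// => j jk.
rewrite derive1_knot_step_eq0 ?mulr0//; apply/orP.
have : (j != k :> nat) by apply: contra jk => /eqP jk; apply/eqP/val_inj.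
rewrite neq_ltn => /orP[jlk|klj].
  by right; rewrite (le_trans _ kt)// knot_nd.
by left; rewrite (le_trans (ltW tk))// knot_nd.
Qed.

Lemma derive1_step_fun_end a m t : knot m <= `|t| -> derive1 (step_fun a m) t = 0.
Proof.
move=> mt; rewrite derive1_step_fun big1// => j _.
rewrite derive1_knot_step_eq0 ?mulr0//; apply/orP; right.
by rewrite (le_trans _ mt)// knot_nd.
Qed.

Lemma stable_derive1_step_fun a : stable knot id (fun m => derive1 (step_fun a m)).
Proof.
move=> k m t /subnK <- tk; elim: (m - k)%N => // j IH.
rewrite addSn -IH !derive1_step_fun big_ord_recr/= derive1_knot_step_eq0 ?mulr0
  ?addr0//.
by rewrite (le_trans (ltW tk))// knot_nd// leq_addl.
Qed.

(* By telescoping, the value is [ell k] at [knot k] for [k <= m]. *)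
Definition width m (t : R) := ell 0 + step_fun (fun j => ell j.+1 - ell j) m t.

Lemma smooth_width m : smooth1 (width m).
Proof.
apply: smooth1_closure_smooth1; apply: s1_add; first exact: s1_cst.
exact/s1_base/smooth_step_fun.
Qed.

Lemma derive1_width m t :
  derive1 (width m) t = derive1 (step_fun (fun j => ell j.+1 - ell j) m) t.
Proof.
have [_ /(_ t) ds] := smooth1_derive (smooth_step_fun (fun j => ell j.+1 - ell j) m).
rewrite [LHS]derive1E; have [_ ->] := is_deriveD (is_derive_cst (ell 0) t (1 : R)) ds.
by rewrite add0r.
Qed.

Lemma stable_width : stable knot id width.
Proof. by move=> k m t km tk; rewrite /width (stable_step_fun _ km tk). Qed.

Lemma stable_derive1_width : stable knot id (fun m => derive1 (width m)).
Proof. by move=> k m t km tk; rewrite !derive1_width (stable_derive1_step_fun _ km tk).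
  Qed.

(** On this bead the width is a convex combination of [ell k] and [ell k.+1], which differ by a
    factor 2 at most. *)
Lemma width_bounds k m t : (k < m)%N -> knot k <= `|t| < knot k.+1 ->
  ell k / 2 <= width m t <= 2 * ell k.
Proof.
move=> km /andP[kt tk]; rewrite (stable_width km tk) /width step_funE//.
have -> : \sum_(j < k) (ell j.+1 - ell j) = ell k - ell 0.
  by rewrite -(big_mkord xpredT (fun j => ell j.+1 - ell j)) telescope_sumr.
have := knot_step_ge0 k t; have := knot_step_le1 k t.
have := ell_leS k; have := ell_geS k; have := ell_gt0 k.
by move: (knot_step k t) => s ? ? ? ? ?; apply/andP; split; nra.
Qed.

Lemma width_end m t : knot m <= `|t| -> width m t = ell m.
Proof.
move=> mt; rewrite /width step_fun_end//.
rewrite -(big_mkord xpredT (fun j => ell j.+1 - ell j)) telescope_sumr//.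
by rewrite addrC subrK.
Qed.

Lemma width_gt0 m t : 0 < width m t.
Proof.
have [mt|tm] := leP (knot m) `|t|; first by rewrite width_end.
have [k kt] := knot_index (normr_ge0 t) (lt_trans tm (knot_lt m)).
have km : (k < m)%N.
  rewrite ltnNge; apply/negP => mk.
  by move: (le_lt_trans (knot_nd mk) (le_lt_trans (andP kt).1 tm)); rewrite ltxx.
by have /andP[h _] := width_bounds km kt; rewrite (lt_le_trans _ h)// divr_gt0.
Qed.

(** Along a bead of length [ell k] the width changes by at most [ell k], so the slopes stay bounded
    although the beads shrink. *)
Lemma derive1_width_bound m t : `|derive1 (width m) t| <= M.
Proof.
rewrite derive1_width; have [mt|tm] := leP (knot m) `|t|.
  by rewrite derive1_step_fun_end// normr0.
have [k kt] := knot_index (normr_ge0 t) (lt_trans tm (knot_lt m)).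
have km : (k < m)%N.
  rewrite ltnNge; apply/negP => mk.
  by move: (le_lt_trans (knot_nd mk) (le_lt_trans (andP kt).1 tm)); rewrite ltxx.
rewrite (derive1_step_fun_eq _ km kt) normrM.
have h1 : `|ell k.+1 - ell k| <= ell k.
  have := ell_leS k; have := ell_geS k; have := ell_gt0 k.
  by move=> ? ? ?; rewrite ler_norml; apply/andP; split; lra.
rewrite (le_trans (ler_pM _ _ h1 (derive1_knot_step_bound k t)))//.
by rewrite mulrCA mulfV ?mulr1// gt_eqF.
Qed.

Definition tube_width : R -> R := truncated_limit knot id width.
Definition tube_slope : R -> R := truncated_limit knot id (fun m => derive1 (width m)).

Lemma tube_widthE m t : `|t| < knot m -> tube_width t = width m t.
Proof. exact: (truncated_limitE knot_nd stable_width). Qed.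

Lemma tube_slopeE m t : `|t| < knot m -> tube_slope t = derive1 (width m) t.
Proof. exact: (truncated_limitE knot_nd stable_derive1_width). Qed.

Lemma tube_width_bounds k t : knot k <= `|t| < knot k.+1 ->
  ell k / 2 <= tube_width t <= 2 * ell k.
Proof. by move=> kt; rewrite (tube_widthE (andP kt).2) width_bounds. Qed.

Lemma tube_width_gt0 t : `|t| < knot_sup -> 0 < tube_width t.
Proof. by move=> /knot_cvg[m tm]; rewrite (tube_widthE tm) width_gt0. Qed.

Lemma tube_width0 t : knot_sup <= `|t| -> tube_width t = 0.
Proof. exact: (truncated_limit0 knot_lt). Qed.

Lemma tube_width_ge0 t : 0 <= tube_width t.
Proof. by have [/tube_width_gt0/ltW|/tube_width0 ->] := ltP `|t| knot_sup. Qed.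

Lemma tube_width_le2 t : tube_width t <= 2.
Proof.
have [tT|/tube_width0 ->//] := ltP `|t| knot_sup.
have [k kt] := knot_index (normr_ge0 t) tT.
have /andP[_ h] := tube_width_bounds kt; rewrite (le_trans h)//.
by have := ell_le1 k; lra.
Qed.

Lemma tube_slope_bound t : `|tube_slope t| <= M.
Proof.
have [tT|tT] := ltP `|t| knot_sup.
  have [m tm] := knot_cvg tT.
  by rewrite (tube_slopeE tm) derive1_width_bound.
by rewrite /tube_slope (truncated_limit0 knot_lt)// normr0.
Qed.

Lemma measurable_smooth1 (f : R -> R) : smooth1 f -> measurable_fun setT f.
Proof. by move=> /smooth1_continuous; exact: continuous_measurable_fun. Qed.

Lemma measurable_tube_width : measurable_fun setT tube_width.
Proof.
apply: (measurable_truncated_limit knot_lt knot_nd knot_cvg stable_width) => // m.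
by apply: measurable_smooth1; exact: smooth_width.
Qed.

Lemma measurable_tube_slope : measurable_fun setT tube_slope.
Proof.
apply: (measurable_truncated_limit knot_lt knot_nd knot_cvg stable_derive1_width) => //
  m.
by apply: measurable_smooth1; have [] := smooth1_derive (smooth_width m).
Qed.

(** A compact set keeps away from the ends, so that on it the width is one of the smooth functions
    [width m]. *)
Lemma compact_knot n (K : set 'rV[R]_n.+1) : compact K ->
  K `<=` [set x | `|x ord0 ord0| < knot_sup] ->
  exists m, K `<=` [set x | `|x ord0 ord0| < knot m].
Proof.
rewrite compact_cover => cK KT.
have [|x Kx|F _ KF] := cK nat setT (fun m => [set x : 'rV[R]_n.+1 | `|x ord0 ord0| <
  knot m]).
- move=> m _; rewrite (_ : [set _ | _] = [set x : 'rV[R]_n.+1 | - knot m < x ord0 ord0]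
    `&`
    [set x | x ord0 ord0 < knot m]).
    by apply: openI; [exact: open_coord_gt|exact: open_coord_lt].
  by apply/seteqP; split => x /=; rewrite ltr_norml => /andP.
- by have [m xm] := knot_cvg (KT _ Kx); exists m.
exists (\max_(m <- finmap.enum_fset F) m)%N => x /KF[m mF xm].
apply: (lt_le_trans xm); apply: knot_nd.
by have := @leq_bigmax_seq _ (finmap.enum_fset F) xpredT id m; apply.
Qed.

End knots.

(** * The extension operator *)

Section plateau.
Variable R : realType.

Definition plateau (y : R) : R :=
  1 - smoothstep (1 * y + -1) - smoothstep (-1 * y + -1).

Lemma plateau_smooth : smooth1 plateau.
Proof.
rewrite (_ : plateau = fun y => (1 + (-1) * smoothstep (1 * y + -1)) +
    (-1) * smoothstep (-1 * y + -1)); last first.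
  by apply/funext => y; rewrite /plateau; ring.
apply: smooth1_closure_smooth1; apply: s1_add; first apply: s1_add.
- exact: s1_cst.
- apply: s1_mul; first exact: s1_cst.
  by apply: s1_comp; [exact: smoothstep_smooth|apply: s1_base; exact: smooth1_affine].
- apply: s1_mul; first exact: s1_cst.
  by apply: s1_comp; [exact: smoothstep_smooth|apply: s1_base; exact: smooth1_affine].
Qed.

Lemma plateau_eq1 (y : R) : `|y| <= 1 -> plateau y = 1.
Proof.
rewrite ler_norml => /andP[y1 y2].
by rewrite /plateau !smoothstep_eq0 ?subr0//; lra.
Qed.

Lemma plateau_eq0 (y : R) : 7 / 4 <= `|y| -> plateau y = 0.
Proof.
rewrite ler_normr => /orP[y1|y1].
  by rewrite /plateau smoothstep_eq1 ?[smoothstep (-1 * _ + _)]smoothstep_eq0 ?subrr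
    ?subr0//; lra.
by rewrite /plateau smoothstep_eq0 ?[smoothstep (-1 * _ + _)]smoothstep_eq1 ?subrr
  ?subr0//; lra.
Qed.

Lemma plateau_le1 (y : R) : `|plateau y| <= 1.
Proof.
rewrite /plateau; set s := smoothstep (1 * y + -1); set t := smoothstep (-1 * y + -1).
have [s0 s1] : 0 <= s /\ s <= 1 by rewrite smoothstep_ge0 smoothstep_le1.
have [t0 t1] : 0 <= t /\ t <= 1 by rewrite smoothstep_ge0 smoothstep_le1.
have [y0|y0] := leP 0 y.
  have : t = 0 by apply: smoothstep_eq0; lra.
  by rewrite ler_norml => ->; apply/andP; split; lra.
have : s = 0 by apply: smoothstep_eq0; lra.
by rewrite ler_norml => ->; apply/andP; split; lra.
Qed.

Lemma derive1_plateau (y : R) : derive1 plateau y =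
  derive1 (@smoothstep R) (-1 * y + -1) - derive1 (@smoothstep R) (1 * y + -1).
Proof.
have [_ ds] := smooth1_derive (@smoothstep_smooth R).
have h (a b : R) : is_derive y (1 : R) (fun t => smoothstep (a * t + b))
    (derive1 (@smoothstep R) (a * y + b) * a).
  exact: (is_derive1_comp (ds _) (is_derive_affine a b y)).
rewrite derive1E.
have := is_deriveB (is_deriveB (is_derive_cst (1 : R) y 1) (h 1 (-1))) (h (-1) (-1)).
by case=> _ ->; rewrite sub0r mulr1 mulrN1 opprK addrC.
Qed.

Lemma derive1_plateau_eq0 (y : R) : 2 <= `|y| -> derive1 plateau y = 0.
Proof.
rewrite derive1_plateau ler_normr => /orP[y1|y1].
  by rewrite !smoothstep_derive0 ?subrr//; apply/orP; [right|left]; lra.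
by rewrite !smoothstep_derive0 ?subrr//; apply/orP; [left|right]; lra.
Qed.

(** The bound with the factor [y] is for the derivative of [x_i / h(x_0)] along the axis, in which
    this quotient reappears. *)
Lemma derive1_plateau_bounded : exists2 B : R, 0 < B &
  forall y, `|derive1 plateau y| <= B /\ `|derive1 plateau y * y| <= B.
Proof.
have [A A0 hA] := @smoothstep_derive_bounded R; exists (4 * A);
  first by rewrite mulr_gt0.
move=> y; have b : `|derive1 plateau y| <= 2 * A.
  by rewrite derive1_plateau (le_trans (ler_normB _ _))// mulr_natl mulr2n lerD.
split; first by lra.
have [y2|y2] := leP 2 `|y|; first by rewrite derive1_plateau_eq0// mul0r normr0; lra.
by rewrite normrM (_ : 4 * A = 2 * A * 2); [apply: ler_pM => //; exact: ltW|ring].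
Qed.

End plateau.

(** * Young's inequality and integrals of powers *)

Section young.
Variable R : realType.

(** If [b^s <= a^r] then [b <= a^(r/s)], so [(a b)^q] is at most [a] to the power [q (1 + r/s) = r];
    the other case is symmetric. This crude form suffices. *)
Lemma young_powR (q r s a b : R) : 0 < q -> 0 < r -> 0 < s -> q^-1 = r^-1 + s^-1 ->
  0 <= a -> 0 <= b -> (a * b) `^ q <= a `^ r + b `^ s.
Proof.
move=> q0 r0 s0 qrs a0 b0; have e1 : q * (1 + r / s) = r.
  have -> : 1 + r / s = r * q^-1 by rewrite qrs mulrDr mulfV// gt_eqF.
  by rewrite mulrCA mulfV ?mulr1// gt_eqF.
have e2 : q * (1 + s / r) = s.
  have -> : 1 + s / r = s * q^-1 by rewrite qrs mulrDr mulfV ?gt_eqF// addrC.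
  by rewrite mulrCA mulfV ?mulr1// gt_eqF.
have H (a' b' r' s' : R) : 0 < r' -> 0 < s' -> q * (1 + r' / s') = r' -> 0 <= a' ->
  0 <= b' ->
    b' `^ s' <= a' `^ r' -> (a' * b') `^ q <= a' `^ r'.
  move=> r'0 s'0 e a'0 b'0 ab.
  have ba : b' <= a' `^ (r' / s').
    have -> : b' = (b' `^ s') `^ s'^-1 by rewrite -powRrM divff ?gt_eqF// powRr1.
    by rewrite powRrM; apply: ge0_ler_powR;
      rewrite ?nnegrE ?powR_ge0 ?invr_ge0 ?(ltW s'0).
  have -> : a' `^ r' = (a' `^ (1 + r' / s')) `^ q by rewrite -powRrM mulrC e.
  rewrite ge0_ler_powR ?nnegrE ?powR_ge0 ?mulr_ge0 ?(ltW q0)//.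
  rewrite powRD; last first.
    by apply/implyP => /eqP e0; move: r'0; rewrite -e e0 mulr0 ltxx.
  by rewrite powRr1// ler_wpM2l.
have [ab|ba] := leP (b `^ s) (a `^ r).
  by rewrite (le_trans (H a b r s _ _ _ _ _ _))// lerDl powR_ge0.
rewrite mulrC (le_trans (H b a s r _ _ _ _ _ _))//; first exact: ltW.
by rewrite lerDr powR_ge0.
Qed.

Lemma powRD_le (q a b : R) : 0 <= q -> 0 <= a -> 0 <= b ->
  (a + b) `^ q <= 2 `^ q * (a `^ q + b `^ q).
Proof.
move=> q0; wlog ab : a b / a <= b.
  by move=> H a0 b0; have [|/ltW] := leP a b;
    [move=> ab; exact: H|move=> ba; rewrite addrC [X in _ * X]addrC; exact: H].
move=> a0 b0; apply: (@le_trans _ _ ((2 * b) `^ q)).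
  by apply: ge0_ler_powR; rewrite ?nnegrE ?addr_ge0 ?mulr_ge0// mulr_natl mulr2n lerD2r.
by rewrite powRM// ler_wpM2l ?powR_ge0// lerDr powR_ge0.
Qed.

End young.

Section power_integral.
Variables (R : realType) (N : nat) (h : R -> R).
Local Notation n := N.+1.
Local Notation V := 'rV[R]_n.
Local Notation mu := (@lebesgue_rV R n).
Implicit Types Q : V -> R.
Hypothesis mh : measurable_fun setT h.

Lemma measurable_powR_comp d (T : measurableType d) (f : T -> R) (E : set T) (q : R) :
  measurable_fun E f -> measurable_fun E (fun x => f x `^ q).
Proof.
by move=> mf; apply: (@measurableT_comp _ _ _ _ _ _ (fun t : R => t `^ q)).
Qed.

Definition powint (q : R) Q : \bar R := (\int[mu]_x (Q x `^ q)%:E)%E.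

Lemma powintZ (q K : R) Q : 0 <= K -> measurable_fun setT Q -> (forall x, 0 <= Q x) ->
  powint q (fun x => K * Q x) = ((K `^ q)%:E * powint q Q)%E.
Proof.
move=> K0 mQ Q0; rewrite /powint -ge0_integralZl//.
- by apply: eq_integral => x _; rewrite powRM.
- by apply/measurable_EFinP; exact: measurable_powR_comp.
- by move=> x _; rewrite lee_fin powR_ge0.
- by rewrite lee_fin powR_ge0.
Qed.

Lemma powintD_le (q : R) Q Q' : 0 <= q ->
  measurable_fun setT Q -> measurable_fun setT Q' ->
  (forall x, 0 <= Q x) -> (forall x, 0 <= Q' x) ->
  (powint q (fun x => Q x + Q' x)%R <=
   (2 `^ q)%:E * (powint q Q + powint q Q'))%E.
Proof.
move=> q0 mQ mQ' Q0 Q'0.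
have mp f : measurable_fun setT f -> measurable_fun setT (fun x : V => (f x `^ q)%:E).
  by move=> mf; apply/measurable_EFinP; exact: measurable_powR_comp.
have p0 f (x : V) : (0 <= (f x `^ q)%:E)%E by rewrite lee_fin powR_ge0.
rewrite /powint -ge0_integralD//; [|exact: mp|exact: mp].
rewrite -ge0_integralZl//; last 2 first.
- by apply: emeasurable_funD; exact: mp.
- by move=> x _; rewrite adde_ge0.
apply: ge0_le_integral => //.
- by move=> x _; exact: (p0 (fun x => Q x + Q' x)).
- by apply: mp; exact: measurable_funD.
- by apply: measurable_funeM; apply: emeasurable_funD; exact: mp.
by move=> x _; rewrite -EFinD -EFinM lee_fin; exact: powRD_le.
Qed.

Lemma powint_reflect (q K : R) (i : 'I_n) sg Q : i != ord0 -> 0 <= K -> 0 <= q ->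
  measurable_fun setT Q -> (forall x, 0 <= Q x) ->
  (powint q (fun x => K * (Q x + Q (axis_reflect h i sg x)))%R <=
   (2 * (2 * K) `^ q)%:E * powint q Q)%E.
Proof.
move=> i0 K0 q0 mQ Q0.
have mc := measurable_axis_shift (N := N) sg mh.
have eR : powint q (fun x => Q (axis_reflect h i sg x)) = powint q Q.
  apply: (ge0_integral_reflect mc (axis_reflect_indep h sg i0) (f :=
    fun x => (Q x `^ q)%:E)).
    by apply/measurable_EFinP; exact: measurable_powR_comp.
  by move=> x; rewrite lee_fin powR_ge0.
have mQR : measurable_fun setT (fun x => Q (axis_reflect h i sg x)).
  by apply: (measurableT_comp mQ); exact: measurable_coord_reflect.
rewrite (powintZ q K0 (measurable_funD mQ mQR)); last by move=> x; rewrite addr_ge0.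
have -> : 2 * (2 * K) `^ q = K `^ q * (2 `^ q * 2) by rewrite powRM//; ring.
rewrite EFinM -muleA; apply: lee_wpmul2l; first by rewrite lee_fin powR_ge0.
rewrite EFinM -muleA.
have -> : (2%:E * powint q Q = powint q Q + powint q Q)%E.
  by rewrite -[RHS]mule2n mule_natl.
rewrite -{2}eR; exact: powintD_le.
Qed.

End power_integral.

(** * Reflections and cut-offs in a tube *)

Section tube.
Variables (R : realType) (N : nat) (T M : R) (h dh : R -> R).
Local Notation n := N.+1.
Local Notation V := 'rV[R]_n.
Local Notation e i := (delta_mx ord0 i : V).
Local Notation mu := (@lebesgue_rV R n).
Implicit Types (D : set V) (v Q phi psi : V -> R) (G : 'I_n -> V -> R).
Opaque partial.

Hypothesis mh : measurable_fun setT h.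
Hypothesis mdh : measurable_fun setT dh.
Hypothesis dhM : forall t, `|dh t| <= M.
Hypothesis h_ge0 : forall t, 0 <= h t.
Hypothesis h_gt0 : forall t, `|t| < T -> 0 < h t.
Hypothesis hloc : forall K : set V, compact K -> K `<=` [set x | `|x ord0 ord0| < T] ->
  exists (H : R -> R) (T' : R), [/\ smooth1 H, forall t, 0 < H t,
    K `<=` [set x | `|x ord0 ord0| < T'] &
    forall t, `|t| < T' -> h t = H t /\ dh t = derive1 H t].

Let M_ge0 : 0 <= M. Proof. exact: le_trans (dhM 0). Qed.

(* The invariant of the construction, where [Q] stands for
   [|v| / h + |grad v|]; it is preserved by reflections and cut-offs up to
   changing [Q]. *)
Definition dominated v G Q :=
  [/\ mu.-integrable setT (EFin \o Q), forall x, 0 <= Q x,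
      forall x : V, `|v x| <= h (x ord0 ord0) * Q x &
      forall j x, `|G j x| <= Q x].

Definition aspect (i : 'I_n) (x : V) : R := x ord0 i / h (x ord0 ord0).

Definition cut_fun (i : 'I_n) v (x : V) : R := plateau (aspect i x) * v x.

(** The j-th partial derivative of [plateau (aspect i x)], with [dh] in place of the derivative of
    [h]. *)
Definition cut_slope (i j : 'I_n) (x : V) : R := derive1 (@plateau R) (aspect i x) *
  ((j == i)%:R - (j == ord0)%:R * (aspect i x * dh (x ord0 ord0))) / h (x ord0 ord0).

Definition cut_grad (i : 'I_n) v G (j : 'I_n) (x : V) : R :=
  plateau (aspect i x) * G j x + cut_slope i j x * v x.

Lemma measurable_inv_width : measurable_fun setT (fun x : V => (h (x ord0 ord0))^-1).
Proof.
rewrite (_ : (fun _ => _) = fun x : V => h (x ord0 ord0) `^ (-1)); last first.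
  by apply/funext => x; rewrite powR_inv1.
have m1 : measurable_fun setT (fun x : V => h (x ord0 ord0)).
  by apply: (measurableT_comp mh); exact: measurable_coord_rV.
apply: (@measurableT_comp _ _ _ _ _ _ (fun t => t `^ (-1))) m1.
exact: measurable_powR.
Qed.

Lemma measurable_aspect i : measurable_fun setT (aspect i).
Proof.
by apply: measurable_funM; [exact: measurable_coord_rV|exact: measurable_inv_width].
Qed.

Lemma measurable_cut_slope i j : measurable_fun setT (cut_slope i j).
Proof.
apply: measurable_funM; last exact: measurable_inv_width.
apply: measurable_funM.
  apply: (@measurableT_comp _ _ _ _ _ _ (derive1 (@plateau R)));
    last exact: measurable_aspect.
  by apply: measurable_smooth1; have [] := smooth1_derive (@plateau_smooth R).
apply: measurable_funB => //; apply: measurable_funM => //.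
apply: measurable_funM; first exact: measurable_aspect.
by apply: (measurableT_comp mdh); exact: measurable_coord_rV.
Qed.

(** The slope of the cut-off is of order 1 / h, which the bound [|v| <= h Q] compensates. *)
Lemma cut_slope_bound (B : R) :
  (forall y : R, `|derive1 (@plateau R) y| <= B /\ `|derive1 (@plateau R) y * y| <= B)
    ->
  forall i j (x : V), h (x ord0 ord0) * `|cut_slope i j x| <= B * (1 + M).
Proof.
move=> hB i j x; set y := aspect i x; have [b1 b2] := hB y.
have B0 : 0 <= B by exact: le_trans b1.
have h1 : `|derive1 (@plateau R) y *
    ((j == i)%:R - (j == ord0)%:R * (y * dh (x ord0 ord0)))| <= B * (1 + M).
  rewrite mulrBr (le_trans (ler_normB _ _))// mulrDr mulr1 lerD//.
    by case: eqP => _ /=; rewrite ?mulr1 ?mulr0 ?normr0.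
  rewrite (_ : derive1 (@plateau R) y * _ = (derive1 (@plateau R) y * y) *
    ((j == ord0)%:R * dh (x ord0 ord0))); last by ring.
  rewrite normrM ler_pM//; case: eqP => _ /=; rewrite ?mul1r ?mul0r ?normr0//.
rewrite /cut_slope normrM; have [->|h0] := eqVneq (h (x ord0 ord0)) 0.
  by rewrite mul0r mulr_ge0 ?addr_ge0.
rewrite normfV (ger0_norm (h_ge0 _)) mulrCA divff// mulr1.
exact: h1.
Qed.

(** The Leibniz rule, by testing against [b phi], where [b] is the cut-off written with a smooth [H]
    in place of [h]. Although [phi] lives in [D'] only, [b phi] is a test function of [D], since the
    plateau is 0 where [|x_i|] is at least [7/4 h]. *)
Lemma cut_weakly_differentiable D D' i v G Q : i != ord0 ->
  D' `<=` [set x | `|x ord0 ord0| < T] -> D `<=` D' ->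
  (forall x, D' x -> `|x ord0 i| <= 7 / 4 * h (x ord0 ord0) -> D x) ->
  dominated v G Q -> weakly_differentiable D v G ->
  weakly_differentiable D' (cut_fun i v) (cut_grad i v G).
Proof.
move=> i0 D'T DD' D'D [Qi Q0 vQ GQ] [v0 vi Gi vG].
have [B B0 hB] := derive1_plateau_bounded R.
have mv := integrable_measurable_fun vi.
have mQ := integrable_measurable_fun Qi.
have mb : measurable_fun setT (fun x => plateau (aspect i x)).
  apply: (@measurableT_comp _ _ _ _ _ _ (@plateau R)); last exact: measurable_aspect.
  by apply: measurable_smooth1; exact: plateau_smooth.
have bi f : mu.-integrable setT (EFin \o f) ->
    mu.-integrable setT (EFin \o (fun x => plateau (aspect i x) * f x)).
  move=> fi; under eq_fun do rewrite mulrC.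
  by apply: (@integrable_mul_bounded _ _ _ _ 1) => // x _; exact: plateau_le1.
have si j : mu.-integrable setT (EFin \o (fun x => cut_slope i j x * v x)).
  apply: (@le_integrable _ _ _ _ _ _ _ (fun x => (B * (1 + M))%:E * (EFin \o Q) x)%E)
    => //.
  - apply/measurable_EFinP; apply: measurable_funM => //; exact: measurable_cut_slope.
  - move=> x _; rewrite /= lee_fin normrM [leRHS]ger0_norm; last first.
      by rewrite !mulr_ge0 ?addr_ge0// ltW.
    apply: le_trans (ler_wpM2r (Q0 x) (cut_slope_bound hB i j x)).
    by rewrite [h _ * _]mulrC -mulrA ler_wpM2l.
  - exact: integrableZl.
split.
- move=> x nD'; have nD : ~ D x by move=> /DD'.
  have [vx gx] := v0 _ nD; rewrite /cut_fun vx mulr0; split => // j.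
  by rewrite /cut_grad vx gx !mulr0 addr0.
- exact: bi.
- by move=> j; apply: integrableDR => //; exact: bi.
move=> j phi tphi; have [sphi kphi phiD'] := tphi.
have [H [T' [sH H0 KT' hH]]] := hloc kphi (subset_trans phiD' D'T).
have [sdH dH] := smooth1_derive sH.
have sHV : smooth1 (fun t => (H t)^-1).
  by apply: smooth1_closure_smooth1; apply: s1_inv; [exact: s1_base|move=> t;
    rewrite gt_eqF].
pose y (x : V) := x ord0 i * (H (x ord0 ord0))^-1.
have sy : smooth y.
  apply: smooth_closure_smooth; apply: sc_mul; first exact: sc_coord.
  by apply: (sc_comp sHV); exact: sc_coord.
pose b (x : V) := plateau (y x).
have sb : smooth b.
  by apply: smooth_closure_smooth; apply: (sc_comp (@plateau_smooth R)); exact: sc_base.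
have [sdHV dHV] := smooth1_derive sHV.
have [_ db] := smooth1_derive (@plateau_smooth R).
pose S := tsupport phi.
have Sy x : S x -> aspect i x = y x by move=> /KT' /hH[e1 _]; rewrite /aspect e1.
have dHVE t : derive1 (fun t => (H t)^-1) t = - (H t)^-1 ^+ 2 * derive1 H t.
  have H0' : H t != 0 by rewrite gt_eqF.
  rewrite derive1E; have [_ ->] := is_deriveV H0' (dH t).
  by rewrite exprVn.
have dy x : is_derive x (e j) y ((j == i)%:R * (H (x ord0 ord0))^-1 -
    (j == ord0)%:R * (y x * derive1 H (x ord0 ord0) * (H (x ord0 ord0))^-1)).
  have d1 := is_derive_coord j i x.
  have d2 := is_derive_compR (dHV (x ord0 ord0)) (is_derive_coord j ord0 x).
  apply: is_derive_eq (is_deriveM d1 d2) _; rewrite dHVE /y /GRing.scale/=; ring.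
have dbx x : is_derive x (e j) b (derive1 (@plateau R) (y x) * ((j == i)%:R * (H (x
  ord0 ord0))^-1 -
    (j == ord0)%:R * (y x * derive1 H (x ord0 ord0) * (H (x ord0 ord0))^-1))).
  exact: is_derive_compR (db _) (dy x).
have sp : forall x, S x -> partial j b x = cut_slope i j x.
  move=> x Sx; rewrite (partialE (dbx x)) /cut_slope (Sy _ Sx).
  by have [-> ->] := hH _ (KT' _ Sx); ring.
have tpsi : test_function D (fun x => b x * phi x).
  have cS : closed [set x : V | `|y x| <= 7 / 4].
    rewrite (_ : [set _ | _] = y @^-1` [set z : R | - (7 / 4) <= z] `&`
        y @^-1` [set z : R | z <= 7 / 4]); last first.
      by apply/seteqP; split => x /=; rewrite ler_norml => /andP.
    apply: closedI; apply: closed_comp; try by move=> x _; exact: smooth_continuous.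
      exact: closed_ge.
    exact: closed_le.
  apply: (test_function_mul (K := S `&` [set x : V | `|y x| <= 7 / 4]) tphi sb).
  - by apply: (subclosed_compact _ kphi); [apply: closedI => //;
      exact: closed_closure|move=> x []].
  - move=> x [Sx /=]; rewrite -(Sy _ Sx) /aspect normrM normfV => yx.
    have Dx := phiD' _ Sx; have hx := h_gt0 (D'T _ Dx).
    by apply: D'D => //; move: yx; rewrite (gtr0_norm hx) ler_pdivrMr.
  - move=> x nx; have [Sx|nS] := pselect (S x); last by rewrite (tsupport_eq0 nS) mulr0.
    rewrite /b plateau_eq0 ?mul0r// ltW// ltNge; apply/negP => yx; exact: nx.
have [Cp Cp0 hCp] := test_function_bounded tphi.
have [Cd Cd0 hCd] := test_function_bounded (test_function_partial j tphi).
have mphi := smooth_measurable sphi.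
have mdphi := smooth_measurable (smooth_partial j sphi).
have i1 : mu.-integrable setT (EFin \o (fun x => cut_fun i v x * partial j phi x)).
  by apply: (@integrable_mul_bounded _ _ _ _ Cd) => //; exact: bi.
have i2 : mu.-integrable setT (EFin \o (fun x => cut_slope i j x * v x * phi x)).
  by apply: (@integrable_mul_bounded _ _ _ _ Cp) => //; exact: si.
have i3 : mu.-integrable setT (EFin \o (fun x => plateau (aspect i x) * G j x * phi x)).
  by apply: (@integrable_mul_bounded _ _ _ _ Cp) => //; exact: bi.
have bS x : b x * phi x = plateau (aspect i x) * phi x.
  have [/Sy ->//|nS] := pselect (S x); by rewrite (tsupport_eq0 nS) !mulr0.
have e1 : \int[mu]_x (v x * partial j (fun x => b x * phi x) x) =
    \int[mu]_x (cut_fun i v x * partial j phi x) +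
    \int[mu]_x (cut_slope i j x * v x * phi x).
  rewrite -(RintegralD measurableT i1 i2); apply: eq_Rintegral => x _.
  have -> : partial j (fun x => b x * phi x) x = b x * partial j phi x + phi x *
    partial j b x.
    by apply: partialE; apply: is_deriveM; exact: smooth_is_derive.
  have [Sx|nS] := pselect (S x).
    by rewrite (sp _ Sx) /cut_fun (Sy _ Sx) /b; ring.
  by rewrite (tsupport_eq0 nS) (partial_tsupport j nS) !mulr0 !mul0r addr0 mulr0.
have e2 : \int[mu]_x (G j x * (b x * phi x)) =
    \int[mu]_x (plateau (aspect i x) * G j x * phi x).
  by apply: eq_Rintegral => x _; rewrite bS; ring.
have := vG j _ tpsi; rewrite e1 e2 => e3.
rewrite /cut_grad; under [X in _ = - X]eq_Rintegral do rewrite mulrDl.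
by rewrite (RintegralD measurableT i3 i2) opprD -e3 addrK.
Qed.

Lemma cut_dominated (B : R) i v G Q :
  (forall y : R, `|derive1 (@plateau R) y| <= B /\ `|derive1 (@plateau R) y * y| <= B)
    ->
  dominated v G Q ->
  dominated (cut_fun i v) (cut_grad i v G) (fun x => (1 + B * (1 + M)) * Q x).
Proof.
move=> hB [Qi Q0 vQ GQ].
have B0 : 0 <= B * (1 + M).
  by rewrite mulr_ge0 ?addr_ge0// (le_trans _ (hB 0).1).
have Qx x : Q x <= (1 + B * (1 + M)) * Q x by rewrite mulrDl mul1r lerDl mulr_ge0.
split.
- exact: (integrableZl measurableT (1 + B * (1 + M)) Qi).
- by move=> x; rewrite mulr_ge0// addr_ge0.
- move=> x; rewrite /cut_fun normrM (le_trans (ler_piMl _ (plateau_le1 _)))//.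
  by rewrite (le_trans (vQ x))// ler_wpM2l.
move=> j x; rewrite /cut_grad; apply: le_trans (ler_normD _ _) _.
rewrite [leRHS]mulrDl mul1r; apply: lerD.
  by rewrite normrM (le_trans (ler_piMl _ (plateau_le1 _))).
rewrite normrM; apply: le_trans (ler_wpM2r (Q0 x) (cut_slope_bound hB i j x)).
by rewrite [h _ * _]mulrC -mulrA ler_wpM2l.
Qed.

(** A reflection in [x_i] keeps [x_0] and hence [h], so the invariant survives with [Q] replaced by
    its symmetrisation; [2 M] comes from the slope of the graph. *)
Lemma reflect_dominated i sg v G Q : i != ord0 -> sg * sg = 1 ->
  dominated v G Q ->
  dominated (reflect_fun h i sg v) (reflect_grad h dh i sg G)
    (fun x => (1 + 2 * M) * (Q x + Q (axis_reflect h i sg x))).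
Proof.
move=> i0 sg1 [Qi Q0 vQ GQ].
have sgn : `|sg| = 1 by apply/eqP; rewrite -sqrp_eq1// -normrX expr2 sg1 normr1.
have mc := measurable_axis_shift (N := N) sg mh.
have QRi := integrable_reflect mc (axis_reflect_indep h sg i0) Qi.
have QR0 x : 0 <= Q (axis_reflect h i sg x) by [].
have Qx x : 0 <= Q x + Q (axis_reflect h i sg x) by rewrite addr_ge0.
have M2 : 0 <= 2 * M by rewrite mulr_ge0.
split.
- exact: (integrableZl measurableT (1 + 2 * M) (integrableDR Qi QRi)).
- by move=> x; rewrite mulr_ge0// addr_ge0.
- move=> x; rewrite /reflect_fun; apply: le_trans (ler_normD _ _) _.
  apply: (@le_trans _ _ (h (x ord0 ord0) * (Q x + Q (axis_reflect h i sg x)))).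
    rewrite mulrDr lerD//; have := vQ (axis_reflect h i sg x).
    by rewrite axis_reflect0.
  by rewrite ler_wpM2l// mulrDl mul1r lerDl mulr_ge0.
move=> j x; rewrite /reflect_grad [leRHS]mulrDl mul1r; case: eqP => _.
  apply: le_trans (ler_normB _ _) _;
    apply: (@le_trans _ _ (Q x + Q (axis_reflect h i sg x))).
    exact: lerD.
  by rewrite lerDl mulr_ge0.
apply: le_trans (ler_normD _ _) _; apply: lerD.
  by apply: le_trans (ler_normD _ _) _; exact: lerD.
case: eqP => _; last by rewrite mul0r normr0 mulr_ge0.
rewrite mul1r !normrM sgn mulr1 normr_nat -!mulrA ler_wpM2l//.
by apply: ler_pM => //; apply: le_trans (GQ _ _) _; rewrite lerDr.
Qed.

(* [s] lists the axes along which functions are already extended. *)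
Definition slab (s : seq 'I_n) : set V := [set x | `|x ord0 ord0| < T /\
  forall i, i != ord0 -> i \notin s -> `|x ord0 i| < h (x ord0 ord0)].

(* The two reflections lead from [-h < x_i < h] to [-h < x_i < 3h] and then to
   [-5h < x_i < 3h], which contains the support of the cut-off function. *)
Definition extend_axis (i : 'I_n) v : V -> R :=
  cut_fun i (reflect_fun h i (-1) (reflect_fun h i 1 v)).

Definition extend (s : seq 'I_n) v : V -> R := foldr extend_axis v s.

Lemma reflect_fun_id D v G i sg x : weakly_differentiable D v G ->
  ~ D (axis_reflect h i sg x) -> reflect_fun h i sg v x = v x.
Proof. by move=> [v0 _ _ _] /v0[vr _]; rewrite /reflect_fun vr addr0. Qed.

Lemma extend_axis_step (q : R) i s : 0 <= q -> i != ord0 -> i \notin s ->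
  exists2 K : R, 0 <= K & forall v G Q, weakly_differentiable (slab s) v G ->
    dominated v G Q -> exists G' Q',
    [/\ weakly_differentiable (slab (i :: s)) (extend_axis i v) G',
        dominated (extend_axis i v) G' Q', (powint q Q' <= K%:E * powint q Q)%E &
        forall x, slab [::] x -> extend_axis i v x = v x].
Proof.
move=> q0 i0 si; have [B B0 hB] := derive1_plateau_bounded R.
have B1 : 0 <= 1 + B * (1 + M) by rewrite addr_ge0// mulr_ge0 ?addr_ge0// ltW.
have M1 : 0 <= 1 + 2 * M by rewrite addr_ge0// mulr_ge0.
have hloc' (K : set V) : compact K -> K `<=` [set x | `|x ord0 ord0| < T] ->
    exists (H : R -> R) (T' : R), [/\ smooth1 H, K `<=` [set x | `|x ord0 ord0| < T'] &
    forall t, `|t| < T' -> h t = H t /\ dh t = derive1 H t].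
  by move=> cK KT; have [H [T' [? ? ? ?]]] := hloc cK KT; exists H, T'.
(* The factor lost in each of the two reflections, by [powint_reflect] with the constant [1 + 2 M]
   of [reflect_dominated]. *)
pose a := 2 * (2 * (1 + 2 * M)) `^ q.
have a0 : 0 <= a by rewrite mulr_ge0// powR_ge0.
exists ((1 + B * (1 + M)) `^ q * (a * a)).
  by rewrite !mulr_ge0 ?powR_ge0.
move=> v G Q wv dv.
pose D1 : set V := slab (i :: s) `&`
  [set x | - h (x ord0 ord0) < x ord0 i < 3 * h (x ord0 ord0)].
pose D2 : set V := slab (i :: s) `&`
  [set x | - 5 * h (x ord0 ord0) < x ord0 i < 3 * h (x ord0 ord0)].
have hpos x : slab (i :: s) x -> 0 < h (x ord0 ord0) by move=> [/h_gt0].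
have slabi x : slab s x <-> slab (i :: s) x /\ - h (x ord0 ord0) < x ord0 i < h (x ord0
  ord0).
  rewrite -ltr_norml; split=> [[xT xs]|[[xT xs] xi]].
    split; last exact: xs.
    by split=> // j j0; rewrite inE negb_or => /andP[_]; exact: xs.
  split=> // j j0 sj; have [->//|ji] := eqVneq j i.
  by apply: xs => //; rewrite inE negb_or ji.
have slabR sg x : slab (i :: s) (axis_reflect h i sg x) <-> slab (i :: s) x.
  rewrite /slab /= axis_reflect0//; split=> -[xT xs]; split=> // j j0 js.
    have := xs j j0 js; rewrite coord_reflectE.
    by move: js; rewrite inE negb_or => /andP[/negbTE -> _].
  rewrite coord_reflectE.
  by move: (js); rewrite inE negb_or => /andP[/negbTE -> _]; exact: xs.
have w1 : weakly_differentiable D1 (reflect_fun h i 1 v) (reflect_grad h dh i 1 G).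
  apply: (reflect_weakly_differentiable i0 (mulr1 1) mh mdh dhM hloc' _ _ _ _ _ _ wv).
  - by move=> x [[]].
  - by move=> x /slabi[_ /andP[_]]; rewrite mul1r.
  - by move=> x [sx /= /andP[x1 x2]]; rewrite mul1r => xh; apply/slabi; rewrite x1 xh.
  - move=> x [sx /= /andP[x1 x2]]; rewrite mul1r => xh; apply/slabi; split;
      first exact/slabR.
    by rewrite axis_reflect0// axis_reflect_i; apply/andP; split; lra.
  - move=> x /slabi[sx /andP[x1 x2]]; split=> //=; have := hpos _ sx.
    by move=> hx; apply/andP; split; lra.
  - move=> x /slabi[/slabR sx]; rewrite axis_reflect0// axis_reflect_i => /andP[x1 x2].
    by split=> //=; have := hpos _ sx; move=> hx; apply/andP; split; lra.
have w2 : weakly_differentiable D2 (reflect_fun h i (-1) (reflect_fun h i 1 v))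
    (reflect_grad h dh i (-1) (reflect_grad h dh i 1 G)).
  apply: (reflect_weakly_differentiable i0 _ mh mdh dhM hloc' _ _ _ _ _ _ w1).
  - by rewrite mulrNN mulr1.
  - by move=> x [[]].
  - by move=> x [_ /= /andP[x1 x2]]; lra.
  - by move=> x [sx /= /andP[x1 x2]] xh; split=> //=; apply/andP; split; lra.
  - move=> x [sx /= /andP[x1 x2]] xh; split=> /=; first exact/slabR.
    by rewrite axis_reflect0// axis_reflect_i; apply/andP; split; lra.
  - move=> x [sx /= /andP[x1 x2]]; split=> //=; have := hpos _ sx.
    by move=> hx; apply/andP; split; lra.
  - move=> x [/slabR sx /=]; rewrite axis_reflect0// axis_reflect_i => /andP[x1 x2].
    by split=> //=; have := hpos _ sx; move=> hx; apply/andP; split; lra.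
have d1 := reflect_dominated i0 (mulr1 1) dv.
have d2 := reflect_dominated i0 (etrans (mulrNN 1 1) (mulr1 1)) d1.
have d3 := cut_dominated i hB d2.
eexists; eexists; split; [|exact: d3| |].
- apply: (cut_weakly_differentiable i0 _ _ _ d2 w2).
  + by move=> x [].
  + by move=> x [].
  + move=> x sx; rewrite ler_norml => /andP[x1 x2]; split=> //=; have := hpos _ sx.
    by move=> hx; apply/andP; split; lra.
- have md v' G' Q' : dominated v' G' Q' ->
    measurable_fun setT Q' /\ forall x, 0 <= Q' x.
    by move=> [Qi Q0 _ _]; split=> //; exact: integrable_measurable_fun Qi.
  have [m0 p0] := md _ _ _ dv; have [m1 p1] := md _ _ _ d1; have [m2 p2] := md _ _ _ d2.
  rewrite powintZ// EFinM -muleA lee_wpmul2l ?lee_fin ?powR_ge0//.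
  apply: le_trans (powint_reflect mh _ i0 M1 q0 m1 p1) _.
  rewrite -/a [(a * a)%:E]EFinM -muleA; apply: lee_wpmul2l; first by rewrite lee_fin.
  exact: (powint_reflect mh _ i0 M1 q0 m0 p0).
move=> x [xT xs]; have hx := h_gt0 xT;
  have xi : `|x ord0 i| < h (x ord0 ord0) by exact: xs.
rewrite /extend_axis /cut_fun plateau_eq1 ?mul1r; last first.
  by rewrite /aspect normrM normfV (gtr0_norm hx) ler_pdivrMr// mul1r ltW.
move: xi; rewrite ltr_norml => /andP[x1 x2].
(* Points of the tube are reflected out of the domains of [v] and of its first extension, so neither
   reflection adds anything there. *)
rewrite (reflect_fun_id w1) ?(reflect_fun_id wv)//.
  by move=> /slabi[_]; rewrite axis_reflect0// axis_reflect_i => /andP[]; lra.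
by move=> [_ /=]; rewrite axis_reflect0// axis_reflect_i => /andP[]; lra.
Qed.

Lemma extend_weakly_differentiable (q : R) s : 0 <= q -> uniq s -> ord0 \notin s ->
  exists2 K : R, 0 <= K & forall v G Q, weakly_differentiable (slab [::]) v G ->
    dominated v G Q -> exists G' Q',
    [/\ weakly_differentiable (slab s) (extend s v) G',
        dominated (extend s v) G' Q', (powint q Q' <= K%:E * powint q Q)%E &
        forall x, slab [::] x -> extend s v x = v x].
Proof.
move=> q0; elim: s => [_ _|i s IH /= /andP[si us]].
  by exists 1 => // v G Q wv dv; exists G, Q; rewrite mul1e; split.
rewrite inE negb_or eq_sym => /andP[i0 s0].
have [K K0 hK] := IH us s0; have [L L0 hL] := extend_axis_step q0 i0 si.
exists (L * K); first exact: mulr_ge0.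
move=> v G Q wv dv; have [G1 [Q1 [w1 d1 q1 e1]]] := hK v G Q wv dv.
have [G2 [Q2 [w2 d2 q2 e2]]] := hL _ _ _ w1 d1.
exists G2, Q2; split; [exact: w2|exact: d2| |by move=> x sx; rewrite e2// e1].
by apply: (le_trans q2); rewrite EFinM -muleA; apply: lee_wpmul2l; rewrite ?lee_fin.
Qed.

Lemma ae_reflect (P : V -> Prop) i sg : i != ord0 -> {ae mu, forall x, P x} ->
  {ae mu, forall x, P (axis_reflect h i sg x)}.
Proof.
move=> i0 [A [mA A0 PA]]; exists (axis_reflect h i sg @^-1` A).
have mc := measurable_axis_shift (N := N) sg mh.
split.
- rewrite -[X in measurable X]setTI.
  exact: (measurable_coord_reflect i mc measurableT mA).
- by rewrite (lebesgue_rV_reflect mc (axis_reflect_indep h sg i0)).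
- by move=> x nx; exact: PA.
Qed.

(** Makes the operator well defined on classes of functions; reflections preserve null sets. *)
Lemma extend_ae s v v' : ord0 \notin s -> {ae mu, forall x, v x = v' x} ->
  {ae mu, forall x, extend s v x = extend s v' x}.
Proof.
move=> + vv'; elim: s => // i s IH; rewrite inE negb_or eq_sym => /andP[i0 /IH{}IH] /=.
have r u u' sg : {ae mu, forall x, u x = u' x} ->
    {ae mu, forall x, reflect_fun h i sg u x = reflect_fun h i sg u' x}.
  move=> uu'; have := ae_reflect sg i0 uu'.
  by move: uu'; apply: filterS2 => x e1 e2; rewrite /reflect_fun e1 e2.
have := r _ _ (-1) (r _ _ 1 IH).
by apply: filterS => x vx; rewrite /extend_axis /cut_fun vx.
Qed.

Variables (C : R) (c : nat -> R -> R).
Hypothesis smooth_c : forall k, smooth1 (c k).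
Hypothesis c_end : forall k, exists2 a, a < T & forall t, a <= `|t| -> c k t = 0.
Hypothesis c_le1 : forall k t, `|c k t| <= 1.
Hypothesis c_near : forall t, `|t| < T ->
  \forall k \near \oo, c k t = 1 /\ derive1 (c k) t = 0.
Hypothesis hc : forall k t, h t * `|derive1 (c k) t| <= C.

(** Test against [c k] times [phi]. The term with the derivative of [c k] tends to 0 pointwise and
    is dominated by a multiple of [Q], because [h |c_k'|] is bounded and [|v| <= h Q]. *)
Lemma axial_weakly_differentiable v G Q : dominated v G Q ->
  weakly_differentiable [set x | `|x ord0 ord0| < T] v G ->
    weakly_differentiable setT v G.
Proof.
move=> [Qi Q0 vQ GQ] [v0 vi Gi vG]; split; [by move=> x []|exact: vi|exact: Gi|].
move=> j phi tphi; have [sphi kphi _] := tphi.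
pose b k (x : V) := c k (x ord0 ord0).
have sb k : smooth (b k).
  by apply: smooth_closure_smooth; apply: (sc_comp (smooth_c k)); exact: sc_coord.
have pb k x : partial j (b k) x = derive1 (c k) (x ord0 ord0) * (j == ord0)%:R.
  apply: partialE; apply: is_derive_compR; last exact: is_derive_coord.
  by have [_] := smooth1_derive (smooth_c k); exact.
have tpsi k : test_function [set x : V | `|x ord0 ord0| < T] (fun x => b k x * phi x).
  have [a aT ha] := c_end k.
  have cS : closed [set x : V | `|x ord0 ord0| <= a].
    have -> : [set x : V | `|x ord0 ord0| <= a] =
        ~` ([set x : V | a < x ord0 ord0] `|` [set x | x ord0 ord0 < - a]); last first.
      by apply: open_closedC; apply: openU; [exact: open_coord_gt|exact: open_coord_lt].
    apply/seteqP; split => x /=; rewrite ler_norml.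
      by move=> /andP[x1 x2] []; rewrite ltNge ?x1 ?x2.
    by move=> nx; apply/andP; rewrite !leNgt; split; apply/negP => xx; apply: nx;
      [right|left].
  apply: (test_function_mul (K := tsupport phi `&` [set x : V | `|x ord0 ord0| <= a])
    tphi (sb k)).
  - by apply: (subclosed_compact _ kphi); [apply: closedI => //;
      exact: closed_closure|move=> x []].
  - by move=> x [_ /= xa]; exact: le_lt_trans aT.
  - move=> x nx; have [Sx|nS] := pselect (tsupport phi x);
      last by rewrite (tsupport_eq0 nS) mulr0.
    rewrite /b ha ?mul0r// leNgt; apply/negP => xa; apply: nx; split=> //=; exact: ltW.
have [Cp Cp0 hCp] := test_function_bounded tphi.
have [Cd Cd0 hCd] := test_function_bounded (test_function_partial j tphi).
have mphi := smooth_measurable sphi.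
have mdphi := smooth_measurable (smooth_partial j sphi).
have mv := integrable_measurable_fun vi.
have mG := integrable_measurable_fun (Gi j).
have C0 : 0 <= C by apply: le_trans (hc 0 0); rewrite mulr_ge0.
have pE k x : partial j (fun x => b k x * phi x) x =
    b k x * partial j phi x + phi x * partial j (b k) x.
  by apply: partialE; apply: is_deriveM; exact: smooth_is_derive.
have nT (x : V) : ~ (`|x ord0 ord0| < T) -> v x = 0 /\ forall j, G j x = 0 by exact: v0.
have [] := @Rintegral_dominated _ _ _ mu
  (fun k x => v x * partial j (fun x => b k x * phi x) x)
  (fun x => v x * partial j phi x)
  (fun x => `|v x * partial j phi x| + C * Cp * Q x).
- by move=> k; apply: measurable_funM => //; apply: smooth_measurable;
    apply: smooth_partial; exact: smoothM.
- move=> x; have [xT|/nT[vx _]] := pselect (`|x ord0 ord0| < T); last first.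
    by under eq_cvg do rewrite vx mul0r; rewrite vx mul0r; exact: cvg_cst.
  apply: cvg_near_cst; apply: filterS (c_near xT) => k [e1 e2].
  by rewrite pE pb e2 mul0r mulr0 addr0 /b e1 mul1r.
- apply: integrableDR.
    apply: integrable_norm.
    exact: (@integrable_mul_bounded _ _ _ _ Cd vi mdphi (fun x _ => hCd x)).
  exact: (integrableZl measurableT (C * Cp) Qi).
- move=> k x; rewrite pE mulrDr; apply: le_trans (ler_normD _ _) _; apply: lerD.
    by rewrite mulrCA normrM; apply: ler_piMl => //; exact: c_le1.
  rewrite pb !normrM.
  apply: (@le_trans _ _ (h (x ord0 ord0) * Q x * (Cp * `|derive1 (c k) (x ord0
    ord0)|))).
    apply: ler_pM => //; apply: ler_pM => //; rewrite ler_piMr//.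
    by case: eqP => _ /=; rewrite ?normr1 ?normr0.
  rewrite (_ : _ * _ = (h (x ord0 ord0) * `|derive1 (c k) (x ord0 ord0)|) * (Cp * Q
    x)); last by ring.
  by rewrite -[leRHS]mulrA ler_wpM2r// mulr_ge0// ltW.
move=> _ cv1.
have [] := @Rintegral_dominated _ _ _ mu
  (fun k x => G j x * (b k x * phi x)) (fun x => G j x * phi x) (fun x => `|G j x * phi
    x|).
- by move=> k; apply: measurable_funM => //; apply: smooth_measurable; exact: smoothM.
- move=> x; have [xT|/nT[_ gx]] := pselect (`|x ord0 ord0| < T); last first.
    by under eq_cvg do rewrite gx mul0r; rewrite gx mul0r; exact: cvg_cst.
  by apply: cvg_near_cst; apply: filterS (c_near xT) => k [e1 e2]; rewrite /b e1 mul1r.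
- apply: integrable_norm.
  exact: (@integrable_mul_bounded _ _ _ _ Cp (Gi j) mphi (fun x _ => hCp x)).
- by move=> k x; rewrite mulrCA normrM; apply: ler_piMl => //; exact: c_le1.
move=> _ cv2.
have e : (fun k => \int[mu]_x (v x * partial j (fun x => b k x * phi x) x)) =
    \- (fun k => \int[mu]_x (G j x * (b k x * phi x))).
  by apply/funext => k; exact: vG.
by rewrite e in cv1; exact: (cvg_unique _ cv1 (cvgN cv2)).
Qed.

End tube.

(** * From the tube to the whole space *)

Section tube_extension.
Variables (R : realType) (N : nat) (ell : nat -> R).
Local Notation n := N.+1.
Local Notation V := 'rV[R]_n.
Local Notation mu := (@lebesgue_rV R n).
Hypothesis ell_gt0 : forall m, 0 < ell m.
Hypothesis ell_le1 : forall m, ell m <= 1.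
Hypothesis ell_leS : forall m, ell m <= 2 * ell m.+1.
Hypothesis ell_geS : forall m, ell m.+1 <= 2 * ell m.
Hypothesis ell_sum : exists B, forall m, \sum_(j < m) ell j <= B.
Opaque partial.

Local Notation T := (knot_sup ell).
Local Notation h := (tube_width ell).
Local Notation dh := (tube_slope ell).

Definition tube : set V := slab T h [::].

Definition tube_axes : seq 'I_n := [seq i <- enum 'I_n | i != ord0].

(** The cut-off drops from 1 to 0 along one bead, whose length is comparable to the width there:
    this keeps [h |c'|] bounded. *)
Definition tube_cutoff k (t : R) := 1 + (-1) * knot_step ell k t.

Lemma smooth_tube_cutoff k : smooth1 (tube_cutoff k).
Proof.
apply: smooth1_closure_smooth1; apply: s1_add; first exact: s1_cst.
apply: s1_mul; first exact: s1_cst.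
by apply: s1_base; exact: smooth_knot_step.
Qed.

Lemma derive1_tube_cutoff k t : derive1 (tube_cutoff k) t = - derive1 (knot_step ell k)
  t.
Proof.
have [_ /(_ t) ds] := smooth1_derive (smooth_knot_step ell k).
rewrite derive1E.
have [_ ->] := is_deriveD (is_derive_cst (1 : R) t 1) (is_deriveZ (-1) ds).
by rewrite add0r scaleN1r.
Qed.

Lemma tube_local (K : set V) : compact K -> K `<=` [set x | `|x ord0 ord0| < T] ->
  exists (H : R -> R) (T' : R), [/\ smooth1 H, forall t, 0 < H t,
    K `<=` [set x | `|x ord0 ord0| < T'] &
    forall t, `|t| < T' -> h t = H t /\ dh t = derive1 H t].
Proof.
move=> cK KT; have [m Km] := compact_knot ell_gt0 ell_sum cK KT.
exists (width ell m), (knot ell m); split=> //.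
- exact: smooth_width.
- exact: width_gt0.
- by move=> t tm; rewrite (tube_widthE ell_gt0 tm) (tube_slopeE ell_gt0 tm).
Qed.

Lemma slab_tube_axes : slab T h tube_axes = [set x : V | `|x ord0 ord0| < T].
Proof.
apply/seteqP; split => [x []//|x xT]; split=> // i i0.
by rewrite mem_filter i0 mem_enum.
Qed.

Lemma tube_extension (q : R) : 0 <= q ->
  exists2 K : R, 0 <= K & forall v G Q, weakly_differentiable tube v G ->
    dominated h v G Q -> exists G' Q',
    [/\ weakly_differentiable setT (extend h tube_axes v) G',
        dominated h (extend h tube_axes v) G' Q',
        (powint q Q' <= K%:E * powint q Q)%E &
        forall x, tube x -> extend h tube_axes v x = v x].
Proof.
move=> q0; have [M M0 hM] := @smoothstep_derive_bounded R.
have mh := measurable_tube_width ell_gt0 ell_sum.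
have mdh := measurable_tube_slope ell_gt0 ell_sum.
have hb t : `|dh t| <= M by exact: tube_slope_bound.
have h0 t : 0 <= h t by exact: tube_width_ge0.
have hp t : `|t| < T -> 0 < h t by exact: tube_width_gt0.
have u : uniq tube_axes by rewrite filter_uniq// enum_uniq.
have a0 : ord0 \notin tube_axes by rewrite mem_filter.
have [K K0 hK] := extend_weakly_differentiable mh mdh hb h0 hp tube_local q0 u a0.
exists K => // v G Q wv dv; have [G' [Q' [w' d' q' e']]] := hK v G Q wv dv.
exists G', Q'; split=> //; rewrite slab_tube_axes in w'.
apply: (axial_weakly_differentiable (C := 2 * M) h0 smooth_tube_cutoff _ _ _ _ d' w').
- move=> k; exists (knot ell k.+1); first exact: knot_lt.
  by move=> t tk; rewrite /tube_cutoff knot_step_eq1// mulr1 subrr.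
- move=> k t; rewrite /tube_cutoff mulN1r ger0_norm ?subr_ge0 ?knot_step_le1//.
  by rewrite gerBl knot_step_ge0.
- move=> t /(knot_cvg ell_sum)[m tm]; exists m => // k /= mk.
  have tk : `|t| <= knot ell k by rewrite (le_trans (ltW tm))// knot_nd.
  rewrite /tube_cutoff derive1_tube_cutoff knot_step_eq0// mulr0 addr0.
  by rewrite derive1_knot_step_eq0 ?tk// oppr0.
move=> k t; rewrite derive1_tube_cutoff normrN.
have [tk|tk] := boolP ((`|t| <= knot ell k) || (knot ell k.+1 <= `|t|)).
  by rewrite derive1_knot_step_eq0// normr0 mulr0 mulr_ge0// ltW.
move: tk; rewrite negb_or -!ltNge => /andP[tk1 tk2].
have /andP[_ h2] := tube_width_bounds ell_gt0 ell_leS ell_geS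
  (introT andP (conj (ltW tk1) tk2)).
apply: (@le_trans _ _ (2 * ell k * (M / ell k))).
  by apply: ler_pM => //; exact: derive1_knot_step_bound.
by rewrite mulrACA mulfV ?mulr1// gt_eqF.
Qed.

End tube_extension.

(** * Weighted estimates *)

Section euclidean.
Variables (R : realType) (n : nat).
Local Notation V := 'rV[R]_n.

Lemma euclidean_norm_ge0 (v : V) : 0 <= euclidean_norm v.
Proof. exact: sqrtr_ge0. Qed.

Lemma coord_le_euclidean_norm (v : V) j : `|v ord0 j| <= euclidean_norm v.
Proof.
rewrite -sqrtr_sqr ler_wsqrtr// (bigD1 j)//= lerDl sumr_ge0// => i _.
exact: sqr_ge0.
Qed.

Lemma euclidean_norm_le (v : V) (B : R) : (forall j, `|v ord0 j| <= B) ->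
  euclidean_norm v <= n%:R * B.
Proof.
case: n v => [|m] v hB; first by rewrite /euclidean_norm big_ord0 sqrtr0 mul0r.
have B0 : 0 <= B by exact: le_trans (hB ord0).
rewrite -[leRHS]ger0_norm ?mulr_ge0// -sqrtr_sqr ler_wsqrtr//.
apply: (@le_trans _ _ (\sum_(i < m.+1) B ^+ 2)).
  by apply: ler_sum => i _; rewrite -real_normK ?num_real// lerXn2r ?nnegrE.
rewrite sumr_const card_ord -[leLHS]mulr_natl exprMn ler_wpM2r ?sqr_ge0//.
by rewrite expr2 ler_peMl// ler1n.
Qed.

Lemma measurable_euclidean_norm (D : set V) (g : V -> V) : measurable D ->
  (forall j, measurable_fun D (fun x => g x ord0 j)) ->
  measurable_fun D (fun x => euclidean_norm (g x)).
Proof.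
move=> mD mg; rewrite (_ : (fun _ => _) =
    (fun x => (\sum_(i < n) g x ord0 i ^+ 2) `^ 2^-1)); last first.
  by apply/funext => x; rewrite powR12_sqrt// sumr_ge0// => i _; exact: sqr_ge0.
apply: (@measurableT_comp _ _ _ _ _ _ (fun t : R => t `^ 2^-1)).
  exact: measurable_powR.
by apply: measurable_sum => i; exact: measurable_funX.
Qed.

End euclidean.

(** * Integrability of the function divided by the width *)

Section weight.
Variables (R : realType) (N : nat) (D : set 'rV[R]_N.+1) (h : R -> R).
Local Notation n := N.+1.
Local Notation V := 'rV[R]_n.
Local Notation mu := (@lebesgue_rV R n).
Hypothesis oD : open D.
Hypothesis Dfin : (mu D < +oo)%E.
Hypothesis mh : measurable_fun setT h.
Hypothesis h_gt0 : forall x : V, D x -> 0 < h (x ord0 ord0).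
Hypothesis h_le2 : forall t, h t <= 2.
Hypothesis h_ge0 : forall t, 0 <= h t.
Hypothesis hint : forall s : R, 0 < s -> s < n%:R ->
  (\int[mu]_(x in D) ((h (x ord0 ord0))^-1 `^ s)%:E < +oo)%E.
Opaque partial.

Let mD : measurable D. Proof. exact: open_measurable_rV. Qed.

(** The function [Q] of [dominated] from which the construction starts. *)
Definition hardy_weight u : V -> R :=
  (fun x : V => `|u x| / h (x ord0 ord0) + grad_norm D u x) \_ D.

Lemma L1p_weak_gradient u (p : \bar R) : fs_mem (L1p p D) u ->
  is_weak_gradient D u (weak_gradient D u).
Proof. by move=> [_ [g wg] _]; exact: weak_gradientP wg. Qed.

Lemma measurable_grad_norm u (p : \bar R) : fs_mem (L1p p D) u ->
  measurable_fun D (grad_norm D u).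
Proof.
move=> /L1p_weak_gradient wg; apply: measurable_euclidean_norm => // j.
by have [[]] := wg j.
Qed.

Lemma measurable_hardy_weight u (p : \bar R) : fs_mem (L1p p D) u ->
  measurable_fun setT (hardy_weight u).
Proof.
move=> up; have mg := measurable_grad_norm up; have [[um _] _ _] := up.
apply: (measurable_restrictT _ mD).1; apply: measurable_funD mg.
apply: measurable_funM; first exact: measurableT_comp.
exact: measurable_funS (@measurable_inv_width _ _ _ mh h_ge0).
Qed.

Lemma hardy_weight_ge0 u x : 0 <= hardy_weight u x.
Proof.
rewrite /hardy_weight patchE; case: ifPn => // _.
by rewrite addr_ge0 ?divr_ge0// euclidean_norm_ge0.
Qed.

(** Common to finite and infinite [p]: [u] is normalised by [lam], and [W] stands for what its norm
    controls. *)
Lemma powint_hardy_weight_le (q s lam : R) u (W : V -> R) (p : \bar R) :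
  fs_mem (L1p p D) u -> 0 < q -> 0 < s -> s < n%:R -> 0 < lam ->
  measurable_fun D W -> (forall x, 0 <= W x) ->
  (\int[mu]_(x in D) (W x)%:E <= 1)%E ->
  {ae mu, forall x, D x -> (`|u x| / lam / h (x ord0 ord0) + grad_norm D u x / lam) `^
    q <=
     2 `^ q * (W x + (h (x ord0 ord0))^-1 `^ s + 1)} ->
  (powint q (hardy_weight u) <= ((lam `^ q)%:E * ((2 `^ q)%:E *
    (1 + \int[mu]_(x in D) ((h (x ord0 ord0))^-1 `^ s)%:E + mu D))))%E.
Proof.
move=> up q0 s0 sn lam0 mW W0 W1 aeW.
have mg := measurable_grad_norm up; have [[mu' _] _ _] := up.
have mi : measurable_fun D (fun x : V => (h (x ord0 ord0))^-1).
  exact: measurable_funS (@measurable_inv_width _ _ _ mh h_ge0).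
have mis := measurable_powR_comp s mi.
have g0 x : 0 <= grad_norm D u x by exact: euclidean_norm_ge0.
have hi0 (x : V) : 0 <= (h (x ord0 ord0))^-1 by rewrite invr_ge0.
rewrite (_ : powint q (hardy_weight u) = \int[mu]_(x in D) ((lam `^ q)%:E *
   ((`|u x| / lam / h (x ord0 ord0) + grad_norm D u x / lam) `^ q)%:E))%E; last first.
  rewrite integral_mkcond; apply: eq_integral => x _.
  rewrite /hardy_weight !patchE; case: ifPn => xD; last by rewrite powR0 ?gt_eqF.
  rewrite -EFinM -powRM ?addr_ge0 ?mulr_ge0 ?invr_ge0 ?(ltW lam0)//.
  congr (_ `^ _)%:E; rewrite mulrDr; congr (_ + _).
    by rewrite mulrA [lam * _]mulrCA divff ?gt_eqF// mulr1.
  by rewrite mulrCA mulfV ?gt_eqF// mulr1.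
have ml : measurable_fun D (fun x : V =>
    ((`|u x| / lam / h (x ord0 ord0) + grad_norm D u x / lam) `^ q)%:E).
  apply/measurable_EFinP; apply: measurable_powR_comp.
  apply: measurable_funD; apply: measurable_funM => //.
  by apply: measurable_funM => //; exact: measurableT_comp.
rewrite ge0_integralZl//; last 2 first.
- by move=> x _; rewrite lee_fin powR_ge0.
- by rewrite lee_fin powR_ge0.
apply: lee_wpmul2l; first by rewrite lee_fin powR_ge0.
have mr : measurable_fun D (fun x : V => (W x + (h (x ord0 ord0))^-1 `^ s + 1)%:E).
  by apply/measurable_EFinP; apply: measurable_funD => //; exact: measurable_funD.
apply: (@le_trans _ _ (\int[mu]_(x in D) ((2 `^ q)%:E *
    (W x + (h (x ord0 ord0))^-1 `^ s + 1)%:E))%E).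
  apply: ae_ge0_le_integral => //.
  - by move=> x _; rewrite lee_fin powR_ge0.
  - by move=> x _; rewrite -EFinM lee_fin mulr_ge0 ?powR_ge0// !addr_ge0 ?powR_ge0.
  - exact: measurable_funeM.

have r0 (x : V) : (0 <= (W x + (h (x ord0 ord0))^-1 `^ s + 1)%:E)%E.
  by rewrite lee_fin !addr_ge0 ?powR_ge0.
rewrite ge0_integralZl//.
apply: lee_wpmul2l; first by rewrite lee_fin powR_ge0.
under eq_integral do rewrite !EFinD.
rewrite ge0_integralD//; last 2 first.
- by move=> x _; rewrite -EFinD lee_fin addr_ge0 ?powR_ge0.
- by apply: emeasurable_funD; exact/measurable_EFinP.
have mW' : measurable_fun D (EFin \o W) by exact/measurable_EFinP.
have mis' : measurable_fun D (fun x : V => ((h (x ord0 ord0))^-1 `^ s)%:E).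
  exact/measurable_EFinP.
have e1 := integral_cst mu mD 1%E; rewrite mul1e in e1.
rewrite e1 ge0_integralD//; first by rewrite !leeD.
- by move=> x _; rewrite lee_fin.
- by move=> x _; rewrite lee_fin powR_ge0.
Qed.

Lemma W1p_norm_pinfty (E : set V) u (lam : R) : (W1p_norm +oo%E E u <= lam%:E)%E ->
  {ae mu, forall x, E x -> `|u x| + grad_norm E u x <= lam}.
Proof.
rewrite /W1p_norm /Lp_norm unlock; case: ifPn => [_ /ess_supP|/negP mu0 _].
  apply: filterS => x + Ex; rewrite /= patchE mem_set//= lee_fin.
  by rewrite ger0_norm// addr_ge0// euclidean_norm_ge0.
(* The norm is 0 by convention when the whole space is null, and then every property holds almost
   everywhere. *)
exists setT; split=> //; apply/eqP; rewrite eq_le measure_ge0 andbT leNgt.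
exact/negP.
Qed.

Lemma W1p_norm_fin (E : set V) u (r lam : R) : 0 < r -> 0 <= lam ->
  (W1p_norm r%:E E u <= lam%:E)%E ->
  (\int[mu]_(x in E) (`|u x| `^ r + grad_norm E u x `^ r)%:E <= (lam `^ r)%:E)%E.
Proof.
move=> r0 lam0; rewrite /W1p_norm; set I := (\int[mu]_(x in E) _)%E => h1.
have I0 : (0 <= I)%E by apply: integral_ge0 => x _; rewrite lee_fin addr_ge0 ?powR_ge0.
rewrite -[I]poweRe1// -(@mulVf _ r) ?gt_eqF// poweRrM -poweR_EFin.
by apply: gt0_ler_poweR; rewrite ?(ltW r0)// in_itv/= ?leey ?andbT ?poweR_ge0 ?lee_fin.
Qed.

(* [lam] is only an upper bound of the norm, so that functions of norm 0 need
   no separate treatment. *)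
Lemma hardy_weight_bound (q : R) (p : \bar R) : 1 <= q -> q < n%:R / 2 ->
  ((q * n%:R / (n%:R - q))%:E < p)%E ->
  exists2 K : R, 0 <= K & forall u lam, fs_mem (L1p p D) u -> 0 < lam ->
    (W1p_norm p D u <= lam%:E)%E -> (powint q (hardy_weight u) <= (lam `^ q * K)%:E)%E.
Proof.
move=> q1 qn qp; have q0 : 0 < q by rewrite (lt_le_trans ltr01).
have nq : 0 < n%:R - q by lra.
have mi : measurable_fun D (fun x : V => (h (x ord0 ord0))^-1).
  exact: measurable_funS (@measurable_inv_width _ _ _ mh h_ge0).
have hi0 (x : V) : 0 <= (h (x ord0 ord0))^-1 by rewrite invr_ge0.
pose S s := (\int[mu]_(x in D) ((h (x ord0 ord0))^-1 `^ s)%:E)%E.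
have S0 s : (0 <= S s)%E by apply: integral_ge0 => x _; rewrite lee_fin powR_ge0.
have Sfin s : 0 < s -> s < n%:R -> S s \is a fin_num.
  by move=> s0 sn; rewrite ge0_fin_numE//; exact: hint.
have Dfin' : mu D \is a fin_num by rewrite ge0_fin_numE.
have g0 u x : 0 <= grad_norm D u x by exact: euclidean_norm_ge0.
suff [s [s0 sn hs]] : exists s : R, [/\ 0 < s, s < n%:R & forall u (lam : R), fs_mem
  (L1p p D) u ->
    0 < lam -> (W1p_norm p D u <= lam%:E)%E -> exists W : V -> R,
    [/\ measurable_fun D W, forall x, 0 <= W x, (\int[mu]_(x in D) (W x)%:E <= 1)%E &
    {ae mu, forall x, D x -> (`|u x| / lam / h (x ord0 ord0) + grad_norm D u x / lam)
      `^ q <=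
     2 `^ q * (W x + (h (x ord0 ord0))^-1 `^ s + 1)}]].
  exists (2 `^ q * (1 + fine (S s) + fine (mu D))).
    by rewrite mulr_ge0 ?powR_ge0// !addr_ge0// fine_ge0.
  move=> u lam up lam0 ulam; have [W [mW W0 W1 aeW]] := hs u lam up lam0 ulam.
  apply: le_trans (powint_hardy_weight_le up q0 s0 sn lam0 mW W0 W1 aeW) _.
  by rewrite !EFinM !EFinD !fineK// Sfin.
case: p qp => [r| |]//.
  rewrite lte_fin ltr_pdivrMr// => qr; have rq : q < r by nra.
  have r0 : 0 < r by exact: lt_trans rq.
  have rq0 : 0 < r - q by lra.
  pose s := q * r / (r - q); have s0 : 0 < s by rewrite divr_gt0// mulr_gt0.
  exists s; split=> //; first by rewrite ltr_pdivrMr//; nra.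
  move=> u lam up lam0 ulam.
  have mg := measurable_grad_norm up; have [[um _] _ _] := up.
  have qrs : q^-1 = r^-1 + s^-1 by rewrite /s; field; rewrite !gt_eqF.
  have lm : 0 <= lam^-1 by rewrite invr_ge0 ltW.
  exists (fun x => (`|u x| / lam) `^ r + (grad_norm D u x / lam) `^ r); split.
  - apply: measurable_funD; apply: measurable_powR_comp; apply: measurable_funM => //.
    exact: measurableT_comp.
  - by move=> x; rewrite addr_ge0 ?powR_ge0.
  - have e (x : V) : ((`|u x| / lam) `^ r + (grad_norm D u x / lam) `^ r)%:E =
        ((lam^-1 `^ r)%:E * (`|u x| `^ r + grad_norm D u x `^ r)%:E)%E.
      by rewrite -EFinM !powRM// mulrDr mulrC [X in _ + X]mulrC.
    under eq_integral do rewrite e.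
    rewrite ge0_integralZl//; last 3 first.
    + apply/measurable_EFinP; apply: measurable_funD; apply: measurable_powR_comp => //.
      exact: measurableT_comp.
    + by move=> x _; rewrite lee_fin addr_ge0 ?powR_ge0.
    + by rewrite lee_fin powR_ge0.
    apply: le_trans (lee_wpmul2l _ (W1p_norm_fin r0 (ltW lam0) ulam)) _.
      by rewrite lee_fin powR_ge0.
    by rewrite -EFinM -powRM ?(ltW lam0)// mulVf ?gt_eqF// powR1.
  apply: aeW => x _; apply: le_trans (powRD_le (ltW q0) _ _) _; rewrite ?mulr_ge0//.
  rewrite ler_wpM2l ?powR_ge0//.
  have y1 := young_powR q0 r0 s0 qrs (mulr_ge0 (normr_ge0 (u x)) lm) (hi0 x).
  (* The gradient is paired with the constant 1, which is the source of the summand 1 in the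
     bound. *)
  have y2 := young_powR q0 r0 s0 qrs (mulr_ge0 (g0 u x) lm) ler01.
  rewrite mulr1 powR1 in y2.
  apply: le_trans (lerD y1 y2) _.
  by rewrite addrACA addrA.
(* For [p = +oo] both quotients by [lam] are at most 1 almost everywhere, so [s = q] works with
   [W = 0]. *)
move=> _; exists q; split=> //; first by rewrite (lt_le_trans qn)// ler_pdivrMr//
  ler_peMr// ler1n.
move=> u lam up lam0 /W1p_norm_pinfty ulam; exists (fun=> 0); split=> //.
  by under eq_integral do rewrite -/(cst 0%E _); rewrite integral0.
move: ulam; apply: filterS => x + Dx => /(_ Dx) ulam.
have a1 : `|u x| / lam <= 1 by rewrite ler_pdivrMr// mul1r (le_trans _ ulam)// lerDl.
have a2 : grad_norm D u x / lam <= 1 by rewrite ler_pdivrMr// mul1r (le_trans _ ulam)//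
  lerDr.
have lm : 0 <= lam^-1 by rewrite invr_ge0 ltW.
apply: le_trans (powRD_le (ltW q0) _ _) _; rewrite ?mulr_ge0//.
rewrite ler_wpM2l ?powR_ge0// add0r lerD//.
  by rewrite ge0_ler_powR ?nnegrE ?mulr_ge0 ?(ltW q0)// ler_piMl.
apply: (@le_trans _ _ (1 `^ q)); last by rewrite powR1.
by rewrite ge0_ler_powR ?nnegrE ?mulr_ge0 ?(ltW q0).
Qed.

Lemma hardy_weakly_differentiable (q : R) (p : \bar R) u : 1 <= q ->
  fs_mem (L1p p D) u -> (powint q (hardy_weight u) < +oo)%E ->
  weakly_differentiable D (u \_ D) (fun j => (fun x => weak_gradient D u x ord0 j) \_
    D) /\
  dominated h (u \_ D) (fun j => (fun x => weak_gradient D u x ord0 j) \_ D)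
    (hardy_weight u).
Proof.
move=> q1 up qfin; have mQ := measurable_hardy_weight up.
have wg := L1p_weak_gradient up; have [[um ul] _ _] := up.
(* [D] has finite measure, and [Q] is at most [Q ^ q] plus the indicator of [D]. *)
have Qi : mu.-integrable setT (EFin \o hardy_weight u).
  have i1 : mu.-integrable setT (EFin \o (fun x => hardy_weight u x `^ q)).
    apply/integrableP; split; first by apply/measurable_EFinP;
      exact: measurable_powR_comp.
    apply: le_lt_trans qfin; apply: ge0_le_integral => //.
    - by apply: measurableT_comp => //; apply/measurable_EFinP;
        exact: measurable_powR_comp.
    - by apply/measurable_EFinP; exact: measurable_powR_comp.
    - by move=> x _; rewrite /= lee_fin ger0_norm ?powR_ge0.
  have i2 := integrable_cst_indic 1 mD Dfin.
  apply: (le_integrable _ _ _ (integrableD measurableT i1 i2)) => //.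
    exact/measurable_EFinP.
  move=> x _; rewrite /= lee_fin ger0_norm ?hardy_weight_ge0//.
  rewrite ger0_norm ?addr_ge0 ?powR_ge0 ?mulr_ge0//.
  have [Q1|Q1] := leP 1 (hardy_weight u x).
    have := ler_powR Q1 q1; rewrite powRr1 ?hardy_weight_ge0// => Q2.
    by rewrite (le_trans Q2)// lerDl mulr_ge0.
  have [Dx|Dx] := pselect (D x).
    by rewrite indicE mem_set// mulr1 (le_trans (ltW Q1))// lerDr powR_ge0.
  by rewrite /hardy_weight patchE memNset// addr_ge0 ?powR_ge0 ?mulr_ge0.
have vQ (x : V) : `|(u \_ D) x| <= h (x ord0 ord0) * hardy_weight u x.
  rewrite /hardy_weight !patchE; case: ifPn => xD; last by rewrite normr0 mulr0.
  have hx := h_gt0 (set_mem xD).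
  by rewrite mulrDr mulrCA divff ?gt_eqF// mulr1 lerDl mulr_ge0 ?(ltW hx)//
    euclidean_norm_ge0.
have GQ j x : `|((fun x => weak_gradient D u x ord0 j) \_ D) x| <= hardy_weight u x.
  rewrite /hardy_weight !patchE; case: ifPn => xD; last by rewrite normr0.
  rewrite (le_trans (coord_le_euclidean_norm _ _))// lerDr.
  by rewrite divr_ge0.
have mv : measurable_fun setT (u \_ D) by exact: (measurable_restrictT _ mD).1.
have mG j : measurable_fun setT ((fun x => weak_gradient D u x ord0 j) \_ D).
  by apply: (measurable_restrictT _ mD).1; have [[]] := wg j.
split; last by split=> // x; exact: hardy_weight_ge0.
split.
- by move=> x nD; rewrite patchE memNset//; split=> // j; rewrite patchE memNset.
- apply: (le_integrable _ _ _ (integrableZl measurableT 2 Qi)) => //;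
    first exact/measurable_EFinP.
  move=> x _; rewrite /= lee_fin (le_trans (vQ x))// ger0_norm ?mulr_ge0
    ?hardy_weight_ge0//.
  by rewrite ler_wpM2r ?hardy_weight_ge0.
- move=> j; apply: (le_integrable _ _ _ Qi) => //; first exact/measurable_EFinP.
  by move=> x _; rewrite /= lee_fin (le_trans (GQ j x))// ler_norm.
move=> j phi tphi; have [lg hg] := wg j.
have [_ <-] := L1loc_test_integrable oD (conj um ul) (test_function_partial j tphi).
have [_ <-] := L1loc_test_integrable oD lg tphi.
exact: hg.
Qed.

(** The constants come from [|v| <= h Q <= 2 Q] and from the comparison of the Euclidean norm of the
    gradient with its largest coordinate. *)
Lemma dominated_W1p (q : R) (v : V -> R) G Q : 1 <= q ->
  weakly_differentiable setT v G ->
  dominated h v G Q -> (powint q Q < +oo)%E ->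
  fs_mem (W1p q%:E setT) v /\
  (W1p_norm q%:E setT v <= ((2 `^ q + n%:R `^ q)%:E * powint q Q) `^ q^-1)%E.
Proof.
move=> q1 [v0 vi Gi vG] [Qi Q0 vQ GQ] qfin.
have q0 : 0 < q by rewrite (lt_le_trans ltr01).
have Li f : mu.-integrable setT (EFin \o f) -> L1loc setT f.
  move=> fi; split; first exact: integrable_measurable_fun fi.
  move=> K cK _; apply: integrableS fi => //; exact: compact_measurable_rV.
have wg : is_weak_gradient setT v (fun x => \row_j G j x).
  move=> j; under eq_fun do rewrite mxE; split; first exact: Li.
  move=> phi tphi; rewrite (vG j phi tphi); congr (- _).
  by apply: eq_Rintegral => x _; rewrite mxE.
have wg' := weak_gradientP wg.
have aeg := weak_gradient_unique openT wg' wg.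
have aeQ : {ae mu, forall x, setT x -> grad_norm setT v x <= n%:R * Q x}.
  move: aeg; apply: filterS => x gx _; rewrite /grad_norm gx//.
  by apply: euclidean_norm_le => j; rewrite mxE.
have v2Q x : `|v x| <= 2 * Q x by rewrite (le_trans (vQ x))// ler_wpM2r.
have mQ := integrable_measurable_fun Qi.
have mv := integrable_measurable_fun vi.
have mg : measurable_fun setT (grad_norm setT v).
  by apply: measurable_euclidean_norm => // j; have [[]] := wg' j.
have g0 x : 0 <= grad_norm setT v x by exact: euclidean_norm_ge0.
have mQq : measurable_fun setT (fun x => (Q x `^ q)%:E).
  by apply/measurable_EFinP; exact: measurable_powR_comp.
have mvq : measurable_fun setT (fun x => `|v x| `^ q).
  by apply: measurable_powR_comp; exact: measurableT_comp.
have mgq : measurable_fun setT (fun x => grad_norm setT v x `^ q) by exact: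
  measurable_powR_comp.
have key : (\int[mu]_x (`|v x| `^ q + grad_norm setT v x `^ q)%:E <=
    (2 `^ q + n%:R `^ q)%:E * powint q Q)%E.
  rewrite /powint -ge0_integralZl//; last by move=> x _; rewrite lee_fin powR_ge0.
  apply: ae_ge0_le_integral => //.
  - by move=> x _; rewrite lee_fin addr_ge0 ?powR_ge0.
  - by apply/measurable_EFinP; exact: measurable_funD.
  - by move=> x _; rewrite -EFinM lee_fin mulr_ge0 ?addr_ge0 ?powR_ge0.
  - exact: measurable_funeM.
  move: aeQ; apply: filterS => x gQ _; rewrite -EFinM lee_fin mulrDl lerD//.
    by rewrite -powRM// ge0_ler_powR ?nnegrE ?mulr_ge0 ?(ltW q0).
  by rewrite -powRM// ge0_ler_powR ?nnegrE ?mulr_ge0 ?(ltW q0)// gQ.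
have kfin : (\int[mu]_x (`|v x| `^ q + grad_norm setT v x `^ q)%:E < +oo)%E.
  by rewrite (le_lt_trans key)// lte_mul_pinfty// lee_fin addr_ge0 ?powR_ge0.
have Lfin (f : V -> R) : measurable_fun setT f ->
  (forall x, `|f x| `^ q <= `|v x| `^ q + grad_norm setT v x `^ q) ->
    (Lp_norm setT q%:E f < +oo)%E.
  move=> mf fle; rewrite /Lp_norm unlock; apply: poweR_lty; apply: le_lt_trans kfin.
  apply: ge0_le_integral => //.
  - by move=> x _; exact: poweR_ge0.
  - rewrite patch_setT (_ : (fun _ => _) = EFin \o (fun x => `|f x| `^ q)).
      by apply/measurable_EFinP; apply: measurable_powR_comp; exact: measurableT_comp.
    by apply/funext => x.
  - by apply/measurable_EFinP; exact: measurable_funD.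
  - by move=> x _; rewrite patch_setT /= lee_fin.
split; last first.
  rewrite /W1p_norm; apply: gt0_ler_poweR; rewrite ?invr_ge0 ?(ltW q0)//.
    by rewrite in_itv/= leey andbT; apply: integral_ge0 => x _;
      rewrite lee_fin addr_ge0 ?powR_ge0.
  rewrite in_itv/= leey andbT mule_ge0 ?lee_fin ?addr_ge0 ?powR_ge0//.
  by apply: integral_ge0 => x _; rewrite lee_fin powR_ge0.
split; last by apply: Lfin => // x; rewrite lerDl powR_ge0.
split; [exact: Li|by exists (fun x => \row_j G j x)|].
by apply: Lfin => // x; rewrite ger0_norm// lerDr powR_ge0.
Qed.

End weight.

(** * The tube is an extension domain *)

Section norms.
Variables (R : realType) (n : nat).
Local Notation V := 'rV[R]_n.
Local Notation mu := (@lebesgue_rV R n).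
Implicit Types (D : set V) (u : V -> R).

Lemma Lp_norm_lty D (r : R) u : 0 < r -> (Lp_norm D r%:E u < +oo)%E ->
  (\int[mu]_(x in D) (`|u x| `^ r)%:E < +oo)%E.
Proof.
move=> r0; rewrite /Lp_norm unlock => /(@lty_poweRy _ _ r^-1).
rewrite invr_neq0 ?gt_eqF// => /(_ erefl); apply: le_lt_trans.
rewrite [leLHS]integral_mkcond le_eqVlt; apply/orP; left; apply/eqP.
apply: eq_integral => x _; rewrite !patchE; case: ifPn => _ //.
by rewrite abse0 poweR0r ?gt_eqF.
Qed.

Lemma W1p_norm_ge0 (p : \bar R) D u : (0 <= W1p_norm p D u)%E.
Proof. by case: p => [r| |]; rewrite /W1p_norm;
  [exact: poweR_ge0|exact: Lnorm_ge0|exact: Lnorm_ge0]. Qed.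

Lemma W1p_norm_lty (p : \bar R) D u : (0 < p)%E -> measurable D -> fs_mem (W1p p D) u ->
  (W1p_norm p D u < +oo)%E.
Proof.
move=> p0 mD [up un]; have [[um _] _ gn] := up.
have wg : is_weak_gradient D u (weak_gradient D u).
  by have [_ [g hg] _] := up; exact: weak_gradientP hg.
have mg : measurable_fun D (grad_norm D u).
  by apply: measurable_euclidean_norm => // j; have [[]] := wg j.
have g0 x : 0 <= grad_norm D u x by exact: euclidean_norm_ge0.
case: p p0 un gn {up} => [r| |]// r0 un gn.
  rewrite lte_fin in r0.
  have gn' := Lp_norm_lty r0 gn; have un' := Lp_norm_lty r0 un.
  rewrite /W1p_norm; apply: poweR_lty.
  under eq_integral do rewrite EFinD.
  have pm (f : V -> R) : measurable_fun D f ->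
    measurable_fun D (fun x => (f x `^ r)%:E).
    by move=> mf; apply/measurable_EFinP; exact: measurable_powR_comp.
  rewrite ge0_integralD//; last 3 first.
  - by apply: pm; exact: measurableT_comp.
  - by move=> x _; rewrite lee_fin powR_ge0.
  - exact: pm.
  apply: (lte_add_pinfty un'); apply: le_lt_trans gn'.
  by apply: ge0_le_integral => //;
    [move=> x _; rewrite lee_fin powR_ge0|exact: pm|
     apply: pm; exact: measurableT_comp|move=> x _; rewrite ger0_norm].
rewrite /W1p_norm; move: un gn; rewrite /Lp_norm unlock; case: ifPn => // _ un gn.
apply: le_lt_trans (lte_add_pinfty un gn); apply/ess_supP.
have := ess_sup_ge mu (abse \o ((EFin \o grad_norm D u) \_ D)).
have := ess_sup_ge mu (abse \o ((EFin \o u) \_ D)).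
apply: filterS2 => x h1 h2; apply: le_trans (leeD h1 h2).
rewrite /= !patchE; case: ifPn => _; last by rewrite abse0 adde0.
by rewrite /= -EFinD lee_fin; apply: le_trans (ler_normD _ _) _; rewrite normr_id.
Qed.

End norms.

(** * Geometry of the tube and volume of its beads *)

Section tube_domain.
Variables (R : realType) (N : nat) (ell : nat -> R).
Local Notation n := N.+1.
Local Notation V := 'rV[R]_n.
Local Notation mu := (@lebesgue_rV R n).
Hypothesis ell_gt0 : forall m, 0 < ell m.
Hypothesis ell_le1 : forall m, ell m <= 1.
Hypothesis ell_leS : forall m, ell m <= 2 * ell m.+1.
Hypothesis ell_geS : forall m, ell m.+1 <= 2 * ell m.
Hypothesis ell_pow : forall eps : R, 0 < eps ->
  exists B, forall m, \sum_(j < m) ell j `^ eps <= B.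
Opaque partial.

Local Notation T := (knot_sup ell).
Local Notation h := (tube_width ell).
Local Notation tube := (@tube R N ell).

Let ell_sum : exists B, forall m, \sum_(j < m) ell j <= B.
Proof.
have [B hB] := ell_pow ltr01; exists B => m; have := hB m.
by under eq_bigr do rewrite powRr1 ?(ltW (ell_gt0 _))//.
Qed.

Definition piece m : set V := tube `&` [set x | knot ell m <= `|x ord0 ord0| < knot ell
  m.+1].

Lemma tube_pieces : tube = \bigcup_m piece m.
Proof.
apply/seteqP; split => [x|x [m _ []]//] [xT xs].
by have [m xm] := knot_index ell_sum (normr_ge0 _) xT; exists m.
Qed.

Lemma trivIset_piece : trivIset setT piece.
Proof.
apply: ltn_trivIset => k m mk; rewrite -subset0 => x [[_ /= /andP[_ x2]] [_ /= /andP[x1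
  _]]].
have := lt_le_trans x2 (le_trans (knot_nd ell_gt0 mk) x1).
by rewrite ltxx.
Qed.

Lemma open_tube : open tube.
Proof.
rewrite (_ : tube = \bigcup_m ([set x : V | `|x ord0 ord0| < knot ell m] `&`
    [set x : V | forall i, i != ord0 -> `|x ord0 i| < width ell m (x ord0 ord0)])).
  apply: bigcup_open => m _.
  have oabs i (H : R -> R) : smooth1 H ->
    open [set x : V | `|x ord0 i| < H (x ord0 ord0)].
    move=> sH; have cH : continuous (fun x : V => H (x ord0 ord0)).
      by apply: smooth_continuous; apply: smooth_closure_smooth; apply: (sc_comp sH);
        exact: sc_coord.
    have ci : continuous (fun x : V => x ord0 i) by exact: coord_continuous.
    rewrite (_ : [set _ | _] = (fun x : V => H (x ord0 ord0) - x ord0 i) @^-1` [set y |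
      0 < y] `&`
        (fun x : V => H (x ord0 ord0) + x ord0 i) @^-1` [set y | 0 < y]).
      apply: openI; apply: open_comp.
      - by move=> x _; exact: (cvgB (cH x) (ci x)).
      - exact: open_gt.
      - by move=> x _; exact: (cvgD (cH x) (ci x)).
      - exact: open_gt.
    apply/seteqP; split => x /=; rewrite ltr_norml.
      by move=> /andP[? ?]; split; lra.
    by move=> [? ?]; apply/andP; split; lra.
  apply: openI; first by apply: (oabs ord0 (fun=> knot ell m));
    exact: smooth1_closure_smooth1 (s1_cst _).
  rewrite (_ : [set _ | _] = [set x : V | forall i, if i != ord0 then
      `|x ord0 i| < width ell m (x ord0 ord0) : Prop else True]).
    apply: open_forall => i; case: eqP => _ /=.
      by rewrite -[X in open X]/setT; exact: openT.
    by apply: oabs; exact: smooth_width.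
  by apply/seteqP; split => x /= hx i; have := hx i; case: eqP => //= _; exact.
apply/seteqP; split => [x [xT xs]|x [m _ [xm xs]]].
  have [m xm] := knot_cvg ell_sum xT; exists m => //; split=> // i i0.
  by rewrite -(tube_widthE ell_gt0 xm); exact: xs.
split; first exact: lt_trans (knot_lt ell_gt0 ell_sum m).
by move=> i i0 _; rewrite (tube_widthE ell_gt0 xm); exact: xs.
Qed.

Let mtube : measurable tube. Proof. exact: open_measurable_rV open_tube. Qed.

Lemma tube_neq0 : tube !=set0.
Proof.
exists 0; split; first by rewrite mxE normr0 knot_sup_gt0.
by move=> i _ _; rewrite !mxE normr0 tube_width_gt0// normr0 knot_sup_gt0.
Qed.

Lemma bounded_tube : bounded_set tube.
Proof.
apply: (@bounded_rV_sub _ _ _ (Num.max T 2)) => x [xT xs] i.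
have [->|i0] := eqVneq i ord0; first by rewrite le_max ltW.
rewrite le_max; apply/orP; right; apply: (le_trans (ltW (xs i i0 erefl))).
exact: tube_width_le2.
Qed.

(** Each point is joined to the axis by a segment orthogonal to it, and all these segments meet the
    connected set [L]. *)
Lemma connected_tube : connected tube.
Proof.
pose axis (t : R) : V := \row_i ((i == ord0)%:R * t).
pose L : set V := axis @` [set t | `|t| < T].
pose ray (x : V) (s : R) : V := \row_i (if i == ord0 then x ord0 ord0 else s * x ord0
  i).
pose S x : set V := ray x @` `[0, 1].
have cL : connected L.
  apply: connected_continuous_connected.
    apply/connected_intervalP => a b /=;
      rewrite !ltr_norml => /andP[a1 a2] /andP[b1 b2] c /andP[ac cb].
    by rewrite /= ltr_norml; apply/andP; split; lra.
  apply: continuous_subspaceT; apply: rV_continuous => i.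
  under eq_fun do rewrite mxE.
  by move=> t; apply: cvgM; [exact: cvg_cst|exact: cvg_id].
have cS x : connected (S x).
  apply: connected_continuous_connected; first exact: segment_connected.
  apply: continuous_subspaceT; apply: rV_continuous => i.
  under eq_fun do rewrite mxE.
  case: eqP => _; first exact: cst_continuous.
  by move=> t; apply: cvgM; [exact: cvg_id|exact: cvg_cst].
have axis0 (t : R) : axis t ord0 ord0 = t by rewrite mxE eqxx mul1r.
have -> : tube = \bigcup_(x in tube) (S x `|` L).
  apply/seteqP; split => [x xt|x [y [yT ys] []]].
  - exists x => //; left; exists 1; first by rewrite /= in_itv/= ler01 lexx.
    by apply/rowP => i; rewrite mxE; case: eqP => [->|_]; rewrite ?mul1r.
  - move=> [s]; rewrite /= in_itv/= => /andP[s0 s1] <-; split;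
      first by rewrite mxE eqxx.
    move=> i i0 _; rewrite !mxE (negbTE i0) eqxx.
    rewrite normrM ger0_norm// (le_lt_trans (ler_piMl _ s1))//.
    exact: ys.
  - move=> [t /= tT <-]; split; first by rewrite axis0.
    by move=> i i0 _; rewrite axis0 mxE (negbTE i0) mul0r normr0 tube_width_gt0.
apply: bigcup_connected.
  by exists (axis 0) => x _; right; exists 0; rewrite //= normr0 knot_sup_gt0.
move=> x [xT _]; apply: connectedU => //.
exists (axis (x ord0 ord0)); split; last by exists (x ord0 ord0).
exists 0; first by rewrite /= in_itv/= lexx ler01.
by apply/rowP => i; rewrite !mxE; case: eqP => _; rewrite ?mul1r ?mul0r.
Qed.

Lemma is_domain_tube : is_domain tube.
Proof. by split; [exact: tube_neq0|exact: open_tube|exact: connected_tube]. Qed.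

Lemma tube_measure_fin : (mu tube < +oo)%E.
Proof. exact: bounded_measure_fin bounded_tube mtube. Qed.

Lemma measurable_piece m : measurable (piece m).
Proof.
have mx : measurable_fun setT (fun x : V => `|x ord0 ord0|).
  by apply: measurableT_comp => //; exact: measurable_coord_rV.
have -> : piece m = tube `&`
    ((fun x : V => `|x ord0 ord0|) @^-1` `[knot ell m, knot ell m.+1[%classic).
  by apply/seteqP; split => x [xt]; rewrite /= in_itv/=.
by apply: measurableI => //; rewrite -[X in measurable X]setTI; exact: mx.
Qed.

Let box_measure (A : set (measurableTypeR R)) (b : R) : measurable A -> 0 <= b ->
  measurable [set x : V | A (x ord0 ord0) /\ forall i, i != ord0 -> `|x ord0 i| < b] /\
  mu [set x : V | A (x ord0 ord0) /\ forall i, i != ord0 -> `|x ord0 i| < b] =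
  (lebesgue_measure A * ((2 * b) ^+ N)%:E)%E.
Proof.
move=> mA b0; pose B (i : 'I_n) := if i == ord0 then A else `]-b, b[%classic.
have mB i : measurable (B i) by rewrite /B; case: eqP.
have -> : [set x : V | A (x ord0 ord0) /\ forall i, i != ord0 -> `|x ord0 i| < b] =
    [set x : V | forall i, B i (x ord0 i)].
  apply/seteqP; split => x /=.
    move=> [x0 xs] i; rewrite /B; case: eqP => [->//|/eqP i0].
    by rewrite /= in_itv/= -ltr_norml; exact: xs.
  move=> hx; split; first by have := hx ord0; rewrite /B eqxx.
  by move=> i i0; have := hx i; rewrite /B (negbTE i0)/= in_itv/= -ltr_norml.
split; first exact: measurable_coord_set.
rewrite lebesgue_rV_box// big_ord_recl {1}/B eqxx; congr (_ * _)%E.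
rewrite (eq_bigr (fun=> (2 * b)%:E)); last first.
  move=> i _; rewrite /B/= lebesgue_measure_itv/= lte_fin.
  case: ltP => h1; first by rewrite -EFinB; congr EFin; ring.
  suff -> : b = 0 by rewrite mulr0.
  by apply: le_anti; rewrite b0 andbT -(pmulrn_lle0 b (n := 2))// mulr2n -lerBrDr sub0r.
by rewrite prodEFin prodr_const card_ord.
Qed.

(** A piece lies in two boxes, one for each sign of [x_0], of length [ell m] and with [N] sides
    equal to [4 * ell m]. *)
Lemma piece_measure_le m : (mu (piece m) <= (2 * 4 ^+ N * ell m ^+ n)%:E)%E.
Proof.
pose A1 : set (measurableTypeR R) := `[knot ell m, knot ell m.+1[%classic.
pose A2 : set (measurableTypeR R) := `]- knot ell m.+1, - knot ell m]%classic.
have b0 : 0 <= 2 * ell m by rewrite mulr_ge0// ltW.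
pose B1 := [set x : V | A1 (x ord0 ord0) /\ forall i, i != ord0 ->
  `|x ord0 i| < 2 * ell m].
pose B2 := [set x : V | A2 (x ord0 ord0) /\ forall i, i != ord0 ->
  `|x ord0 i| < 2 * ell m].
have [m1 e1] : measurable B1 /\ mu B1 = (lebesgue_measure A1 * ((2 * (2 * ell m)) ^+
  N)%:E)%E.
  by apply: box_measure => //; exact: measurable_itv.
have [m2 e2] : measurable B2 /\ mu B2 = (lebesgue_measure A2 * ((2 * (2 * ell m)) ^+
  N)%:E)%E.
  by apply: box_measure => //; exact: measurable_itv.
have l1 : lebesgue_measure A1 = (ell m)%:E.
  by rewrite /A1 lebesgue_measure_itv/= lte_fin knot_ltS// -EFinB knotS [X in
    X%:E]addrAC subrr add0r.
have l2 : lebesgue_measure A2 = (ell m)%:E.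
  rewrite /A2 lebesgue_measure_itv/= lte_fin ltrN2 knot_ltS// -EFinB knotS.
  by congr EFin; ring.
apply: (@le_trans _ _ (mu (B1 `|` B2))).
  apply: le_measure; rewrite ?inE; [exact: measurable_piece|exact: measurableU|].
  move=> x [[xT xs] /= xm].
  have hx i : i != ord0 -> `|x ord0 i| < 2 * ell m.
    move=> i0; apply: (lt_le_trans (xs i i0 erefl)).
    by have /andP[] := tube_width_bounds ell_gt0 ell_leS ell_geS xm.
  have [x0|x0] := leP 0 (x ord0 ord0).
    by left; split=> //; move: xm; rewrite ger0_norm// /A1 /= in_itv.
  right; split=> //; move: xm; rewrite ltr0_norm// /A2 /= in_itv/= => /andP[? ?].
  by apply/andP; split; lra.
apply: le_trans (measureU2 _ m1 m2) _.
have -> : (mu B1 + mu B2 = ((ell m * (2 * (2 * ell m)) ^+ N) + (ell m * (2 * (2 * ell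
  m)) ^+ N))%:E)%E.
  by rewrite e1 e2 l1 l2 -!EFinM -EFinD.
rewrite lee_fin.
rewrite (_ : 2 * (2 * ell m) = 4 * ell m); last by ring.
by rewrite exprMn exprS le_eqVlt; apply/orP; left; apply/eqP; ring.
Qed.

(** The part with [x_0] nonnegative suffices: it contains a box of length and sides [ell m]. *)
Lemma piece_measure_ge m : ((ell m ^+ n)%:E <= mu (piece m))%E.
Proof.
pose A1 : set (measurableTypeR R) := `[knot ell m, knot ell m.+1[%classic.
have b0 : 0 <= ell m / 2 by rewrite divr_ge0// ltW.
have [m1 e1] := @box_measure A1 (ell m / 2) (measurable_itv _) b0.
have l1 : lebesgue_measure A1 = (ell m)%:E.
  by rewrite /A1 lebesgue_measure_itv/= lte_fin knot_ltS// -EFinB knotS [X in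
    X%:E]addrAC subrr add0r.
pose B1 := [set x : V | A1 (x ord0 ord0) /\ forall i, i != ord0 ->
  `|x ord0 i| < ell m / 2].
apply: (@le_trans _ _ (mu B1)).
  by rewrite e1 l1 -EFinM lee_fin mulrC [2 * _]mulrC divfK// exprS mulrC.
apply: le_measure; rewrite ?inE//; first exact: measurable_piece.
move=> x [] + xs; rewrite /A1 /= in_itv/= => xm.
have x0 : 0 <= x ord0 ord0 by rewrite (le_trans (knot_ge0 ell_gt0 m))//; case/andP: xm.
have xm' : knot ell m <= `|x ord0 ord0| < knot ell m.+1 by rewrite ger0_norm.
split=> //; split.
  by rewrite (lt_le_trans (andP xm').2)// ltW// knot_lt.
move=> i i0 _; apply: (lt_le_trans (xs i i0)).
by have /andP[] := tube_width_bounds ell_gt0 ell_leS ell_geS xm'.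
Qed.

Lemma tube_integral_fin (f : V -> R) (b : nat -> R) :
  measurable_fun tube f -> (forall x, 0 <= f x) ->
  (forall m x, piece m x -> f x <= b m) ->
  (exists B, forall m, \sum_(j < m) b j * ell j ^+ n <= B) ->
  (\int[mu]_(x in tube) (f x)%:E < +oo)%E.
Proof.
move=> mf f0 fb [B hB].
have mf' : measurable_fun tube (fun x => (f x)%:E) by exact/measurable_EFinP.
have mfp m : measurable_fun (piece m) (fun x => (f x)%:E).
  by apply: measurable_funS mf' => // x [].
(* Pieces have positive measure, hence a point at which to compare [b m] with [f]. *)
have b0 m : 0 <= b m.
  have [x xm] : piece m !=set0.
    apply/set0P/eqP => p0; have := piece_measure_ge m.
    by rewrite p0 measure0 lee_fin leNgt exprn_gt0.
  exact: le_trans (f0 x) (fb m x xm).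
rewrite tube_pieces ge0_integral_bigcup//; last 4 first.
- exact: measurable_piece.
- by rewrite -tube_pieces.
- by move=> x _; rewrite lee_fin.
- exact: trivIset_piece.
apply: (@le_lt_trans _ _ ((2 * 4 ^+ N * B)%:E)); last exact: ltry.
apply: lime_le.
  by apply: is_cvg_nneseries => k _ _; apply: integral_ge0 => x _; rewrite lee_fin.
apply: nearW => m.
apply: (@le_trans _ _ (\sum_(0 <= k < m) (2 * 4 ^+ N * (b k * ell k ^+ n))%:E)%E).
  apply: lee_sum => k _.
  apply: (@le_trans _ _ (\int[mu]_(x in piece k) (cst (b k)%:E x))%E).
    apply: ge0_le_integral => //; first exact: measurable_piece.
    - by move=> x _; rewrite lee_fin.
    - by move=> x kx; rewrite lee_fin; exact: fb.
  rewrite integral_cst; last exact: measurable_piece.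
  apply: le_trans (lee_wpmul2l _ (piece_measure_le k)) _; first by rewrite lee_fin.
  by rewrite -EFinM lee_fin mulrCA.
by rewrite sumEFin lee_fin -mulr_sumr ler_wpM2l// big_mkord.
Qed.

Lemma width_powR_integral (s : R) : 0 < s -> s < n%:R ->
  (\int[mu]_(x in tube) ((h (x ord0 ord0))^-1 `^ s)%:E < +oo)%E.
Proof.
move=> s0 sn; have mh := measurable_tube_width ell_gt0 ell_sum.
have h0 t : 0 <= h t by exact: tube_width_ge0.
apply: (@tube_integral_fin _ (fun m => 2 `^ s * (ell m)^-1 `^ s)).
- apply: measurable_powR_comp.
  exact: measurable_funS (@measurable_inv_width R N h mh h0).
- by move=> x; rewrite powR_ge0.
- move=> m x [_ /= xm]; have /andP[h1 _] :=
    tube_width_bounds ell_gt0 ell_leS ell_geS xm.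
  have em : 0 < ell m / 2 by rewrite divr_gt0.
  rewrite -powRM ?invr_ge0 ?(ltW (ell_gt0 _))// ge0_ler_powR ?nnegrE ?mulr_ge0
    ?invr_ge0 ?(ltW s0) ?(ltW (ell_gt0 _))//.
  rewrite -[leRHS]invrK invfM invrK mulrC lef_pV2// posrE//.
  exact: lt_le_trans h1.
have ns : 0 < n%:R - s by rewrite subr_gt0.
have [B hB] := ell_pow ns; exists (2 `^ s * B) => m.
apply: (@le_trans _ _ (2 `^ s * \sum_(j < m) ell j `^ (n%:R - s))).
  rewrite mulr_sumr ler_sum// => j _; rewrite -mulrA ler_wpM2l ?powR_ge0//.
  by rewrite -powR_mulrn ?(ltW (ell_gt0 _))// -powR_inv1 ?(ltW (ell_gt0 _))// -powRrM
    mulN1r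
    -powRD ?gt_eqF ?implybT// addrC.
by rewrite ler_wpM2l ?powR_ge0.
Qed.

Lemma tube_extension_domain (q : R) (p : \bar R) : 1 <= q -> q < n%:R / 2 ->
  ((q * n%:R / (n%:R - q))%:E < p)%E ->
  extension_domain (W1p p) (W1p q%:E) tube.
Proof.
move=> q1 qn qp; have q0 : 0 < q by rewrite (lt_le_trans ltr01).
have mh := measurable_tube_width ell_gt0 ell_sum.
have h0 t : 0 <= h t by exact: tube_width_ge0.
have h2 t : h t <= 2 by exact: tube_width_le2.
have hp (x : V) : tube x -> 0 < h (x ord0 ord0) by move=> [/tube_width_gt0 + _]; exact.
have [K0 K00 hK0] := hardy_weight_bound open_tube tube_measure_fin mh h0
  width_powR_integral q1 qn qp.
have [K K_ge0 hK] := @tube_extension R N ell ell_gt0 ell_leS ell_geS ell_sum q (ltW q0).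
pose L := ((2 `^ q + n%:R `^ q) * (K * K0)) `^ q^-1.
have a0 : ord0 \notin tube_axes N by rewrite mem_filter.
pose E (u : V -> R) := extend h (tube_axes N) (u \_ tube).
have key u (lam : R) : fs_mem (L1p p tube) u -> 0 < lam ->
  (W1p_norm p tube u <= lam%:E)%E ->
    [/\ fs_mem (W1p q%:E setT) (E u), forall x, tube x -> E u x = u x &
      (W1p_norm q%:E setT (E u) <= (L * lam)%:E)%E].
  move=> up lam0 ulam; have hu := hK0 u lam up lam0 ulam.
  have hufin := le_lt_trans hu (ltry _).
  have [w d] := hardy_weakly_differentiable open_tube tube_measure_fin mh hp h2 h0 q1
    up hufin.
  have [G' [Q' [w' d' q' e']]] := hK _ _ _ w d.
  have hQ' : (powint q Q' <= (K * (lam `^ q * K0))%:E)%E.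
    by rewrite (le_trans q')// EFinM lee_wpmul2l// lee_fin.
  have [mE nE] := dominated_W1p h2 q1 w' d' (le_lt_trans hQ' (ltry _)).
  split=> //; first by move=> x xt; rewrite /E e'// patchE mem_set.
  apply: (le_trans nE).
  apply: (@le_trans _ _ (((2 `^ q + n%:R `^ q) * (K * (lam `^ q * K0)))%:E `^ q^-1)%E).
    apply: gt0_ler_poweR; rewrite ?invr_ge0 ?(ltW q0)//.
    - rewrite in_itv/= leey andbT mule_ge0 ?lee_fin ?addr_ge0 ?powR_ge0//.
      by apply: integral_ge0 => x _; rewrite lee_fin powR_ge0.
    - by rewrite in_itv/= leey andbT lee_fin !mulr_ge0 ?addr_ge0 ?powR_ge0.
    - by rewrite EFinM lee_wpmul2l// lee_fin addr_ge0 ?powR_ge0.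
  rewrite poweR_EFin lee_fin (_ : _ * _ = (2 `^ q + n%:R `^ q) * (K * K0) * lam `^ q);
    last by ring.
  rewrite powRM ?powR_ge0 ?mulr_ge0 ?addr_ge0 ?powR_ge0// -powRrM mulfV ?gt_eqF//
    powRr1 ?(ltW lam0)//.
have fin u : fs_mem (W1p p tube) u -> (W1p_norm p tube u < +oo)%E.
  apply: W1p_norm_lty; last exact: open_measurable_rV open_tube.
  apply: lt_trans qp; rewrite lte_fin divr_gt0//; first by rewrite mulr_gt0.
  by rewrite subr_gt0 (lt_le_trans qn)// ler_pdivrMr// ler_peMr// ler1n.
have W0 u := W1p_norm_ge0 p tube u.
have good u : fs_mem (W1p p tube) u ->
  exists2 lam : R, 0 < lam & (W1p_norm p tube u <= lam%:E)%E.
  move=> /fin uf; exists (fine (W1p_norm p tube u) + 1).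
    by rewrite ltr_wpDl// fine_ge0.
  by rewrite EFinD fineK ?ge0_fin_numE// leeDl.
(* [L] may be 0, while the constant has to be positive. *)
exists E, (L + 1); split; first by rewrite ltr_wpDl// powR_ge0.
split.
- move=> u mu1; have [lam lam0 ulam] := good u mu1.
  by have [] := key u lam mu1.1 lam0 ulam.
- move=> u v _ _ uv; apply: filterS (extend_ae mh a0 _) => //.
    by move=> x ex _; exact: ex.
  move: uv; apply: filterS => x uvx; rewrite !patchE; case: ifPn => // xt.
  by apply: uvx; exact: set_mem.
- move=> u mu1; have [lam lam0 ulam] := good u mu1.
  have [_ Eu _] := key u lam mu1.1 lam0 ulam.
  by apply: nearW => x; exact: Eu.
move=> u mu1; have uf := fin u mu1.
change (W1p_norm q%:E setT (E u) <= (L + 1)%:E * W1p_norm p tube u)%E.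
have a1 : W1p_norm p tube u = (fine (W1p_norm p tube u))%:E by rewrite fineK//
  ge0_fin_numE.
have L0 : 0 <= L by exact: powR_ge0.
move: a1; set a := fine _ => a1; have : 0 <= a by rewrite fine_ge0.
rewrite le_eqVlt => /orP[/eqP a00|a_gt0]; last first.
  have ulam : (W1p_norm p tube u <= a%:E)%E by rewrite a1.
  have [_ _] := key u a mu1.1 a_gt0 ulam.
  by rewrite a1 => h1; rewrite (le_trans h1)// -EFinM lee_fin mulrDl mul1r lerDl ltW.
(* If the norm is 0, every positive [lam] bounds it, so the norm of the extension is below every
   [e > 0]. *)
rewrite a1 -a00 mule0; apply/lee_addgt0Pr => e e0.
have e1 : 0 < e / (L + 1) by rewrite divr_gt0// ltr_wpDl.
have [_ _] := key u _ mu1.1 e1 ltac:(by rewrite a1 -a00 lee_fin ltW).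
move=> h1; rewrite (le_trans h1)// add0e lee_fin mulrCA ler_piMr ?(ltW e0)//.
by rewrite ler_pdivrMr ?ltr_wpDl// mul1r lerDl.
Qed.

End tube_domain.

(** * Choice of the widths *)

Section sequences.
Variable R : realType.

Lemma sum_geometric_le (r : R) k : 0 <= r -> r < 1 -> \sum_(j < k) r ^+ j <= (1 - r)^-1.
Proof.
move=> r0 r1; have r1' : 0 < 1 - r by rewrite subr_gt0.
rewrite -[leRHS]mulr1 ler_pdivlMl//.
have -> : (1 - r) * \sum_(j < k) r ^+ j = 1 - r ^+ k.
  by apply: oppr_inj; rewrite -mulNr !opprB -subrX1.
by rewrite gerBl exprn_ge0.
Qed.

(** With truncated subtraction the exponent is the distance from [m] to [s]: each side of [s]
    contributes at most a geometric sum. *)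
Lemma sum_two_sided_geometric_le (r : R) s L : 0 <= r -> r < 1 ->
  \sum_(m < L) r ^+ ((m - s) + (s - m))%N <= 2 / (1 - r).
Proof.
move=> r0 r1.
suff : \sum_(m < L) r ^+ ((m - s) + (s - m))%N <= \sum_(j < s.+1) r ^+ j + \sum_(j < L)
  r ^+ j.
  move=> h; rewrite (le_trans h)// mulr_natl mulr2n lerD//; exact: sum_geometric_le.
have p0 k : 0 <= \sum_(j < k) r ^+ j by rewrite sumr_ge0// => i _; rewrite exprn_ge0.
elim: s L => [|s IH] L.
  under eq_bigr do rewrite subn0 sub0n addn0.
  by rewrite lerDr.
case: L => [|L]; first by rewrite big_ord0 addr_ge0.
rewrite big_ord_recl /= sub0n subn0 add0n.
under eq_bigr do rewrite /bump /= add1n !subSS.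
rewrite [in leRHS]big_ord_recr/= [X in _ <= _ + X]big_ord_recr/= addrC.
have h1 : \sum_(j < L) r ^+ j <= \sum_(j < L) r ^+ j + r ^+ L by rewrite lerDl
  exprn_ge0.
have := IH L; have := exprn_ge0 L r0.
set A := \sum_(i < L) _; set B := \sum_(j < s.+1) _; set C := \sum_(j < L) r ^+ j.
by move=> ? ?; lra.
Qed.

Lemma bead_widths (sigma : nat -> nat) : exists ell : nat -> R,
  [/\ (forall m, 0 < ell m) /\ (forall m, ell m <= 1),
      forall m, ell m <= 2 * ell m.+1, forall m, ell m.+1 <= 2 * ell m,
      forall eps : R, 0 < eps -> exists B, forall m, \sum_(j < m) ell j `^ eps <= B &
      forall k, 2^-1 ^+ k <= ell (sigma k)].
Proof.
pose c k m := (k + ((m - sigma k) + (sigma k - m)))%N.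
have /choice[e he] (m : nat) : exists e, (exists k, e = c k m) /\ forall k, (e <= c k
  m)%N.
  have ex : exists e, `[< exists k, e = c k m >] by exists (c 0 m); apply/asboolP;
    exists 0%N.
  case: (ex_minnP ex) => e /asboolP ke emin; exists e; split=> // k.
  by apply: emin; apply/asboolP; exists k.
(* A minimum of functions of [m] with increments at most 1 has increments at most 1, so consecutive
   widths differ by a factor 2 at most. *)
have e1 m : (e m.+1 <= (e m).+1)%N.
  have [[k ->] _] := he m; have [_ /(_ k)] := he m.+1.
  by move=> h; apply: (leq_trans h); rewrite /c; lia.
have e2 m : (e m <= (e m.+1).+1)%N.
  have [[k ->] _] := he m.+1; have [_ /(_ k)] := he m.
  by move=> h; apply: (leq_trans h); rewrite /c; lia.
have two : (2^-1 : R) * 2 = 1 by rewrite mulVf.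
have dec (a b : nat) : (a <= b)%N -> (2^-1 : R) ^+ b <= 2^-1 ^+ a.
  by move=> ab; apply: ler_wiXn2l => //; rewrite ?invr_ge0// invf_le1// ler1n.
exists (fun m => 2^-1 ^+ e m); split.
- split=> m; first by rewrite exprn_gt0.
  by rewrite exprn_ile1// invf_le1// ler1n.
- move=> m; rewrite (_ : 2^-1 ^+ e m = 2 * 2^-1 ^+ (e m).+1);
    last by rewrite exprS mulrA divff// mul1r.
  by rewrite ler_wpM2l// dec.
- move=> m; rewrite (_ : 2^-1 ^+ e m.+1 = 2 * 2^-1 ^+ (e m.+1).+1);
    last by rewrite exprS mulrA divff// mul1r.
  by rewrite ler_wpM2l// dec.
- move=> eps eps0; pose r : R := 2^-1 `^ eps.
  have r0 : 0 < r by rewrite powR_gt0.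
  have r1 : r < 1.
    apply: (@lt_le_trans _ _ (1 `^ eps)); last by rewrite powR1.
    by rewrite gt0_ltr_powR ?nnegrE// invf_lt1// ltr1n.
  exists (2 / (1 - r) * (1 - r)^-1) => L.
  have rE m : (2^-1 ^+ e m : R) `^ eps = r ^+ e m.
    by rewrite /r -powR_mulrn// -powRrM mulrC powRrM powR_mulrn ?powR_ge0.
  under eq_bigr do rewrite rE.
  have /choice[kk hk] (m : nat) : exists k, e m = c k m by have [] := he m.
  (* For [m < L] the minimum is attained at some [k < K], so [r ^ e m] is at most the sum of the
     [r ^ c k m] over these [k]. Summing over [m] first leaves a geometric sum in [k]. *)
  pose K := (\max_(m < L) kk m).+1.
  apply: (@le_trans _ _ (\sum_(m < L) \sum_(k < K) r ^+ c k m)).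
    apply: ler_sum => m _; have kK : (kk m < K)%N by rewrite ltnS;
      exact: (leq_bigmax m).
    rewrite (bigD1 (Ordinal kK))//= -hk lerDl sumr_ge0// => i _.
    by rewrite exprn_ge0// ltW.
  rewrite exchange_big/=.
  apply: (@le_trans _ _ (\sum_(k < K) r ^+ k * (2 / (1 - r)))).
    apply: ler_sum => k _; rewrite /c; under eq_bigr do rewrite exprD.
    by rewrite -mulr_sumr ler_wpM2l ?exprn_ge0 ?(ltW r0)// sum_two_sided_geometric_le//
      ltW.
  rewrite -mulr_suml mulrC ler_wpM2l ?sum_geometric_le ?(ltW r0)//.
  by rewrite divr_ge0// subr_ge0 ltW.
- move=> k; apply: dec; have [_ /(_ k)] := he (sigma k).
  by rewrite /c subnn !addn0.
Qed.

(* Any exponent in ]1/3, 1[ would do. *)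
Definition slow_decay (j : nat) : R := (j.+1%:R)^-1 `^ (2 / 3).

Lemma slow_decay_ge0 j : 0 <= slow_decay j. Proof. exact: powR_ge0. Qed.

Lemma slow_decay_le1 j : slow_decay j <= 1.
Proof.
apply: (@le_trans _ _ (1 `^ (2 / 3))); last by rewrite powR1.
by rewrite ge0_ler_powR ?nnegrE ?invr_ge0// ?divr_ge0// invf_le1// ler1n.
Qed.

Lemma sum_slow_decay_cube m : \sum_(j < m) slow_decay j ^+ 3 <= 2.
Proof.
have e j : slow_decay j ^+ 3 = (j.+1%:R)^-1 ^+ 2.
  by rewrite /slow_decay -powR_mulrn ?powR_ge0// -powRrM divfK// powR_mulrn.
under eq_bigr do rewrite e.
case: m => [|m]; first by rewrite big_ord0.
(* The sharper bound makes the induction telescope: [1 / (m+2)^2 <= 1 / (m+1) - 1 / (m+2)]. *)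
suff : \sum_(j < m.+1) (j.+1%:R : R)^-1 ^+ 2 <= 2 - (m.+1%:R)^-1.
  by move=> h; rewrite (le_trans h)// gerBl invr_ge0.
elim: m => [|m IH]; first by rewrite big_ord1/= invr1 expr1n; lra.
rewrite big_ord_recr/=; apply: le_trans (lerD IH (lexx _)) _.
have a0 : (m.+1%:R : R) != 0 by rewrite pnatr_eq0.
have b0 : (m.+2%:R : R) != 0 by rewrite pnatr_eq0.
rewrite -subr_ge0.
have -> : 2 - (m.+2%:R)^-1 - (2 - (m.+1%:R)^-1 + (m.+2%:R)^-1 ^+ 2) =
    (m.+1%:R)^-1 * (m.+2%:R)^-1 ^+ 2 :> R.
  move: a0 b0; have -> : m.+2%:R = m.+1%:R + 1 :> R by rewrite -natr1.
  by move: (m.+1%:R : R) => a a0 b0; field; rewrite b0 a0.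
by rewrite mulr_ge0 ?exprn_ge0 ?invr_ge0.
Qed.

(** Each of the [c ^ 3] terms is at least the power [- 2 / 3] of [c ^ 3], that is [c ^ - 2]. *)
Lemma sum_slow_decay_ge (c : nat) : (0 < c)%N -> c%:R <= \sum_(j < c ^ 3) slow_decay j.
Proof.
move=> c0; have c0' : (c%:R : R) != 0 by rewrite pnatr_eq0 -lt0n.
apply: (@le_trans _ _ (\sum_(j < c ^ 3) (c%:R)^-1 ^+ 2)).
  rewrite sumr_const card_ord -[leRHS]mulr_natl natrX.
  by rewrite le_eqVlt; apply/orP; left; apply/eqP; field.
apply: ler_sum => j _; rewrite /slow_decay.
have -> : (c%:R : R)^-1 ^+ 2 = ((c%:R)^-1 ^+ 3) `^ (2 / 3).
  have c1 : 0 <= (c%:R : R)^-1 by rewrite invr_ge0.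
  by rewrite -powR_mulrn// -[in RHS]powR_mulrn// -powRrM mulrC divfK.
rewrite ge0_ler_powR ?nnegrE ?exprn_ge0 ?invr_ge0// ?divr_ge0//.
rewrite exprVn lef_pV2 ?posrE ?exprn_gt0 ?ltr0n// -natrX ler_nat.
exact: ltn_ord.
Qed.

End sequences.

(** * The tube is not an extension domain *)

Section non_extension.
Variables (R : realType) (N : nat) (ell d : nat -> R).
Local Notation n := N.+1.
Local Notation V := 'rV[R]_n.
Local Notation mu := (@lebesgue_rV R n).
Hypothesis ell_gt0 : forall m, 0 < ell m.
Hypothesis ell_le1 : forall m, ell m <= 1.
Hypothesis ell_leS : forall m, ell m <= 2 * ell m.+1.
Hypothesis ell_geS : forall m, ell m.+1 <= 2 * ell m.
Hypothesis ell_pow : forall eps : R, 0 < eps ->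
  exists B, forall m, \sum_(j < m) ell j `^ eps <= B.
Hypothesis d_ge0 : forall j, 0 <= d j.
Hypothesis d_sum : exists B, forall m, \sum_(j < m) d j ^+ n <= B.
Hypothesis d_large : forall B, exists m, B <= (\sum_(j < m) d j) * ell m ^+ n.
Opaque partial.

Local Notation T := (knot_sup ell).
Local Notation tube := (@tube R N ell).
Local Notation piece := (@piece R N ell).

Let ell_sum : exists B, forall m, \sum_(j < m) ell j <= B.
Proof.
have [B hB] := ell_pow ltr01; exists B => m; have := hB m.
by under eq_bigr do rewrite powRr1 ?(ltW (ell_gt0 _))//.
Qed.

Let otube : open tube.
Proof. exact: open_tube. Qed.

Let mtube : measurable tube. Proof. exact: open_measurable_rV otube. Qed.

Definition profile : R -> R := truncated_limit (knot ell) id (step_fun ell d).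
Definition profile_slope : R -> R :=
  truncated_limit (knot ell) id (fun m => derive1 (step_fun ell d m)).

Lemma profileE m t : `|t| < knot ell m -> profile t = step_fun ell d m t.
Proof. exact: (truncated_limitE (knot_nd ell_gt0) (stable_step_fun ell_gt0 d)). Qed.

Lemma profile_slopeE m t : `|t| < knot ell m ->
  profile_slope t = derive1 (step_fun ell d m) t.
Proof. exact: (truncated_limitE (knot_nd ell_gt0) (stable_derive1_step_fun ell_gt0 d)).
  Qed.

Lemma measurable_profile : measurable_fun setT profile.
Proof.
apply: (measurable_truncated_limit (knot_lt ell_gt0 ell_sum) (knot_nd ell_gt0)
  (knot_cvg ell_sum) (stable_step_fun ell_gt0 d)) => // m.
by apply: measurable_smooth1; exact: smooth_step_fun.
Qed.

Lemma measurable_profile_slope : measurable_fun setT profile_slope.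
Proof.
apply: (measurable_truncated_limit (knot_lt ell_gt0 ell_sum) (knot_nd ell_gt0)
  (knot_cvg ell_sum) (stable_derive1_step_fun ell_gt0 d)) => // m.
by apply: measurable_smooth1; have [] := smooth1_derive (smooth_step_fun ell d m).
Qed.

Definition axial (f : R -> R) : V -> R := fun x => f (x ord0 ord0).

(** The function may be unbounded towards the ends, but a compact subset of the tube meets finitely
    many beads only. *)
Lemma L1loc_axial (f : R -> R) (B : nat -> R) : measurable_fun setT f ->
  (forall m t, `|t| < knot ell m -> `|f t| <= B m) -> L1loc tube (axial f).
Proof.
move=> mf fB; have mfx : measurable_fun setT (axial f).
  by apply: (measurableT_comp mf); exact: measurable_coord_rV.
split; first exact: measurable_funS mfx.
move=> K cK Kt.
have [m Km] := compact_knot ell_gt0 ell_sum cK (fun x Kx => (Kt x Kx).1).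
have mK := compact_measurable_rV cK.
apply: measurable_bounded_integrable => //.
- exact: bounded_measure_fin (compact_bounded cK) mK.
- exact: measurable_funS mfx.
- exists `|B m|; split; first exact: num_real.
  move=> y By x Kx; rewrite /= (le_trans (fB m _ _))//; first exact: Km.
  by rewrite (le_trans (ler_norm _))// ltW.
Qed.

Variable M : R.
Hypothesis M_ge : forall x : R, `|derive1 (@smoothstep R) x| <= M.

Let M_ge0 : 0 <= M. Proof. exact: le_trans (M_ge 0). Qed.

Lemma L1loc_profile : L1loc tube (axial profile).
Proof.
apply: (L1loc_axial (B := fun m => \sum_(j < m) d j) measurable_profile) => m t tm.
rewrite (profileE tm) /step_fun; apply: le_trans (ler_norm_sum _ _ _) _.
apply: ler_sum => j _; rewrite normrM ger0_norm// ler_piMr// ger0_norm ?knot_step_ge0//.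
exact: knot_step_le1.
Qed.

Lemma L1loc_profile_slope : L1loc tube (axial profile_slope).
Proof.
apply: (L1loc_axial (B := fun m => \sum_(j < m) d j * (M / ell j))
  measurable_profile_slope) => m t tm.
rewrite (profile_slopeE tm) derive1_step_fun; apply: le_trans (ler_norm_sum _ _ _) _.
apply: ler_sum => j _; rewrite normrM ger0_norm// ler_wpM2l//.
exact: derive1_knot_step_bound.
Qed.

(** On the support of a test function the profile is a smooth [step_fun], and integration by parts
    is [integral_partial0] for its product with the test function. *)
Lemma weak_gradient_axial_profile : is_weak_gradient tube (axial profile)
  (fun x => \row_j ((j == ord0)%:R * axial profile_slope x)).
Proof.
move=> j; under eq_fun do rewrite mxE; split.
  have [ms is_] := L1loc_profile_slope; split; first exact: measurable_funM.
  move=> K cK Kt; have h := is_ K cK Kt.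
  exact: (integrableZl (compact_measurable_rV cK) ((j == ord0)%:R) h).
move=> phi tphi; have [sphi kphi phit] := tphi.
have [m Km] := compact_knot ell_gt0 ell_sum kphi (fun x Kx => (phit x Kx).1).
pose F (x : V) := step_fun ell d m (x ord0 ord0).
have sf := smooth_step_fun ell d m.
have [sdf df] := smooth1_derive sf.
have sF : smooth F.
  by apply: smooth_closure_smooth; apply: (sc_comp sf); exact: sc_coord.
have sdF : smooth (fun x : V => (j == ord0)%:R * derive1 (step_fun ell d m) (x ord0
  ord0)).
  apply: smooth_closure_smooth; apply: sc_mul; first exact: sc_cst.
  by apply: (sc_comp sdf); exact: sc_coord.
have pF x : partial j F x = (j == ord0)%:R * derive1 (step_fun ell d m) (x ord0 ord0).
  by rewrite mulrC; apply: partialE; apply: (is_derive_compR (df _));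
    exact: is_derive_coord.
have sFp := smoothM sF sphi.
have cs (f : V -> R) : smooth f -> (forall x, ~ tsupport phi x -> f x = 0) ->
    mu.-integrable setT (EFin \o f).
  move=> sf' f0; apply: integrable_compact_support; first exact: smooth_continuous.
  apply: (subclosed_compact _ kphi); first exact: closed_closure.
  by apply: tsupport_sub => //; exact: closed_closure.
have kFp : compact (tsupport (fun x => F x * phi x)).
  apply: (subclosed_compact _ kphi); first exact: closed_closure.
  apply: tsupport_sub; first exact: closed_closure.
  by move=> x nx; rewrite (tsupport_eq0 nx) mulr0.
have := integral_partial0 j sFp kFp.
have -> : partial j (fun x => F x * phi x) =
    fun x => F x * partial j phi x + (j == ord0)%:R * derive1 (step_fun ell d m) (x
      ord0 ord0) * phi x.
  apply/funext => x; rewrite -pF [_ * phi x]mulrC.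
  by apply: partialE; apply: is_deriveM; exact: smooth_is_derive.
have i1 : mu.-integrable setT (EFin \o (fun x => F x * partial j phi x)).
  apply: cs; first exact: smoothM sF (smooth_partial j sphi).
  by move=> x nx; rewrite (partial_tsupport j nx) mulr0.
have i2 : mu.-integrable setT (EFin \o (fun x : V =>
    (j == ord0)%:R * derive1 (step_fun ell d m) (x ord0 ord0) * phi x)).
  apply: cs; first exact: smoothM sdF sphi.
  by move=> x nx; rewrite (tsupport_eq0 nx) mulr0.
rewrite (RintegralD measurableT i1 i2) => /eqP; rewrite addr_eq0 => /eqP e.
have toT (f g : V -> R) : (forall x, tsupport phi x -> f x = g x) ->
    (forall x, ~ tsupport phi x -> f x = 0) -> (forall x, ~ tsupport phi x ->
      g x = 0) ->
    \int[mu]_(x in tube) f x = \int[mu]_x g x.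
  move=> fg f0 g0; rewrite /Rintegral integral_mkcond; congr fine.
  apply: eq_integral => x _; rewrite patchE; case: ifPn => xt.
    have [px|px] := pselect (tsupport phi x); first by rewrite fg.
    by rewrite f0// g0.
  by rewrite g0// => /phit/mem_set tx; rewrite tx in xt.
rewrite (toT _ (fun x => F x * partial j phi x)); first rewrite e; first congr (- _).
- symmetry; apply: toT => x.
  + by move=> px; rewrite mxE /axial (profile_slopeE (Km _ px)).
  + by move=> px; rewrite (tsupport_eq0 px) mulr0.
  + by move=> px; rewrite (tsupport_eq0 px) mulr0.
- by move=> x px; rewrite /axial (profileE (Km _ px)).
- by move=> x px; rewrite (partial_tsupport j px) mulr0.
- by move=> x px; rewrite (partial_tsupport j px) mulr0.
Qed.

Lemma L1p_axial_profile (r : R) : 0 < r -> r <= n%:R ->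
  fs_mem (L1p r%:E tube) (axial profile).
Proof.
move=> r0 rn; have wg := weak_gradient_axial_profile.
split; [exact: L1loc_profile|by eexists; exact: wg|].
have wg' := weak_gradientP wg.
have aeg := weak_gradient_unique otube wg' wg.
have mg : measurable_fun tube (grad_norm tube (axial profile)).
  by apply: measurable_euclidean_norm => // j; have [[]] := wg' j.
have msl : measurable_fun setT (axial profile_slope).
  by apply: (measurableT_comp measurable_profile_slope); exact: measurable_coord_rV.
have mf : measurable_fun tube (fun x => (n%:R * `|axial profile_slope x|) `^ r).
  apply: measurable_powR_comp; apply: measurable_funM => //.
  by apply: measurableT_comp => //; exact: measurable_funS msl.
have g0 x : 0 <= grad_norm tube (axial profile) x by exact: euclidean_norm_ge0.
have fin : (\int[mu]_(x in tube) ((n%:R * `|axial profile_slope x|) `^ r)%:E < +oo)%E.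
  apply: (tube_integral_fin ell_gt0 ell_leS ell_geS ell_pow (b :=
    fun m => (n%:R * (d m * (M / ell m))) `^ r) mf).
  - by move=> x; exact: powR_ge0.
  - move=> m x [_ /= xm]; apply: ge0_ler_powR; rewrite ?nnegrE ?mulr_ge0 ?(ltW r0)//.
      by rewrite invr_ge0 ltW.
    rewrite ler_wpM2l// /axial (profile_slopeE (andP xm).2) (derive1_step_fun_eq
      ell_gt0 _ (ltnSn m) xm).
    by rewrite normrM ger0_norm// ler_wpM2l//; exact: derive1_knot_step_bound.
  have [B hB] := d_sum; have [B' hB'] := ell_pow (ltr0Sn R N).
  exists (B' + (n%:R * M) ^+ n * B) => m.
  apply: (@le_trans _ _ (\sum_(j < m) (ell j `^ n%:R + (n%:R * M) ^+ n * d j ^+ n))).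
    apply: ler_sum => j _.
    have x0 : 0 <= n%:R * (d j * (M / ell j)) by rewrite !mulr_ge0 ?invr_ge0 ?(ltW
      (ell_gt0 _)).
    (* For [r <= n], [t ^ r <= 1 + t ^ n]. Multiplied by the volume [ell j ^ n], the second term
       loses its dependence on [ell j] and becomes a multiple of [d j ^ n]; the first is summable by
       [ell_pow]. *)
    have h : (n%:R * (d j * (M / ell j))) `^ r <= 1 + (n%:R * (d j * (M / ell j))) ^+ n.
      rewrite -(powR_mulrn _ x0); have [x1|x1] := leP (n%:R * (d j * (M / ell j))) 1.
        apply: (@le_trans _ _ (1 `^ r)); last by rewrite powR1 lerDl powR_ge0.
        by rewrite ge0_ler_powR ?nnegrE ?(ltW r0).
      by rewrite (le_trans (ler_powR (ltW x1) rn))// lerDr.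
    apply: le_trans (ler_wpM2r _ h) _; first by rewrite exprn_ge0// ltW.
    rewrite mulrDl mul1r powR_mulrn ?(ltW (ell_gt0 _))// lerD2l -!exprMn.
    rewrite le_eqVlt; apply/orP; left; apply/eqP; congr (_ ^+ _).
    by field; rewrite gt_eqF.
  rewrite big_split/=; apply: lerD; first exact: hB'.
  by rewrite -mulr_sumr; apply: ler_wpM2l; [rewrite exprn_ge0// mulr_ge0|exact: hB].
rewrite /Lp_norm unlock; apply: poweR_lty; apply: le_lt_trans fin.
have -> : (\int[mu]_x `|((EFin \o grad_norm tube (axial profile)) \_ tube) x| `^ r =
    \int[mu]_(x in tube) (grad_norm tube (axial profile) x `^ r)%:E)%E.
  rewrite [RHS]integral_mkcond; apply: eq_integral => x _; rewrite !patchE;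
    case: ifPn => _.
    by rewrite /= ger0_norm.
  by rewrite abse0 poweR0r ?gt_eqF.
apply: ae_ge0_le_integral => //.
- by move=> x _; rewrite lee_fin powR_ge0.
- by apply/measurable_EFinP; exact: measurable_powR_comp.
- exact/measurable_EFinP.
move: aeg; apply: filterS => x gx tx; rewrite lee_fin.
apply: ge0_ler_powR; rewrite ?nnegrE ?mulr_ge0 ?(ltW r0)// /grad_norm gx//.
apply: euclidean_norm_le => j; rewrite mxE normrM.
by case: eqP => _ /=; rewrite ?normr1 ?mul1r// normr0 mul0r.
Qed.

(** On the m-th piece the function has already climbed the first [m] steps, so [d_large] makes its
    integral over suitable pieces as large as desired. *)
Lemma integral_axial_profile : (\int[mu]_(x in tube) `|axial profile x|%:E = +oo)%E.
Proof.
have mpr : measurable_fun setT (axial profile).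
  by apply: (measurableT_comp measurable_profile); exact: measurable_coord_rV.
have mp D : measurable_fun D (fun x => `|axial profile x|%:E).
  by apply/measurable_EFinP; apply: measurableT_comp => //; exact: measurable_funS mpr.
apply/eqyP => B B0; have [m hm] := d_large B.
have F0 : 0 <= \sum_(j < m) d j by exact: sumr_ge0.
have mpi : measurable (piece m) by exact: measurable_piece.
apply: (@le_trans _ _ (\int[mu]_(x in piece m) `|axial profile x|%:E)%E); last first.
  by apply: ge0_subset_integral => // x [].
apply: (@le_trans _ _ (\int[mu]_(x in piece m) (cst (\sum_(j < m) d j)%:E x))%E).
  rewrite integral_cst//.
  apply: (@le_trans _ _ ((\sum_(j < m) d j)%:E * (ell m ^+ n)%:E)%E).
    by rewrite -EFinM lee_fin.
  by apply: lee_wpmul2l; [rewrite lee_fin|exact: piece_measure_ge].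
apply: ge0_le_integral => //.
move=> x [_ /= xm]; rewrite lee_fin /axial (profileE (andP xm).2).
rewrite (step_funE ell_gt0 d (andP xm).1); apply: le_trans (ler_norm _).
by rewrite lerDl mulr_ge0// knot_step_ge0.
Qed.

Lemma tube_not_extension_domain (q : R) (p : \bar R) : 1 <= q ->
  (q%:E < p)%E -> (p <= n%:R%:E)%E -> ~ extension_domain (L1p p) (L1p q%:E) tube.
Proof.
move=> q1; case: p => [r| |]//; rewrite lte_fin lee_fin => qr rn [E [C [_ [memE _ aeE
  _]]]].
have r0 : 0 < r by rewrite (lt_trans _ qr)// (lt_le_trans ltr01).
have up := L1p_axial_profile r0 rn.
have [[_ Eloc] _ _] := memE _ up; have aeu := aeE _ up.
have bt : bounded_set tube by exact: bounded_tube.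
have [A A0 tA] := bounded_rV bt.
(* The tube is bounded, hence inside a compact box, on which the extension would be integrable. *)
have cK := @compact_closed_box R n (fun=> - A) (fun=> A).
have tK : tube `<=` [set y : V | forall i, - A <= y ord0 i <= A].
  by move=> x /tA xA i; rewrite -ler_norml ltW.
have iE : mu.-integrable tube (EFin \o E (axial profile)).
  by apply: integrableS (Eloc _ cK _) => //; exact: compact_measurable_rV cK.
have /integrableP[mE fE] := iE.
have := integral_axial_profile; apply/eqP; rewrite lt_eqF//; apply: le_lt_trans fE.
have mpr : measurable_fun setT (axial profile).
  by apply: (measurableT_comp measurable_profile); exact: measurable_coord_rV.
apply: ae_ge0_le_integral => //.
- by apply/measurable_EFinP; apply: measurableT_comp => //; exact: measurable_funS mpr.
- exact: measurableT_comp.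
by move: aeu; apply: filterS => x ex tx; rewrite /= ex.
Qed.

End non_extension.

Theorem theorem1p1 (R : realType) (n : nat) (q : R)
    (n_gt0 : (0 < n)%N) (q_ge1 : 1 <= q) (q_lt : q < n%:R / 2) :
  let qstar := q * n%:R / (n%:R - q) in
  exists Omega : set 'rV[R]_n,
    [/\ is_domain Omega,
        bounded_set Omega,
        forall p : \bar R, (qstar%:E < p)%E -> (p <= +oo)%E ->
          extension_domain (W1p p) (W1p q%:E) Omega &
        forall p : \bar R, (q%:E < p)%E -> (p <= n%:R%:E)%E ->
          ~ extension_domain (L1p p) (L1p q%:E) Omega].
Proof.
case: n n_gt0 q_lt => // N _ q_lt /=.
(* [1 <= q < n / 2] forces the dimension [N + 1] to be at least 3, so that the cubes of [slow_decay]
   bound its powers of exponent [N + 1]. *)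
have N2 : (2 <= N)%N.
  rewrite leqNgt; apply/negP => N2; have : (N.+1%:R : R) <= 2 by rewrite ler_nat.
  lra.
(* Up to sigma_k = c ^ 3, where c = 2 ^ ((N + 2) k), the sum of the increments
   is at least c, while the volume of the bead is at least 2 ^ (- (N + 1) k). *)
have [ell [[ell0 ell1] ellS elS ellp ells]] :=
  bead_widths R (fun k => (2 ^ (k * N.+2)) ^ 3)%N.
have [M M0 hM] := @smoothstep_derive_bounded R.
have dsum : exists B : R, forall m, \sum_(j < m) slow_decay R j ^+ N.+1 <= B.
  exists 2 => m; apply: le_trans (sum_slow_decay_cube R m); apply: ler_sum => j _.
  by rewrite ler_wiXn2l ?slow_decay_ge0 ?slow_decay_le1.
have dlarge (B : R) : exists m, B <= (\sum_(j < m) slow_decay R j) * ell m ^+ N.+1.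
  have [k hk] : exists k : nat, B <= k%:R.
    exists (Num.bound `|B|); rewrite (le_trans (ler_norm _))// ltW//.
    exact: archi_boundP.
  exists ((2 ^ (k * N.+2)) ^ 3)%N; apply: (le_trans hk).
  have c0 : (0 < 2 ^ (k * N.+2))%N by rewrite expn_gt0.
  (* The product in the middle is [2 ^ k], which exceeds [k]. *)
  apply: (@le_trans _ _ ((2 ^ (k * N.+2))%:R * (2^-1 ^+ k) ^+ N.+1)); last first.
    apply: ler_pM => //; first exact: sum_slow_decay_ge.
    by rewrite lerXn2r ?nnegrE ?exprn_ge0 ?(ltW (ell0 _)).
  rewrite natrX -exprM mulnS exprD -mulrA exprVn mulfV ?mulr1 ?expf_neq0//.
  by rewrite -natrX ler_nat ltnW// ltn_expl.
exists (tube (R := R) (N := N) ell); split.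
- exact: is_domain_tube.
- exact: bounded_tube.
- by move=> p qp _; exact: tube_extension_domain.
- move=> p; exact: (tube_not_extension_domain ell0 ell1 ellS elS ellp
    (@slow_decay_ge0 R) dsum dlarge hM q_ge1).
Qed.
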